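(* Let $K$ be a totally real number field of degree $n\ge 2$ with ring of integers $\mathcal{O}_K$ and discriminant $d_K$, and let $\mathcal{O}_K^{0}=\{\alpha\in\mathcal{O}_K : \operatorname{Tr}_{K/\mathbb{Q}}(\alpha)=0\}$. Suppose $d_K$ is a fundamental discriminant and $\gcd(n,d_K)=1$. Then the theta series $$\theta_K(z):=\sum_{\alpha\in\mathcal{O}_K^{0}} e^{\pi i\,\operatorname{Tr}_{K/\mathbb{Q}}(\alpha^2)\,z}\qquad (z\in\mathbb{H})$$ satisfies $$\theta_K\in M_{\frac{n-1}{2}}\!\left(\Gamma_0(2nd_K),\ \left(\frac{\delta_n\, n\, d_K}{\cdot}\right)\right),\qquad \delta_n=\begin{cases}(-1)^{\frac{n-1}{2}} & n \text{ odd},\\ \tfrac12 & n\text{ even}.\end{cases}$$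
   Context: $\mathbb{H}$ is the complex upper half-plane. The symbol $\left(\frac{a}{b}\right)$ for integers $a,b$ is the quadratic residue (Kronecker) symbol determined by: for an odd prime $p$ it is the Legendre symbol; for odd $a$, $\left(\frac{a}{2}\right)=(-1)^{(a^2-1)/8}$; $\left(\frac{a}{-1}\right)=1$ if $a\ge 0$ and $-1$ if $a<0$; $\left(\frac{a}{b}\right)=0$ if $\gcd(a,b)>1$; $\left(\frac{1}{0}\right)=1$ and $\left(\frac{a}{0}\right)=0$ for $a\ne 1$; and $\left(\frac{a}{bc}\right)=\left(\frac{a}{b}\right)\left(\frac{a}{c}\right)$. For nonzero $d$, write $d=d_fd_s^2$ with $d_f$ squarefree and set $D_d=d_f$ if $d_f\equiv 1\pmod 4$ and $D_d=4d_f$ otherwise; $\chi_d(m):=\left(\frac{D_d}{m}\right)$. For $k\in\mathbb{Z}$, $N\ge1$ (with $4\mid N$ if $k$ odd) and a Dirichlet character $\chi$ mod $N$, $M_{k/2}(\Gamma_0(N),\chi)$ is the space of holomorphic $f:\mathbb{H}\to\mathbb{C}$, holomorphic at every cusp of $\Gamma_0(N)$, such that for all $\gamma=\begin{pmatrix}a&b\\c&d\end{pmatrix}\in\Gamma_0(N)$: $f(\gamma z)=\chi(d)(cz+d)^{k/2}f(z)$ if $k$ is even, and $f(\gamma z)=\chi(d)\chi_c(d)^k\varepsilon_d^{-k}(cz+d)^{k/2}f(z)$ if $k$ is odd, where $\varepsilon_d=1$ if $d\equiv1\pmod 4$ and $\varepsilon_d=i$ if $d\equiv 3\pmod 4$.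 *)

(* Defs.v *)
From HB Require Import structures.
From mathcomp Require Import all_boot all_order all_algebra all_field.
From mathcomp Require Import complex.
From mathcomp Require Import all_classical all_reals all_analysis.
From mathcomp.analysis.showcase Require Import summability.

Set Implicit Arguments.
Unset Strict Implicit.
Unset Printing Implicit Defensive.

Import Order.TTheory GRing.Theory Num.Theory.
Import numFieldNormedType.Exports.

Local Open Scope classical_set_scope.
Local Open Scope ring_scope.
Local Open Scope complex_scope.

Definition squarefree (m : int) : Prop :=
  forall s : int, (s ^+ 2 %| m)%Z -> `|s|%N = 1%N.

Definition fundamental_discriminant (D : int) : Prop :=
  ((D = 1 %[mod 4])%Z /\ squarefree D) \/
  exists m : int, [/\ D = 4 * m, squarefree m &
                      (m = 2 %[mod 4])%Z \/ (m = 3 %[mod 4])%Z].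

Definition legendre (a : int) (p : nat) : int :=
  if (p%:Z %| a)%Z then 0
  else if [exists x : 'I_p, ((x%:Z ^+ 2 == a %[mod p%:Z])%Z)] then 1 else -1.

Definition kronecker_prime (a : int) (p : nat) : int :=
  if p == 2%N then
    if (2 %| a)%Z then 0 else (-1) ^ ((a ^+ 2 - 1) %/ 8)%Z
  else legendre a p.

(* The rule (a/b) = 0 for gcd(a,b) > 1 needs no separate clause: a common
   prime factor contributes a zero factor to the product, and (a/0) = 0 as
   soon as a <> 1. *)
Definition kronecker (a b : int) : int :=
  if b == 0 then (a == 1)%:R
  else (if (b < 0) && (a < 0) then -1 else 1) *
       \prod_(q <- prime_decomp `|b|%N) kronecker_prime a q.1 ^+ q.2.

(* The squarefree d_f (of the sign of d) with d = d_f * d_s ^ 2. *)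
Definition squarefree_part (d : int) : int :=
  sgz d * \prod_(p <- primes `|d|%N) (p ^ odd (logn p `|d|))%N%:Z.

Definition quad_disc (d : int) : int :=
  let df := squarefree_part d in
  if (df == 1 %[mod 4])%Z then df else 4 * df.

(* Only d <> 0 matters mathematically, except that the automorphy factor of
   half-integral weight evaluates quad_char 0 at 1 and -1 (matrices with lower
   left entry 0). There quad_disc 0 = 0, so quad_char 0 takes the value
   (0/1) = (0/-1) = 1, which is Shimura's convention. *)
Definition quad_char (d m : int) : int := kronecker (quad_disc d) m.

Section NumberField.
Variable K : fieldExtType rat.

Definition algebraic_integer (x : K) : Prop :=
  integralOver (intr : int -> K) x.

Definition field_trace (x : K) : rat :=
  \tr (passmx.mxof (vbasis {:K}) (vbasis {:K}) (amulr x)).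

Definition integral_basis (n : nat) (w : 'I_n -> K) : Prop :=
  (forall i, algebraic_integer (w i)) /\
  (forall x, algebraic_integer x ->
     exists! c : {ffun 'I_n -> int}, x = \sum_i w i *~ c i).

Definition is_discriminant (d : int) : Prop :=
  exists2 w : 'I_(\dim {:K}) -> K, integral_basis w &
    d%:~R = \det (\matrix_(i, j) field_trace (w i * w j)).

Definition totally_real (R : realType) : Prop :=
  forall (sigma : {rmorphism K -> R[i]}) (x : K), complex.Im (sigma x) = 0.

Definition trace_zero_integers : set K :=
  [set x | algebraic_integer x /\ field_trace x = 0].

End NumberField.

Arguments is_discriminant K d : clear implicits.
Arguments totally_real K R : clear implicits.
Arguments trace_zero_integers K : clear implicits.

Section ModularForms.
Variable R : realType.
Implicit Types (f : R[i] -> R[i]) (chi : int -> R[i]) (g : 'M[int]_2).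

Definition cexp (z : R[i]) : R[i] :=
  (expR (complex.Re z))%:C * (cos (complex.Im z) +i* sin (complex.Im z)).

Definition upper_half_plane : set R[i] := [set z | 0 < complex.Im z].

(* Differentiability along 1 over the scalar field R[i] is the existence of
   the complex derivative. *)
Definition holomorphic_on_H f : Prop :=
  forall z, upper_half_plane z -> derivable (f : R[i]^o -> R[i]^o) z 1.

(* w^(k/2), computed with the principal square root: the argument of sqrtc w
   lies in ]-pi/2, pi/2] (contrary to that of the generic sqrtC). *)
Definition half_power (w : R[i]) (k : int) : R[i] := sqrtc w ^ k.

Definition SL2Z : set 'M[int]_2 := [set g | \det g = 1].

Definition Gamma0 (N : int) : set 'M[int]_2 :=
  [set g | SL2Z g /\ (N %| g 1%R 0%R)%Z].

Definition denom g (z : R[i]) : R[i] := (g 1 0)%:~R * z + (g 1 1)%:~R.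

Definition moebius g (z : R[i]) : R[i] :=
  ((g 0 0)%:~R * z + (g 0 1)%:~R) / denom g z.

Definition dirichlet_character (N : int) chi : Prop :=
  [/\ forall m, (chi m != 0) = coprimez m N,
      forall m m', chi (m * m') = chi m * chi m' &
      forall m, chi (m + N) = chi m].

Definition epsilon (d : int) : R[i] :=
  if (d == 1 %[mod 4])%Z then 1 else 'i.

Definition automorphy_factor (k : int) chi g (z : R[i]) : R[i] :=
  if (2 %| k)%Z then chi (g 1 1) * half_power (denom g z) k
  else chi (g 1 1) * (quad_char (g 1 0) (g 1 1))%:~R ^ k
       * epsilon (g 1 1) ^ (- k) * half_power (denom g z) k.

(* At the cusp g(oo), the function (c z + d)^(-k/2) f(g z) has an expansion in
   powers of exp(2 pi i z / h) without negative exponents. The width h is left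
   free: for odd k it may have to be a multiple of the geometric width, as
   translation by the latter can act through a nontrivial root of unity. *)
Definition holomorphic_at_cusps (k : int) f : Prop :=
  forall g, SL2Z g -> exists (h : nat) (a : nat -> R[i]), (0 < h)%N /\
    forall z, upper_half_plane z ->
      (series (fun m => a m * cexp (2 * pi%:C * 'i * m%:R * z / h%:R))
         : nat -> R[i]^o) @ \oo
      --> (half_power (denom g z) (- k) * f (moebius g z) : R[i]^o).

(* The space M_{k/2}(Gamma0(N), chi). Its elements are functions on R[i] of
   which only the values on the upper half-plane are constrained; the standing
   conditions on k, N and chi are part of the definition. *)
Definition modular_forms (k N : int) chi : set (R[i] -> R[i]) :=
  [set f | [/\ 0 < N /\ (~~ (2 %| k)%Z -> (4 %| N)%Z),
               dirichlet_character N chi,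
               holomorphic_on_H f,
               forall g z, Gamma0 N g -> upper_half_plane z ->
                 f (moebius g z) = automorphy_factor k chi g z * f z &
               holomorphic_at_cusps k f]].

(* The character (a / .) modulo N. *)
Definition kronecker_character (N a : int) : int -> R[i] :=
  fun m => if coprimez m N then (kronecker a m)%:~R else 0.

Definition theta (K : fieldExtType rat) (z : R[i]) : R[i] :=
  summability.sum (fun x : trace_zero_integers K =>
    cexp (pi%:C * 'i * ratr (field_trace (val x ^+ 2)) * z) : R[i]^o).

End ModularForms.

Arguments theta R K z : clear implicits.
Arguments kronecker_character R N a m : clear implicits.

(* delta_n * n * d; for even n the factor delta_n = 1/2 is absorbed in n. *)
Definition delta_mul (n : nat) (d : int) : int :=
  if odd n then (-1) ^+ (n.-1)./2 * n%:Z * d else (n./2)%:Z * d.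

(* Main.v *)
(** Trace-zero integers form an even positive definite lattice (the trace form of a
    totally real field is positive), with Gram matrix A; since gcd(n, d_K) = 1 forces
    the trace O_K -> Z to be onto, det A = n d_K.

    One-variable Poisson summation, obtained from Riemann sums of the Gaussian along
    the rays of a sector, gives the inversion law of the theta series with
    characteristics, and a Euclidean descent on |c| then gives the law of the Jacobi
    theta series on Gamma_0(4), with multiplier (c/d) eps_d^-1.

    An integral diagonalization P^T A P = diag(2 s_i) writes theta_K as a finite sum of
    products of such series in the variables s_i z.  This yields its law for the
    matrices with d > 0 prime to a fixed modulus M and c divisible by M.  The rest of
    Gamma_0(2 det A) is reached by translations and by the matrices (1 0; K 1) with
    2 det A | K, under which theta_K is covariant because 2 det A . A^-1 is an even
    integral form.  Quadratic reciprocity identifies the resulting character with the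
    Kronecker symbol, and holomorphy at the cusps follows from
    g z = a / c - 1 / (c (c z + d)) and the inversion law. *)
Require Import Defs.
From HB Require Import structures.
From mathcomp Require Import all_boot all_order all_algebra all_field.
From mathcomp Require Import complex.
From mathcomp Require Import all_classical all_reals all_analysis.
From mathcomp.analysis.showcase Require Import summability.
From mathcomp Require finmap.
From mathcomp Require Import ring lra zify.

Set Implicit Arguments.
Unset Strict Implicit.
Unset Printing Implicit Defensive.

Import Order.TTheory GRing.Theory Num.Theory.
Import numFieldNormedType.Exports.

Local Open Scope classical_set_scope.
Local Open Scope ring_scope.
Local Open Scope complex_scope.

(** * Exponential and unconditional sums *)

(** No integral is defined or evaluated: the Riemann sums of the Gaussian enter the Poisson formula
    as one unknown factor, and the self-dual case of the formula shows that this factor tends to 1.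

    Sums are limits over finite subsets of an arbitrary index type, because the same series has to
    be cut into residue classes, multiplied over coordinates, transported along bijections and
    regrouped by exponent.

    The main obstacle is the branch of the square root, which is not multiplicative. For d > 0 the
    points [(c z + d) / d] lie on the line [1 + R z], which avoids the negative real axis, and
    quotients of principal roots taken there are again principal. The laws are therefore established
    for d > 0; the matrix -1, or a shift of d by a multiple of c, gives the other cases.

    A diagonalizing matrix over Z need not be unimodular, so in the new coordinates the lattice is a
    union of classes modulo m. This is why theta series with characteristics are needed, and why
    group elements are adjusted by Bezout until they act on these classes by mere multiplication by
    a. *)

Section RealBounds.
Variable R : realType.
Implicit Types x a b : R.

Lemma ge0_derive_ge0 (f df : R -> R) :
  (forall x, is_derive x 1 f (df x)) -> (forall x, 0 <= x -> 0 <= df x) ->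
  f 0 = 0 -> forall x, 0 <= x -> 0 <= f x.
Proof.
move=> fd dfge f0 x; rewrite le_eqVlt => /orP[/eqP<-|x0]; first by rewrite f0.
have fc : {within `[0, x], continuous f}.
  apply: continuous_subspaceT => y.
  by apply: differentiable_continuous; apply/derivable1_diffP; have [] := fd y.
have [c] := MVT x0 (fun y _ => fd y) fc.
rewrite in_itv /= => /andP[c0 _]; rewrite f0 !subr0 => ->.
by rewrite mulr_ge0 ?dfge // ltW.
Qed.

Lemma sin_le_id x : 0 <= x -> sin x <= x.
Proof.
move=> x0; rewrite -subr_ge0.
apply: (@ge0_derive_ge0 (fun y => y - sin y) (fun y => 1 - cos y)) => //.
all: by [rewrite sin0 subr0 | move=> y _; rewrite subr_ge0 cos_le1].
Qed.

Lemma normr_sin_le x : `|sin x| <= `|x|.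
Proof.
wlog x0 : x / 0 <= x => [H|].
  have [/H //|/ltW x0] := leP 0 x.
  by rewrite -normrN -sinN -(normrN x); apply: H; rewrite oppr_ge0.
rewrite (ger0_norm x0) ler_norml sin_le_id // andbT.
have [x1|x1] := leP x 1; last by rewrite (le_trans _ (sin_geN1 x))// lerN2 ltW.
by rewrite (le_trans (y := 0)) ?oppr_le0 // sin_ge0_pi // x0 (le_trans x1) // (le_trans _ (pi_ge2 R)) // ler1n.
Qed.

Lemma one_sub_cos_le x : `|1 - cos x| <= x ^+ 2 / 2.
Proof.
rewrite ger0_norm ?subr_ge0 ?cos_le1 //.
have -> : 1 - cos x = sin (x / 2) ^+ 2 *+ 2.
  rewrite {1}[x](_ : _ = (x / 2) *+ 2) ?cos_mulr2n ?cos2sin2; first by ring.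
  by rewrite -mulr_natr divfK.
have := normr_sin_le (x / 2); rewrite -(ler_pXn2r (n := 2)) ?nnegrE //.
by rewrite !real_normK ?num_real // => h; rewrite -mulr_natr; nra.
Qed.

Lemma sub_sin_le x : 0 <= x -> x - sin x <= x ^+ 2 / 2.
Proof.
move=> x0; rewrite -subr_ge0.
have H1 y : is_derive y (1:R) (fun y : R => y ^+ 2 / 2 - (y - sin y)) (y - (1 - cos y)).
  by apply: is_derive_eq; rewrite /GRing.scale /=; field.
have H2 (y : R) : 0 <= y -> 0 <= y - (1 - cos y).
  move=> y0; rewrite subr_ge0.
  have -> : 1 - cos y = sin (y / 2) ^+ 2 *+ 2.
    rewrite {1}[y](_ : _ = (y / 2) *+ 2) ?cos_mulr2n ?cos2sin2; first by ring.
    by rewrite -mulr_natr divfK.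
  have h1 := normr_sin_le (y / 2).
  have h2 := sin_max (y / 2).
  have -> : sin (y / 2) ^+ 2 = `|sin (y / 2)| ^+ 2 by rewrite real_normK ?num_real.
  have hy : `|y / 2| = y / 2 by rewrite ger0_norm // divr_ge0.
  rewrite hy in h1; have := normr_ge0 (sin (y/2)).
  move: h1 h2; move: `|sin (y / 2)| => t h1 h2 t0.
  have : t ^+ 2 <= t by rewrite expr2 ler_piMl.
  by rewrite -mulr_natr; lra.
have H3 : 0 ^+ 2 / 2 - (0 - sin 0) = 0 :> R.
  by rewrite sin0 expr0n /= mul0r subr0 subrr.
exact: ge0_derive_ge0 H1 H2 H3 x x0.
Qed.

Lemma normr_sub_sin_le x : `|sin x - x| <= x ^+ 2 / 2.
Proof.
wlog x0 : x / 0 <= x => [H|].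
  have [/H //|/ltW x0] := leP 0 x.
  have := H (- x); rewrite oppr_ge0 sqrrN sinN => /(_ x0); congr (_ <= _).
  by rewrite -normrN; congr (`| _ |); ring.
by rewrite -normrN opprB ger0_norm ?subr_ge0 ?sin_le_id // sub_sin_le.
Qed.

(** A weak Jordan inequality: up to 1 the bound [x - sin x <= x^2 / 2] suffices; beyond,
    [sin x >= sin 1 >= 1/2] while [x < 2]. *)
Lemma sin_ge_quarter x : 0 <= x <= pi / 2 -> x / 4 <= sin x.
Proof.
move=> /andP[x0 xpi]; have pi2 := pihalf_lt2 R.
have [x1|x1] := leP x 1; first by have := sub_sin_le x0; nra.
have h1 : sin 1 <= sin x.
  rewrite leNgt; apply/negP; rewrite ltr_sin ?in_itv /=.
  - by rewrite ltNge ltW.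
  - by rewrite xpi andbT; have := pi_ge0 R; lra.
  - by have := pihalf_ge1 R; lra.
have := sub_sin_le (@ler01 R); rewrite expr1n; lra.
Qed.

Lemma expR_sub1_le a : `|expR a - 1| <= `|a| * expR `|a|.
Proof.
have h := expR_ge1Dx a; have h' := expR_ge1Dx (- a).
have e0 := expR_gt0 a; have := expRxMexpNx_1 a => e1.
have [a0|a0] := leP 0 a.
  rewrite [`|a|]ger0_norm // ger0_norm; first by nra.
  by lra.
rewrite [`|a|]ltr0_norm // ltr0_norm; last first.
  by rewrite subr_lt0 expR_lt1.
by have := expR_gt0 (- a); nra.
Qed.

Lemma expR_sub1D_le a : `|expR a - 1 - a| <= a ^+ 2 * expR `|a|.
Proof.
have h := expR_ge1Dx a.
rewrite ger0_norm; last by lra.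
have h' := expR_ge1Dx (- a); have := expRxMexpNx_1 a => e1.
have e0 := expR_gt0 a.
have [a0|a0] := leP 0 a.
  rewrite [`|a|]ger0_norm //.
  have : expR a - 1 <= a * expR a by nra.
  nra.
rewrite [`|a|]ltr0_norm //.
have : 1 <= expR (- a) by rewrite -(@expR0 R) ler_expR oppr_ge0 ltW.
nra.
Qed.

End RealBounds.

(** * Modulus and exponential on the complex numbers *)

Section ComplexBasics.
Variable R : realType.
Implicit Types (x y z w : R[i]) (a b : R).

Definition cabs z : R := ComplexField.Normc.normc z.

Lemma cabsE z : `|z| = (cabs z)%:C. Proof. by []. Qed.
Lemma cabsM z w : cabs (z * w) = cabs z * cabs w.
Proof. exact: ComplexField.Normc.normcM. Qed.
Lemma ler_cabsD z w : cabs (z + w) <= cabs z + cabs w.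
Proof. exact: le_normcD. Qed.
Lemma cabsN z : cabs (- z) = cabs z.
Proof. exact: normcN. Qed.
Lemma cabsB z w : cabs (z - w) = cabs (w - z).
Proof. by rewrite -cabsN opprB. Qed.
Lemma ler_cabsB z w : cabs (z - w) <= cabs z + cabs w.
Proof. by rewrite -(cabsN w) ler_cabsD. Qed.
Lemma cabs_ge0 z : 0 <= cabs z.
Proof. by case: z => a b; rewrite sqrtr_ge0. Qed.
Lemma cabs0 : cabs 0 = 0.
Proof. exact: ComplexField.Normc.normc0. Qed.
Lemma cabs1 : cabs 1 = 1.
Proof. exact: ComplexField.Normc.normc1. Qed.
Lemma cabs_eq0 z : (cabs z == 0) = (z == 0).
Proof. by apply/eqP/eqP => [/ComplexField.Normc.eq0_normc|->] //; rewrite cabs0. Qed.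
Lemma cabs_gt0 z : (0 < cabs z) = (z != 0).
Proof. by rewrite lt_neqAle cabs_ge0 andbT eq_sym cabs_eq0. Qed.
Lemma cabsX z n : cabs (z ^+ n) = cabs z ^+ n.
Proof. by elim: n => [|n IH]; rewrite ?cabs1 // !exprS cabsM IH. Qed.
Lemma cabsV z : cabs z^-1 = (cabs z)^-1.
Proof. exact: ComplexField.Normc.normcV. Qed.
Lemma cabsR a : cabs a%:C = `|a|.
Proof. by rewrite /cabs /= expr0n addr0 sqrtr_sqr. Qed.
Lemma cabs_sqr z : cabs z ^+ 2 = complex.Re z ^+ 2 + complex.Im z ^+ 2.
Proof. by case: z => a b /=; rewrite sqr_sqrtr // addr_ge0 ?sqr_ge0. Qed.
Lemma Re_le_cabs z : `|complex.Re z| <= cabs z.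
Proof.
rewrite -(ler_pXn2r (n := 2)) ?nnegrE ?cabs_ge0 //.
by rewrite cabs_sqr real_normK ?num_real // lerDl sqr_ge0.
Qed.
Lemma Im_le_cabs z : `|complex.Im z| <= cabs z.
Proof.
rewrite -(ler_pXn2r (n := 2)) ?nnegrE ?cabs_ge0 //.
by rewrite cabs_sqr real_normK ?num_real // lerDr sqr_ge0.
Qed.
Lemma cabs_le z : cabs z <= `|complex.Re z| + `|complex.Im z|.
Proof.
rewrite -(ler_pXn2r (n := 2)) ?nnegrE ?cabs_ge0 ?addr_ge0 //.
rewrite cabs_sqr sqrrD !real_normK ?num_real // lerD2r lerDl.
by rewrite mulrn_wge0 // mulr_ge0.
Qed.
Lemma cabsi : cabs 'i = 1.
Proof. by rewrite /cabs /= expr0n /= add0r expr1n sqrtr1. Qed.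
Lemma cabs_nat n : cabs n%:R = n%:R.
Proof. by rewrite -(rmorph_nat (real_complex R)) cabsR normr_nat. Qed.
Lemma ler_cabs_sum I (s : seq I) (P : pred I) (f : I -> R[i]) :
  cabs (\sum_(i <- s | P i) f i) <= \sum_(i <- s | P i) cabs (f i).
Proof.
elim/big_ind2: _ => [|u a v b ua vb|//]; first by rewrite cabs0.
by rewrite (le_trans (ler_cabsD _ _)) // lerD.
Qed.

Lemma cexpD z w : cexp (z + w) = cexp z * cexp w.
Proof.
case: z w => [a b] [c d]; apply/eqP; rewrite /cexp /= eq_complex /= expRD cosD sinD.
by apply/andP; split; apply/eqP; ring.
Qed.
Lemma cexp0 : cexp (0 : R[i]) = 1.
Proof. by apply/eqP; rewrite /cexp /= eq_complex /= expR0 cos0 sin0; apply/andP; split; apply/eqP; ring. Qed.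
Lemma cabs_cexp z : cabs (cexp z) = expR (complex.Re z).
Proof.
rewrite /cexp cabsM cabsR ger0_norm ?expR_ge0 // /cabs /= cos2Dsin2 sqrtr1 mulr1 //.
Qed.
Lemma cexp_neq0 z : cexp z != 0.
Proof. by rewrite -cabs_eq0 cabs_cexp expR_eq0. Qed.
Lemma cexpN z : cexp (- z) = (cexp z)^-1.
Proof.
apply: (mulfI (cexp_neq0 z)); rewrite -cexpD subrr cexp0 divff ?cexp_neq0 //.
Qed.
Lemma cexp_sum I (s : seq I) (P : pred I) (f : I -> R[i]) :
  cexp (\sum_(i <- s | P i) f i) = \prod_(i <- s | P i) cexp (f i).
Proof. by elim/big_rec2: _ => [|i u v _ <-]; rewrite ?cexp0 ?cexpD. Qed.
Lemma cexpMn z n : cexp (z *+ n) = cexp z ^+ n.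
Proof. by elim: n => [|n IH]; rewrite ?mulr0n ?cexp0 // mulrS cexpD IH exprS. Qed.
Lemma cexp_real a : cexp a%:C = (expR a)%:C.
Proof. by apply/eqP; rewrite /cexp /= eq_complex /= cos0 sin0; apply/andP; split; apply/eqP; ring. Qed.

Definition ci : R[i] := 'i.
Lemma ciM : ci * ci = -1.
Proof. by rewrite -expr2 sqr_i. Qed.
Lemma cabs_ci : cabs ci = 1.
Proof. exact: cabsi. Qed.

Definition tpi : R[i] := 2 * pi%:C * ci.

Lemma cexp_tpi : cexp tpi = 1.
Proof.
have -> : tpi = 0 +i* (pi *+ 2).
  by rewrite /tpi; apply/eqP; rewrite eq_complex /=; apply/andP; split; apply/eqP; ring.
by rewrite /cexp /= cos2pi sin2pi expR0 mul1r.
Qed.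
Lemma cexp_tpi_int (n : int) : cexp (tpi * n%:~R) = 1.
Proof.
case: n => n; first by rewrite mulr_natr cexpMn cexp_tpi expr1n.
by rewrite NegzE mulrNz mulrN cexpN mulr_natr cexpMn cexp_tpi expr1n invr1.
Qed.
Lemma cabs_cexp_tpi (t : R) : cabs (cexp (tpi * t%:C)) = 1.
Proof. by rewrite cabs_cexp -(@expR0 R); congr expR; rewrite /tpi /=; ring. Qed.

(** The real and imaginary parts are compared with the real exponential, cosine and sine, each at
    the cost of the constant 2; power series are avoided. *)
Lemma cexp_sub1D_le z : cabs (cexp z - 1 - z) <= 4 * cabs z ^+ 2 * expR (cabs z).
Proof.
have := cabs_le (cexp z - 1 - z); have := Re_le_cabs z; have := Im_le_cabs z.
move: (cabs z) => M; case: z => a b bM aM h; apply: (le_trans h).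
rewrite /= in bM aM *.
have M0 : 0 <= M by rewrite (le_trans _ aM).
have eM : expR `|a| <= expR M by rewrite ler_expR.
have e1 : 1 + M <= expR M by exact: expR_ge1Dx.
have a2 : a ^+ 2 <= M ^+ 2 by rewrite -(real_normK (num_real a)) ler_pXn2r ?nnegrE.
have b2 : b ^+ 2 <= M ^+ 2 by rewrite -(real_normK (num_real b)) ler_pXn2r ?nnegrE.
have M20 := sqr_ge0 M.
have h1 : `|expR a * cos b - 1 - a| <= 2 * M ^+ 2 * expR M.
  have -> : expR a * cos b - 1 - a = (expR a - 1 - a) * cos b - (1 + a) * (1 - cos b) by ring.
  apply: (le_trans (ler_normB _ _)); rewrite !normrM.
  have k1 := expR_sub1D_le a; have k2 := cos_max b; have k3 := one_sub_cos_le b.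
  have k4 : `|1 + a| <= expR M by rewrite (le_trans (ler_normD _ _)) // normr1; lra.
  have : `|expR a - 1 - a| * `|cos b| <= M ^+ 2 * expR M.
    rewrite -[leRHS]mulr1 ler_pM //; apply: (le_trans k1).
    by rewrite ler_pM ?sqr_ge0 ?expR_ge0.
  have : `|1 + a| * `|1 - cos b| <= expR M * M ^+ 2.
    by rewrite ler_pM //; lra.
  lra.
have h2 : `|expR a * sin b - b| <= 2 * M ^+ 2 * expR M.
  have -> : expR a * sin b - b = (expR a - 1) * sin b + (sin b - b) by ring.
  apply: (le_trans (ler_normD _ _)); rewrite !normrM.
  have k1 := expR_sub1_le a; have k2 := normr_sin_le b; have k3 := normr_sub_sin_le b.
  have : `|expR a - 1| * `|sin b| <= (M * expR M) * M.
    rewrite ler_pM //; last exact: le_trans k2 bM.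
    by apply: (le_trans k1); rewrite ler_pM ?expR_ge0.
  have : M ^+ 2 <= M ^+ 2 * expR M by rewrite -{1}[M ^+ 2]mulr1 ler_wpM2l //; lra.
  lra.
have -> : expR a * cos b - 0 * sin b - 1 - a = expR a * cos b - 1 - a by ring.
have -> : expR a * sin b + 0 * cos b - 0 - b = expR a * sin b - b by ring.
lra.
Qed.

Lemma cexp_sub1_le z : cabs (cexp z - 1) <= 5 * cabs z * expR (2 * cabs z).
Proof.
have := cexp_sub1D_le z; set M := cabs z => h.
have -> : cexp z - 1 = (cexp z - 1 - z) + z by ring.
apply: (le_trans (ler_cabsD _ _)); rewrite -/M.
have M0 : 0 <= M := cabs_ge0 z.
have e1 : 1 + M <= expR M by exact: expR_ge1Dx.
have -> : expR (2 * M) = expR M * expR M by rewrite -expRD; congr expR; ring.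
move: (expR M) e1 h => E e1 h.
have : M * (M * E) <= M * (E * E) by rewrite ler_wpM2l // ler_wpM2r; lra.
have : M * 1 <= M * (E * E) by rewrite ler_wpM2l //; nra.
nra.
Qed.

End ComplexBasics.
Arguments tpi {R}.
Arguments ci {R}.

(** * Unconditional and absolutely convergent sums *)

Section HasSum.
Variable R : realType.
Local Notation C := R[i].

(** Convergence along the directed set of finite subsets, given as duplicate-free sequences. No
    order of summation is involved, so bijections and partitions of the indices are available. *)
Definition has_sum (I : eqType) (a : I -> C) (s : C) : Prop :=
  forall e : R, 0 < e -> exists2 F : seq I, uniq F &
    forall G, uniq G -> {subset F <= G} -> cabs (\sum_(i <- G) a i - s) < e.

Definition sum_bounded (I : eqType) (a : I -> C) (M : R) : Prop :=
  forall G : seq I, uniq G -> \sum_(i <- G) cabs (a i) <= M.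

Lemma small_cabs_eq0 (z : C) : (forall e : R, 0 < e -> cabs z < e) -> z = 0.
Proof.
move=> h; apply/eqP; rewrite -cabs_eq0 eq_le cabs_ge0 andbT leNgt.
by apply/negP => /h; rewrite ltxx.
Qed.

Lemma has_sum_unique (I : eqType) (a : I -> C) s t :
  has_sum a s -> has_sum a t -> s = t.
Proof.
move=> hs ht; apply/eqP; rewrite -subr_eq0; apply/eqP; apply: small_cabs_eq0 => e e0.
have e2 : 0 < e / 2 by rewrite divr_gt0.
have [F uF hF] := hs _ e2; have [G uG hG] := ht _ e2.
have uH := undup_uniq (F ++ G).
have h1 := hF _ uH; have h2 := hG _ uH.
have {h1} : cabs (\sum_(i <- undup (F ++ G)) a i - s) < e / 2.
  by apply: h1 => i iF; rewrite mem_undup mem_cat iF.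
have {h2} : cabs (\sum_(i <- undup (F ++ G)) a i - t) < e / 2.
  by apply: h2 => i iF; rewrite mem_undup mem_cat iF orbT.
set S := \sum_(i <- _) _; rewrite -(cabsN (S - s)) => h2 h1.
have -> : s - t = - (S - s) + (S - t) by ring.
by apply: (le_lt_trans (ler_cabsD _ _)); lra.
Qed.

Lemma has_sum_ext (I : eqType) (a b : I -> C) s : a =1 b -> has_sum a s -> has_sum b s.
Proof. by move=> /funext ->. Qed.

Lemma has_sum0 (I : eqType) : has_sum (fun _ : I => 0) 0.
Proof. by move=> e e0; exists [::] => // G _ _; rewrite big1 // subrr cabs0. Qed.

Lemma has_sumD (I : eqType) (a b : I -> C) s t :
  has_sum a s -> has_sum b t -> has_sum (fun i => a i + b i) (s + t).
Proof.
move=> ha hb e e0; have e2 : 0 < e / 2 by rewrite divr_gt0.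
have [F uF hF] := ha _ e2; have [G uG hG] := hb _ e2.
exists (undup (F ++ G)); first exact: undup_uniq.
move=> H uH FGH; rewrite big_split /= opprD addrACA.
apply: (le_lt_trans (ler_cabsD _ _)).
have h1 : cabs (\sum_(i <- H) a i - s) < e / 2.
  by apply: hF => // i iF; apply: FGH; rewrite mem_undup mem_cat iF.
have h2 : cabs (\sum_(i <- H) b i - t) < e / 2.
  by apply: hG => // i iF; apply: FGH; rewrite mem_undup mem_cat iF orbT.
lra.
Qed.

Lemma has_sumZ (I : eqType) (c : C) (a : I -> C) s :
  has_sum a s -> has_sum (fun i => c * a i) (c * s).
Proof.
move=> ha e e0; have e2 : 0 < e / (1 + cabs c).
  by rewrite divr_gt0 // ltr_wpDr ?cabs_ge0.
have [F uF hF] := ha _ e2; exists F => // G uG FG.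
rewrite -mulr_sumr -mulrBr cabsM.
have := hF _ uG FG; rewrite ltr_pdivlMr ?ltr_wpDr ?cabs_ge0 //.
have := cabs_ge0 c; have := cabs_ge0 (\sum_(i <- G) a i - s); nra.
Qed.

Lemma has_sumN (I : eqType) (a : I -> C) s : has_sum a s -> has_sum (fun i => - a i) (- s).
Proof.
move=> /(has_sumZ (-1)); rewrite mulN1r; apply: has_sum_ext => i; by rewrite mulN1r.
Qed.

Lemma has_sumB (I : eqType) (a b : I -> C) s t :
  has_sum a s -> has_sum b t -> has_sum (fun i => a i - b i) (s - t).
Proof. by move=> ha /has_sumN hb; exact: has_sumD. Qed.

Lemma has_sum_sum (I : eqType) (K : Type) (r : seq K) (P : pred K) (a : K -> I -> C) s :
  (forall k, P k -> has_sum (a k) (s k)) ->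
  has_sum (fun i => \sum_(k <- r | P k) a k i) (\sum_(k <- r | P k) s k).
Proof.
move=> h; elim: r => [|k r IH].
  by rewrite big_nil; apply: has_sum_ext (@has_sum0 I) => i; rewrite big_nil.
rewrite big_cons; case: ifP => Pk.
  by apply: has_sum_ext (has_sumD (h k Pk) IH) => i; rewrite big_cons Pk.
by apply: has_sum_ext IH => i; rewrite big_cons Pk.
Qed.

Section Injection.
Variables (I J : eqType) (e : J -> I).
Hypothesis e_inj : injective e.

Let inv (i : I) : option J :=
  if pselect (exists j, e j = i) is left h then Some (projT1 (cid h)) else None.

Let eK : pcancel e inv.
Proof.
move=> j; rewrite /inv; case: pselect => [h|]; last by case; exists j.
by congr Some; apply: e_inj; case: cid.
Qed.

Let invK : ocancel inv e.
Proof. by move=> i; rewrite /inv; case: pselect => //= h; case: cid. Qed.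

Lemma has_sum_inj (a : I -> C) s : (forall i, (forall j, e j <> i) -> a i = 0) ->
  has_sum (a \o e) s -> has_sum a s.
Proof.
move=> a0 h eps /h[F uF hF]; exists (map e F); first by rewrite map_inj_uniq.
move=> G uG FG; rewrite (bigID (fun i => isSome (inv i))) /= [X in _ + X - _]big1 ?addr0; last first.
  move=> i ni; apply: a0 => j ej; move: ni; rewrite -ej eK //.
have -> : \sum_(i <- G | inv i) a i = \sum_(j <- pmap inv G) a (e j).
  elim: G {uG FG} => [|i G IH]; first by rewrite !big_nil.
  rewrite big_cons /=; have := invK i; case: (inv i) => [j|] /= ij //.
  by rewrite big_cons IH ij.
apply: hF; first by apply: pmap_uniq uG; exact: invK.
by move=> j jF; rewrite mem_pmap -(eK j) map_f // FG // map_f.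
Qed.

Lemma has_sum_comp (a : I -> C) s : (forall i, (forall j, e j <> i) -> a i = 0) ->
  has_sum a s -> has_sum (a \o e) s.
Proof.
move=> a0 h eps /h[F uF hF]; exists (pmap inv F); first by apply: pmap_uniq uF; exact: invK.
move=> G uG FG; pose H := map e G ++ [seq i <- F | ~~ isSome (inv i)].
have : cabs (\sum_(i <- H) a i - s) < eps.
  apply: hF.
    rewrite cat_uniq map_inj_uniq // uG filter_uniq // andbT.
    apply/hasPn => i; rewrite mem_filter => /andP[ni _]; apply/mapP => -[j _ ij].
    by move: ni; rewrite ij eK.
  move=> i iF; rewrite mem_cat mem_filter iF andbT.
  case E : (inv i) => [j|] /=; last by rewrite orbT.
  rewrite orbF; have := invK i; rewrite E /= => <-; apply: map_f; apply: FG.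
  by rewrite mem_pmap -E map_f.
rewrite big_cat big_map /= [X in _ + X - _]big1_seq ?addr0 //.
move=> i; rewrite mem_filter => /andP[_ /andP[ni _]]; apply: a0 => j ej.
by move: ni; rewrite -ej eK.
Qed.

End Injection.

Lemma has_sum_bij (I J : eqType) (e : J -> I) (f : I -> J) (a : I -> C) s :
  cancel e f -> cancel f e -> has_sum a s -> has_sum (a \o e) s.
Proof.
move=> ef fe; move=> h; apply: (has_sum_comp (can_inj ef)) h => i h.
by case: (h (f i)).
Qed.

(** Summation by packets. Given finitely many fibres [K], one finite set is adequate for all of them
    at once, the error [e / 2] being shared among them. It yields both Fubini and the regrouping of
    equal exponents. *)
Lemma has_sum_fiber (I J : eqType) (f : I -> J) (a : I -> C) b s :
  has_sum a s -> (forall j, has_sum (fun i => if f i == j then a i else 0) (b j)) ->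
  has_sum b s.
Proof.
move=> ha hb e e0; have e2 : 0 < e / 2 by rewrite divr_gt0.
have [F uF hF] := ha _ e2.
exists (undup (map f F)); first exact: undup_uniq.
move=> K uK FK.
pose d := e / 2 / (size K).+1%:R.
have d0 : 0 < d by rewrite divr_gt0.
have [g hg] := choice (fun j => (let: ex_intro2 G h1 h2 := hb j d d0 in ex_intro _ G (conj h1 h2) :
  exists G, uniq G /\ forall H, uniq H -> {subset G <= H} ->
    cabs (\sum_(i <- H) (if f i == j then a i else 0) - b j) < d)).
pose G := undup (F ++ flatten (map g K)).
(* [G'] retains the indices over [K]: its sum is exactly the double sum over [K], and it still
   contains [F]. *)
pose G' := [seq i <- G | f i \in K].
have h1 : cabs (\sum_(i <- G') a i - s) < e / 2.
  apply: hF; first by rewrite filter_uniq // undup_uniq.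
  move=> i iF; rewrite mem_filter mem_undup mem_cat iF andbT FK // mem_undup map_f //.
have h2 : \sum_(i <- G') a i = \sum_(j <- K) \sum_(i <- G) (if f i == j then a i else 0).
  rewrite exchange_big /= big_filter big_mkcond /=; apply: eq_bigr => i _.
  case: ifP => fK.
    rewrite (bigD1_seq (f i)) //= eqxx big1 ?addr0 // => j /negbTE nj.
    by rewrite eq_sym nj.
  rewrite big1_seq // => j /= jK; case: eqP => // fj; by rewrite fj jK in fK.
have h3 : cabs (\sum_(j <- K) (\sum_(i <- G) (if f i == j then a i else 0) - b j)) <= e / 2.
  apply: (le_trans (ler_cabs_sum _ _ _)).
  apply: (@le_trans _ _ (\sum_(j <- K) d)).
    rewrite big_seq [leRHS]big_seq; apply: ler_sum => j jK; apply: ltW.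
    have [_] := hg j; apply; first exact: undup_uniq.
    move=> i ij; rewrite mem_undup mem_cat; apply/orP; right.
    by apply/flattenP; exists (g j) => //; rewrite map_f.
  rewrite big_const_seq count_predT iter_addr_0 /d -[X in X <= _]mulr_natr -mulrA.
  by rewrite ler_piMr ?[0 <= e / 2]ltW // mulrC ler_pdivrMr // mul1r ler_nat.
rewrite sumrB -h2 in h3.
have -> : \sum_(i <- K) b i - s =
  - (\sum_(i <- G') a i - \sum_(i <- K) b i) + (\sum_(i <- G') a i - s) by ring.
by apply: (le_lt_trans (ler_cabsD _ _)); rewrite cabsN; lra.
Qed.

Lemma sum_bounded_le (I : eqType) (a b : I -> C) M :
  (forall i, cabs (a i) <= cabs (b i)) -> sum_bounded b M -> sum_bounded a M.
Proof. by move=> ab hb G /hb; apply: le_trans; exact: ler_sum. Qed.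

Lemma sum_bounded_ge0 (I : eqType) (a : I -> C) M : sum_bounded a M -> 0 <= M.
Proof. by move=> /(_ [::] isT); rewrite big_nil. Qed.

Lemma has_sum_cabs_le (I : eqType) (a : I -> C) M s :
  has_sum a s -> sum_bounded a M -> cabs s <= M.
Proof.
move=> ha hM; rewrite leNgt; apply/negP => Ms.
have [|F uF /(_ F uF)] := ha (cabs s - M); first by rewrite subr_gt0.
move=> /(_ (fun _ => id)); rewrite cabsB => h.
have := ler_cabsD (s - \sum_(i <- F) a i) (\sum_(i <- F) a i); rewrite subrK.
have := ler_cabs_sum F xpredT a; have := hM F uF; lra.
Qed.

Lemma sum_ge0_sup (I : eqType) (f : I -> R) M : (forall i, 0 <= f i) ->
  (forall G, uniq G -> \sum_(i <- G) f i <= M) ->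
  exists s : R, forall e : R, 0 < e -> exists2 F : seq I, uniq F &
    forall G, uniq G -> {subset F <= G} -> `|\sum_(i <- G) f i - s| < e.
Proof.
move=> f0 fM; pose A := [set \sum_(i <- G) f i | G in [set G : seq I | uniq G]].
have hA : has_sup A.
  by split; [exists 0, [::] => //; rewrite big_nil|exists M => _ [G uG <-]; exact: fM].
exists (sup A) => e e0; have [_ [F uF <-] hF] := sup_adherent e0 hA.
exists F => // G uG FG.
have : \sum_(i <- G) f i <= sup A by apply: (ub_le_sup hA.2); exists G.
have : \sum_(i <- F) f i <= \sum_(i <- G) f i.
  have pF : perm_eq F [seq i <- G | i \in F].
    apply: uniq_perm => //; first exact: filter_uniq.
    by move=> i; rewrite mem_filter; case iF : (i \in F) => //=; rewrite FG.
  rewrite (perm_big _ pF) big_filter /= [leRHS](bigID (mem F)) /= lerDl sumr_ge0 //.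
by move=> h1 h2; rewrite ler0_norm; lra.
Qed.

(** Completeness enters through suprema of nonnegative sums, applied to the positive and negative
    parts of the real and imaginary parts. *)
Lemma has_sum_bounded (I : eqType) (a : I -> C) M :
  sum_bounded a M -> exists2 s, has_sum a s & cabs s <= M.
Proof.
move=> hM; suff [s hs] : exists s, has_sum a s.
  by exists s => //; exact: has_sum_cabs_le hs hM.
have part (h : C -> R) : (forall z, 0 <= h z <= cabs z) ->
    exists s : R, forall e : R, 0 < e -> exists2 F : seq I, uniq F &
    forall G, uniq G -> {subset F <= G} -> `|\sum_(i <- G) h (a i) - s| < e.
  move=> hh; apply: (sum_ge0_sup (M := M)) => [i|G uG]; first by case/andP: (hh (a i)).
  by apply: le_trans (hM G uG); apply: ler_sum => i _; case/andP: (hh (a i)).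
have lift (h : C -> R) : (forall z, 0 <= h z <= cabs z) ->
    exists s, has_sum (fun i => (h (a i))%:C) s.
  move=> /part [s hs]; exists s%:C => e /hs [F uF hF]; exists F => // G uG /(hF G uG).
  by rewrite -rmorph_sum -rmorphB cabsR.
have pos (x : R) : 0 <= (`|x| + x) / 2 <= `|x|.
  by have := ler_norm x; have := ler_norm (- x); rewrite normrN; lra.
have [//|s1 h1] := lift (fun z => (`|complex.Re z| + complex.Re z) / 2).
  by move=> z; case/andP: (pos (complex.Re z)) => -> /= /le_trans; apply; exact: Re_le_cabs.
have [//|s2 h2] := lift (fun z => (`|complex.Re z| + - complex.Re z) / 2).
  by move=> z; rewrite -normrN; case/andP: (pos (- complex.Re z)) => -> /= /le_trans; apply; rewrite normrN; exact: Re_le_cabs.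
have [//|s3 h3] := lift (fun z => (`|complex.Im z| + complex.Im z) / 2).
  by move=> z; case/andP: (pos (complex.Im z)) => -> /= /le_trans; apply; exact: Im_le_cabs.
have [//|s4 h4] := lift (fun z => (`|complex.Im z| + - complex.Im z) / 2).
  by move=> z; rewrite -normrN; case/andP: (pos (- complex.Im z)) => -> /= /le_trans; apply; rewrite normrN; exact: Im_le_cabs.
exists ((s1 - s2) + 'i * (s3 - s4)).
apply: has_sum_ext (has_sumD (has_sumB h1 h2) (has_sumZ 'i (has_sumB h3 h4))) => i.
rewrite [RHS]complexE -!rmorphB; by congr (_%:C + _ * _%:C); field.
Qed.

Lemma sum_boundedZ (I : eqType) (c : C) (a : I -> C) M :
  sum_bounded a M -> sum_bounded (fun i => c * a i) (cabs c * M).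
Proof.
move=> h G /h hG; under eq_bigr do rewrite cabsM.
by rewrite -mulr_sumr ler_wpM2l ?cabs_ge0.
Qed.

Lemma sum_boundedD (I : eqType) (a b : I -> C) M N :
  sum_bounded a M -> sum_bounded b N -> sum_bounded (fun i => a i + b i) (M + N).
Proof.
move=> ha hb G uG; apply: (@le_trans _ _ (\sum_(i <- G) (cabs (a i) + cabs (b i)))).
  by apply: ler_sum => i _; exact: ler_cabsD.
by rewrite big_split /= lerD ?ha ?hb.
Qed.

Lemma sum_bounded_prod (I J : eqType) (a : I -> C) (b : J -> C) M N :
  sum_bounded a M -> sum_bounded b N ->
  sum_bounded (fun ij : I * J => a ij.1 * b ij.2) (M * N).
Proof.
move=> ha hb G uG.
have u1 := undup_uniq (map fst G); have u2 := undup_uniq (map snd G).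
pose H := allpairs pair (undup (map fst G)) (undup (map snd G)).
have uH : uniq H by apply: allpairs_uniq => // -[? ?] [? ?].
apply: (@le_trans _ _ (\sum_(ij <- H) cabs (a ij.1 * b ij.2))).
  have pF : perm_eq G [seq i <- H | i \in G].
    apply: uniq_perm => //; first exact: filter_uniq.
    move=> -[i j]; rewrite mem_filter; case iF : ((i, j) \in G) => //=; apply/esym.
    by apply/allpairsP; exists (i, j); rewrite !mem_undup; split => //; apply/mapP; exists (i, j).
  rewrite (perm_big _ pF) big_filter /= [leRHS](bigID (mem G)) /= lerDl sumr_ge0 // => *.
  exact: cabs_ge0.
rewrite big_allpairs /=; under eq_bigr do under eq_bigr do rewrite cabsM.
under eq_bigr do rewrite -mulr_sumr.
rewrite -mulr_suml ler_pM ?ha ?hb // sumr_ge0 // => *; exact: cabs_ge0.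
Qed.

(** The bound on pairs provides some sum [u]; packets along the first projection, then uniqueness,
    identify it. *)
Lemma has_sum_prod (I J : eqType) (a : I -> C) (b : J -> C) M N s t :
  sum_bounded a M -> sum_bounded b N -> has_sum a s -> has_sum b t ->
  has_sum (fun ij : I * J => a ij.1 * b ij.2) (s * t).
Proof.
move=> Ma Nb ha hb; have [u hu _] := has_sum_bounded (sum_bounded_prod Ma Nb).
suff hs : has_sum (fun i => a i * t) u.
  rewrite [s * t](_ : _ = u) //; apply: has_sum_unique hs.
  by rewrite mulrC; apply: has_sum_ext (has_sumZ t ha) => i; rewrite mulrC.
apply: (has_sum_fiber (f := fst) hu) => i.
apply: (has_sum_inj (e := fun j => (i, j))); first by move=> j k [].
  by move=> [k j] h; case: eqP => // ki; case: (h j); rewrite -ki.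
by apply: has_sum_ext (has_sumZ (a i) hb) => j /=; rewrite eqxx.
Qed.

Lemma nat_sum_bounded (f : nat -> R) (M : R) : (forall i, 0 <= f i) ->
  (forall m, \sum_(i < m) f i <= M) -> sum_bounded (fun n => (f n)%:C) M.
Proof.
move=> f0 fM G uG; apply: le_trans (fM (\max_(i <- G) i).+1).
rewrite -(big_mkord xpredT f).
have pF : perm_eq G [seq i <- index_iota 0 (\max_(i <- G) i).+1 | i \in G].
  apply: uniq_perm => //; first by rewrite filter_uniq // iota_uniq.
  move=> i; rewrite mem_filter; case iF : (i \in G) => //=; apply/esym.
  by rewrite mem_index_iota /= ltnS (leq_bigmax_seq (F := id)).
have E n : cabs (f n)%:C = f n by rewrite cabsR ger0_norm.
rewrite (eq_bigr _ (fun n _ => E n)).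
by rewrite (perm_big _ pF) big_filter /= [leRHS](bigID (mem G)) /= lerDl sumr_ge0.
Qed.

Lemma int_sum_bounded (f : nat -> C) M : sum_bounded f M ->
  sum_bounded (fun n : int => f `|n|%N) (2 * M).
Proof.
move=> h G uG; rewrite (bigID (fun n : int => 0 <= n)) /=.
have key (P : pred int) : {in [pred n | P n] &, injective absz} ->
    \sum_(i <- G | P i) cabs (f `|i|%N) <= M.
  move=> Pinj; rewrite -big_filter -(big_map absz xpredT (fun n => cabs (f n))).
  apply: h; rewrite map_inj_in_uniq ?filter_uniq //.
  by move=> x y; rewrite !mem_filter => /andP[Px _] /andP[Py _]; exact: Pinj.
by rewrite mulrDl mul1r lerD //; apply: key => x y; rewrite !inE; lia.
Qed.

Lemma geometric_sum_bounded (q : R) : 0 <= q < 1 ->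
  sum_bounded (fun n : nat => (q ^+ n)%:C) ((1 - q)^-1).
Proof.
move=> /andP[q0 q1]; apply: nat_sum_bounded => [i|m]; first exact: exprn_ge0.
have h1 : 0 < 1 - q by rewrite subr_gt0.
rewrite -(ler_pM2l h1) divff ?gt_eqF // -opprB mulNr -subrX1 opprB.
by rewrite gerBl exprn_ge0.
Qed.

End HasSum.

(** * Poisson summation for the Gaussian *)

Section Poisson.
Variable R : realType.
Local Notation C := R[i].
Implicit Types (x h v w z : C) (T e : R).

Definition gauss (x : C) : C := cexp (- (pi%:C * x ^+ 2)).

Lemma cabs_gauss x : cabs (gauss x) = expR (- (pi * complex.Re (x ^+ 2))).
Proof. by rewrite cabs_cexp; case: (x ^+ 2) => a b /=; congr expR; ring. Qed.

Lemma gaussD x h : gauss (x + h) = gauss x * cexp (- (pi%:C * (2 * x * h + h ^+ 2))).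
Proof. by rewrite /gauss -cexpD; congr cexp; ring. Qed.

Lemma cabs_gauss_arg x h V W D T e : 0 <= W -> 0 <= V -> 0 <= D -> 0 <= T -> 0 <= e <= 1 ->
  cabs x <= V + W * T -> cabs h <= D * (1 + T) * e ->
  cabs (- (pi%:C * (2 * x * h + h ^+ 2))) <= pi * (2 * (V + W) * D + D ^+ 2) * (1 + T) ^+ 2 * e.
Proof.
move=> W0 V0 D0 T0 /andP[e0 e1] hx hh; rewrite cabsN cabsM cabsR ger0_norm ?pi_ge0 // -!mulrA.
rewrite ler_wpM2l ?pi_ge0 //; apply: (le_trans (ler_cabsD _ _)).
rewrite cabsX (cabsM 2) (cabsM x) cabs_nat.
have x1 : cabs x <= (V + W) * (1 + T) by apply: (le_trans hx); nra.
have h2 : cabs h ^+ 2 <= (D * (1 + T) * e) ^+ 2 by rewrite ler_pXn2r ?nnegrE ?cabs_ge0 // ?mulr_ge0 // addr_ge0.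
have xh : cabs x * cabs h <= (V + W) * (1 + T) * (D * (1 + T) * e).
  by rewrite ler_pM ?cabs_ge0.
have DT : 0 <= D ^+ 2 * (1 + T) ^+ 2 by rewrite mulr_ge0 ?sqr_ge0.
have e2 : e ^+ 2 <= e by rewrite expr2 ler_piMl.
have : D ^+ 2 * (1 + T) ^+ 2 * e ^+ 2 <= D ^+ 2 * (1 + T) ^+ 2 * e by rewrite ler_wpM2l.
lra.
Qed.

Lemma gauss_majorant (V W dl T : R) : 0 < dl ->
  - (pi * (dl * T ^+ 2 - 2 * V * W * T - V ^+ 2)) + (4 * T + (pi * dl / 2 + pi * dl / 2 * T ^+ 2))
   <= - (2 * T) + (pi * V ^+ 2 + pi * dl / 2 + (6 + 2 * pi * V * W) ^+ 2 / (2 * pi * dl)).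
Proof.
move=> d0; have p0 := pi_gt0 R.
have [a ea a0] : exists2 a, a = pi * dl & 0 < a by exists (pi * dl) => //; rewrite mulr_gt0.
set b := 6 + 2 * pi * V * W.
have : b * T - a / 2 * T ^+ 2 <= b ^+ 2 / (2 * a).
  rewrite ler_pdivlMr ?mulr_gt0 // -subr_ge0.
  have -> : b ^+ 2 - (b * T - a / 2 * T ^+ 2) * (2 * a) = (b - a * T) ^+ 2 by field.
  exact: sqr_ge0.
rewrite -[2 * pi * dl]mulrA -ea => H.
have -> : pi * (dl * T ^+ 2 - 2 * V * W * T - V ^+ 2) = a * T ^+ 2 - 2 * pi * V * W * T - pi * V ^+ 2.
  by rewrite ea; ring.
move: H; move: (b ^+ 2 / (2 * a)) => X; rewrite /b; lra.
Qed.

(** Bounds for the Gaussian, its first difference and its first-order Taylor remainder, uniform over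
    the points of the lines [v + w t] with [|t| = T], [|v| <= V], [|w| <= W] and [Re (w^2) >= dl].
    The derivative is [- 2 pi x gauss x], whence the plus sign in the last bound. *)
Lemma gauss_estimates (V W D dl : R) : 0 <= V -> 0 <= W -> 0 <= D -> 0 < dl ->
  exists C1 e0 : R, [/\ 0 < C1, 0 < e0 & forall x T, 0 <= T -> cabs x <= V + W * T ->
   dl * T ^+ 2 - 2 * V * W * T - V ^+ 2 <= complex.Re (x ^+ 2) ->
   cabs (gauss x) <= C1 * expR (- (2 * T)) /\
   forall e h, 0 <= e <= e0 -> cabs h <= D * (1 + T) * e ->
    cabs (gauss (x + h) - gauss x) <= C1 * e * expR (- (2 * T)) /\
    cabs (gauss (x + h) - gauss x + 2 * pi%:C * x * h * gauss x)
      <= C1 * e ^+ 2 * expR (- (2 * T))].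
Proof.
move=> V0 W0 D0 d0; have p0 := pi_gt0 R.
pose K : R := pi * (2 * (V + W) * D + D ^+ 2).
have K0 : 0 <= K by rewrite /K mulr_ge0 ?(ltW p0) // addr_ge0 ?sqr_ge0 // !mulr_ge0 // addr_ge0.
pose L : R := expR (pi * V ^+ 2 + pi * dl / 2 + (6 + 2 * pi * V * W) ^+ 2 / (2 * pi * dl)).
have L0 : 0 < L by exact: expR_gt0.
(* With this [e0] the exponent [2 K (1 + T)^2 e] stays below [pi dl (1 + T^2) / 2], the loss that
   [gauss_majorant] allows. *)
pose e0 : R := Num.min 1 (pi * dl / 8 / (K + 1)).
have K1 : 0 < K + 1 by rewrite ltr_wpDl.
have pd : 0 < pi * dl by rewrite mulr_gt0.
have Q2 := sqr_ge0 K; have Q3 : 0 <= pi * D ^+ 2 by rewrite mulr_ge0 ?sqr_ge0 // ltW.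
have [S [S1 S5 S4]] : exists S : R, [/\ 1 <= S, 5 * K <= S & 4 * K ^+ 2 + pi * D ^+ 2 <= S].
  by exists (1 + 5 * K + 4 * K ^+ 2 + pi * D ^+ 2); split; lra.
exists (S * L), e0; split.
- by rewrite mulr_gt0 //; lra.
- by rewrite lt_min ltr01 !divr_gt0.
move=> x T T0 hx hre; have := cabs_gauss x; set G := cabs (gauss x) => Ge.
have G0 : 0 <= G := cabs_ge0 _.
have major e : 0 <= e <= e0 -> G * (expR (4 * T) * expR (2 * (K * (1 + T) ^+ 2 * e))) <= L * expR (- (2 * T)).
  move=> /andP[ee0]; rewrite le_min ler_pdivlMr // => /andP[_ ee].
  rewrite Ge /L -!expRD ler_expR addrC [leRHS]addrC.
  apply: le_trans (gauss_majorant V W T d0).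
  have h1 : K * e <= pi * dl / 8 by apply: le_trans ee; rewrite mulrC ler_wpM2l // lerDl.
  have T2 : (1 + T) ^+ 2 <= 2 + 2 * T ^+ 2 by have := sqr_ge0 (1 - T); rewrite !expr2; lra.
  have h2 : K * e * (1 + T) ^+ 2 <= pi * dl / 8 * (2 + 2 * T ^+ 2).
    by rewrite ler_pM ?sqr_ge0 // mulr_ge0.
  have : pi * (dl * T ^+ 2 - 2 * V * W * T - V ^+ 2) <= pi * complex.Re (x ^+ 2).
    by rewrite ler_pM2l.
  lra.
have L1 := expR_ge0 (- (2 * T)).
have e00 : 0 <= e0 by rewrite ltW // lt_min ltr01 !divr_gt0.
have eT : 1 + T <= expR T := expR_ge1Dx T.
have eT1 : 1 <= expR T by rewrite -(@expR0 R) ler_expR.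
have eT4 : expR (4 * T) = expR T ^+ 4 by rewrite expRM_natl.
have T2 : (1 + T) ^+ 2 <= expR (4 * T).
  have h1 : (1 + T) ^+ 2 <= expR T ^+ 2 by rewrite ler_pXn2r ?nnegrE //; lra.
  apply: (le_trans h1); rewrite eT4; apply: ler_weXn2l => //.
have T4 : (1 + T) ^+ 4 <= expR (4 * T) by rewrite eT4 ler_pXn2r ?nnegrE //; lra.
have LT0 : 0 <= L * expR (- (2 * T)) by rewrite mulr_ge0 // ltW.
split.
  have := major 0; rewrite lexx e00 mulr0 mulr0 expR0 mulr1 => /(_ isT) h.
  apply: (@le_trans _ _ (L * expR (- (2 * T)))).
    by apply: le_trans h; rewrite ler_peMr // -(@expR0 R) ler_expR mulr_ge0.
  by rewrite -mulrA ler_peMl.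
move=> e h ee hh; have e1 : 0 <= e <= 1.
  by move: ee => /andP[-> /=]; rewrite le_min => /andP[].
have := cabs_gauss_arg W0 V0 D0 T0 e1 hx hh; rewrite -/K gaussD.
set w := - _ => hw; have maj := major _ ee; set E := expR (2 * _) in maj.
have w0 := cabs_ge0 w; have [ee0 ee1] := andP e1.
have E1 : expR (2 * cabs w) <= E by rewrite ler_expR; lra.
have E2 : expR (cabs w) <= E by apply: le_trans E1; rewrite ler_expR; lra.
have E3 : 1 <= E by apply: le_trans E2; rewrite -(@expR0 R) ler_expR.
have ge0 := expR_ge0 (4 * T).
have wT : cabs w <= K * e * expR (4 * T).
  by apply: (le_trans hw); rewrite mulrAC ler_wpM2l // mulr_ge0.
have wT2 : cabs w ^+ 2 <= K ^+ 2 * e ^+ 2 * expR (4 * T).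
  apply: (@le_trans _ _ ((K * (1 + T) ^+ 2 * e) ^+ 2)).
    by rewrite lerXn2r ?nnegrE //; apply: le_trans hw.
  have -> : (K * (1 + T) ^+ 2 * e) ^+ 2 = K ^+ 2 * e ^+ 2 * (1 + T) ^+ 4 by ring.
  by rewrite ler_wpM2l // mulr_ge0 ?sqr_ge0.
have hT2 : cabs h ^+ 2 <= D ^+ 2 * e ^+ 2 * expR (4 * T).
  apply: (@le_trans _ _ ((D * (1 + T) * e) ^+ 2)).
    by rewrite lerXn2r ?nnegrE ?cabs_ge0 //; apply: le_trans hh; exact: cabs_ge0.
  have -> : (D * (1 + T) * e) ^+ 2 = D ^+ 2 * e ^+ 2 * (1 + T) ^+ 2 by ring.
  by rewrite ler_wpM2l // mulr_ge0 ?sqr_ge0.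
have GE0 : 0 <= G * (expR (4 * T) * E) by rewrite !mulr_ge0 // expR_ge0.
split.
  have -> : gauss x * cexp w - gauss x = gauss x * (cexp w - 1) by ring.
  rewrite cabsM -/G; have k1 := cexp_sub1_le w.
  have k2 : 5 * cabs w * expR (2 * cabs w) <= 5 * (K * e * expR (4 * T)) * E.
    by rewrite ler_pM ?expR_ge0 ?mulr_ge0 // ler_wpM2l.
  apply: (@le_trans _ _ (5 * K * e * (G * (expR (4 * T) * E)))).
    have := ler_wpM2l G0 (le_trans k1 k2); lra.
  apply: (@le_trans _ _ (5 * K * e * (L * expR (- (2 * T))))).
    by rewrite ler_wpM2l //; have := mulr_ge0 K0 ee0; lra.
  by have := ler_wpM2l (mulr_ge0 ee0 LT0) S5; lra.
have -> : gauss x * cexp w - gauss x + 2 * pi%:C * x * h * gauss x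
    = gauss x * ((cexp w - 1 - w) - pi%:C * h ^+ 2) by rewrite /w; ring.
rewrite cabsM -/G; have k1 := cexp_sub1D_le w.
have k0 : cabs ((cexp w - 1 - w) - pi%:C * h ^+ 2) <= 4 * cabs w ^+ 2 * expR (cabs w) + pi * cabs h ^+ 2.
  apply: (le_trans (ler_cabsB _ _)); rewrite cabsM cabsX cabsR ger0_norm ?pi_ge0 //; lra.
have k2 : 4 * cabs w ^+ 2 * expR (cabs w) <= 4 * (K ^+ 2 * e ^+ 2 * expR (4 * T)) * E.
  by rewrite ler_pM ?expR_ge0 ?mulr_ge0 ?sqr_ge0 // ler_wpM2l.
have k3 : pi * cabs h ^+ 2 <= pi * D ^+ 2 * e ^+ 2 * expR (4 * T) * E.
  apply: (@le_trans _ _ (pi * D ^+ 2 * e ^+ 2 * expR (4 * T))).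
    by have := ler_wpM2l (ltW p0) hT2; lra.
  by rewrite ler_peMr // mulr_ge0 // mulr_ge0 ?sqr_ge0.
apply: (@le_trans _ _ ((4 * K ^+ 2 + pi * D ^+ 2) * e ^+ 2 * (G * (expR (4 * T) * E)))).
  have k4 := le_trans k0 (lerD k2 k3).
  have := ler_wpM2l G0 k4; lra.
apply: (@le_trans _ _ ((4 * K ^+ 2 + pi * D ^+ 2) * e ^+ 2 * (L * expR (- (2 * T))))).
  by rewrite ler_wpM2l // mulr_ge0 ?sqr_ge0 //; lra.
by have := ler_wpM2l (mulr_ge0 (sqr_ge0 e) LT0) S4; lra.
Qed.

(** Here [q = exp (- 1 / l) <= l / (l + 1)], so each half of the geometric series is at most
    [l + 1 <= 2 l]. *)
Lemma exp_sum_bounded (a : int -> C) (B : R) (l : nat) : (0 < l)%N -> 0 <= B ->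
  (forall n, cabs (a n) <= B * expR (- (`|n|%N%:R / l%:R))) ->
  sum_bounded a (4 * B * l%:R).
Proof.
move=> l0 B0 ha; pose q : R := expR (- l%:R^-1).
have l0R : 0 < l%:R :> R by rewrite ltr0n.
have q1 : q < 1 by rewrite expR_lt1 oppr_lt0 invr_gt0.
have q01 : 0 <= q < 1 by rewrite expR_ge0.
have hb := sum_boundedZ B%:C (int_sum_bounded (geometric_sum_bounded q01)).
have : sum_bounded a (cabs B%:C * (2 * (1 - q)^-1)).
  apply: sum_bounded_le hb => n; apply: (le_trans (ha n)).
  rewrite cabsM !cabsR (ger0_norm B0) ger0_norm ?exprn_ge0 ?expR_ge0 //.
  by rewrite -expRM_natl mulrN.
move=> h G uG; apply: (le_trans (h G uG)); rewrite cabsR (ger0_norm B0).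
rewrite -[4 * B]mulrC -mulrA ler_wpM2l // ler_pdivrMr ?subr_gt0 //.
have h1 : q * (1 + l%:R^-1) <= 1.
  have := ler_wpM2l (expR_ge0 (- l%:R^-1 : R)) (expR_ge1Dx (l%:R^-1 : R)).
  by rewrite (mulrC _ (expR l%:R^-1)) expRxMexpNx_1.
have h2 : l%:R^-1 <= 1 :> R by rewrite invf_le1 // ler1n.
have h3 : l%:R * l%:R^-1 = 1 :> R by rewrite divff ?gt_eqF.
have q0 := expR_ge0 (- l%:R^-1 : R); rewrite -/q in q0.
have h4 : q * (l%:R + 1) <= l%:R by have := ler_wpM2l (ltW l0R) h1; nra.
have : 1 <= l%:R :> R by rewrite ler1n.
nra.
Qed.

End Poisson.

(** * Riemann sums of the Gaussian along complex lines *)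

Section PoissonSummation.
Variable R : realType.
Local Notation C := R[i].
Implicit Types (x h v w z : C) (T e : R).

Definition tsum (I : eqType) (a : I -> C) : C := xget 0 [set s | has_sum a s].

Lemma has_sum_tsum (I : eqType) (a : I -> C) M : sum_bounded a M -> has_sum a (tsum a).
Proof. by move=> /has_sum_bounded[s hs _]; rewrite /tsum; case: xgetP => [y _ //|/(_ s)]. Qed.

Lemma tsumE (I : eqType) (a : I -> C) s : has_sum a s -> tsum a = s.
Proof.
move=> hs; rewrite /tsum; case: xgetP => [y -> hy|/(_ s)//].
exact: has_sum_unique hy hs.
Qed.

Lemma ler_1Dx_expRN2 (T : R) : (1 + T) * expR (- (2 * T)) <= expR (- T).
Proof.
have -> : - (2 * T) = - T + - T by ring.
rewrite expRD mulrA ler_piMl ?expR_ge0 //.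
by have := ler_wpM2r (expR_ge0 (- T)) (expR_ge1Dx T); rewrite expRxMexpNx_1.
Qed.

(* The sector around the positive reals on which [exp (- pi (w t) ^ 2)] decays. *)
Definition sector : set C := [set w | `|complex.Im w| < complex.Re w].

Lemma Re_sqr_line v w (t : R) :
  complex.Re (w ^+ 2) * t ^+ 2 - 2 * cabs v * cabs w * `|t| - cabs v ^+ 2
    <= complex.Re ((v + w * t%:C) ^+ 2).
Proof.
have h1 := Re_le_cabs (v ^+ 2); have h2 := Re_le_cabs (v * w).
rewrite cabsX in h1; rewrite cabsM in h2.
have -> : complex.Re ((v + w * t%:C) ^+ 2) =
  complex.Re (v ^+ 2) + 2 * t * complex.Re (v * w) + complex.Re (w ^+ 2) * t ^+ 2.
  by case: v w {h1 h2} => [a b] [c d] /=; rewrite !expr2 /=; ring.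
have : `|2 * t * complex.Re (v * w)| <= 2 * cabs v * cabs w * `|t|.
  rewrite !normrM normr_nat.
  have := ler_wpM2l (normr_ge0 t) h2; lra.
move: h1; rewrite !ler_norml => /andP[h1 _] /andP[h3 _]; lra.
Qed.

(** [Re - |Im|] is concave, hence along the segment at least its smaller end value [m]; and the real
    part of a square is [(Re - |Im|) (Re + |Im|)], at least [m^2]. *)
Lemma sector_segment w w' (s : R) : sector w -> sector w' -> 0 <= s <= 1 ->
  Num.min (complex.Re w - `|complex.Im w|) (complex.Re w' - `|complex.Im w'|) ^+ 2
    <= complex.Re ((w + (w' - w) * s%:C) ^+ 2).
Proof.
case: w w' => [a b] [c d]; rewrite /sector /= => ab cd /andP[s0 s1].
set m := Num.min _ _.
have m1 : m <= a - `|b| by rewrite ge_min lexx.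
have m2 : m <= c - `|d| by rewrite ge_min lexx orbT.
have m0 : 0 <= m by rewrite le_min !subr_ge0 !ltW.
rewrite expr2 /=.
set A := a + _; set B := b + _.
have hB : `|B| <= (1 - s) * `|b| + s * `|d|.
  have -> : B = (1 - s) * b + s * d by rewrite /B; ring.
  by apply: (le_trans (ler_normD _ _)); rewrite !normrM (ger0_norm s0) ger0_norm ?subr_ge0.
have hA : A = (1 - s) * a + s * c by rewrite /A; ring.
have h1 : m <= A - `|B|.
  have := ler_wpM2l s0 m2; have : (1 - s) * m <= (1 - s) * (a - `|b|) by rewrite ler_wpM2l // subr_ge0.
  rewrite hA; lra.
have -> : A * A - B * B = (A - `|B|) * (A + `|B|).
  by rewrite -subr_sqr -[X in X - _]expr2 -expr2 real_normK ?num_real.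
by rewrite ler_pM // (le_trans h1) // lerD2l; have := normr_ge0 B; lra.
Qed.

Definition rpt (l : nat) (n : int) : R := n%:~R / l%:R.
Definition gterm (l : nat) v w (n : int) : C := gauss (v + w * (rpt l n)%:C).
(** Stands for the contour integral of [gauss] over the line [v + R w], sampled with step
    [w / l]. *)
Definition riemann (l : nat) v w : C := w / l%:R * tsum (gterm l v w).

Lemma normr_rpt l n : `|rpt l n| = `|n|%N%:R / l%:R.
Proof. by rewrite /rpt normrM normfV normr_nat -intr_norm -abszE. Qed.

Lemma sector_min_gt0 w : sector w -> 0 < complex.Re (w ^+ 2).
Proof.
case: w => a b; rewrite /sector expr2 /= => ab.
rewrite -!expr2 subr_gt0 -[b ^+ 2]real_normK ?num_real //.
by rewrite ltr_pXn2r ?nnegrE // (le_trans _ (ltW ab)).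
Qed.

Lemma sector_neq0 w : sector w -> w != 0.
Proof. by move=> /sector_min_gt0; apply: contraTneq => ->; rewrite expr0n /= ltxx. Qed.

(* The estimates of [gauss_estimates] along the lattice lines [v + w Z / l], uniformly in l. *)
Lemma line_estimates v w v' w' (D : R) : sector w -> sector w' -> 0 <= D ->
  exists C1 : R, exists l0 : nat, [/\ 0 < C1, (0 < l0)%N & forall l n (s : R), (l0 <= l)%N -> 0 <= s <= 1 ->
   let x := v + (v' - v) * s%:C + (w + (w' - w) * s%:C) * (rpt l n)%:C in
   let E := expR (- (2 * (`|n|%N%:R / l%:R))) in
   cabs (gauss x) <= C1 * E /\
   forall h, cabs h <= D * (1 + `|n|%N%:R / l%:R) / l%:R ->
    cabs (gauss (x + h) - gauss x) <= C1 / l%:R * E /\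
    cabs (gauss (x + h) - gauss x + 2 * pi%:C * x * h * gauss x) <= C1 / l%:R ^+ 2 * E].
Proof.
move=> sw sw' D0.
pose V := cabs v + cabs v'; pose W := cabs w + cabs w'.
pose dl := Num.min (complex.Re w - `|complex.Im w|) (complex.Re w' - `|complex.Im w'|) ^+ 2.
have V0 : 0 <= V by rewrite addr_ge0 ?cabs_ge0.
have W0 : 0 <= W by rewrite addr_ge0 ?cabs_ge0.
have d0 : 0 < dl by rewrite exprn_gt0 // lt_min !subr_gt0 sw sw'.
have [C1 [e0 [C0 e00 H]]] := gauss_estimates V0 W0 D0 d0.
have [l0 hl0] : exists l0 : nat, forall l, (l0 <= l)%N -> l%:R^-1 <= e0.
  exists (Num.truncn e0^-1).+1 => l hl.
  have : e0^-1 <= l%:R.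
    apply: ltW; apply: lt_le_trans (_ : (Num.truncn e0^-1).+1%:R <= _); last by rewrite ler_nat.
    by rewrite truncnS_gt.
  by move=> h; rewrite -(invrK e0) lef_pV2 ?posrE ?invr_gt0 // (lt_le_trans _ h) ?invr_gt0.
exists C1, l0.+1; split => // l n s hl s01 x E.
have l1 : (0 < l)%N by apply: leq_trans hl.
have cv (a b : C) : cabs (a + (b - a) * s%:C) <= cabs a + cabs b.
  have -> : a + (b - a) * s%:C = a * (1 - s)%:C + b * s%:C.
    by rewrite rmorphB /=; ring.
  apply: (le_trans (ler_cabsD _ _)); rewrite !cabsM !cabsR.
  move: s01 => /andP[s0 s1]; rewrite !ger0_norm ?subr_ge0 //.
  by have := cabs_ge0 a; have := cabs_ge0 b; nra.
have T0 : 0 <= `|n|%N%:R / l%:R :> R by rewrite divr_ge0.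
have x1 : cabs x <= V + W * (`|n|%N%:R / l%:R).
  apply: (le_trans (ler_cabsD _ _)); rewrite cabsM cabsR normr_rpt.
  by rewrite lerD ?cv // ler_wpM2r ?cv.
have x2 : dl * (`|n|%N%:R / l%:R) ^+ 2 - 2 * V * W * (`|n|%N%:R / l%:R) - V ^+ 2 <= complex.Re (x ^+ 2).
  apply: le_trans (Re_sqr_line _ _ _); rewrite normr_rpt.
  have -> : rpt l n ^+ 2 = (`|n|%N%:R / l%:R) ^+ 2 by rewrite -normr_rpt real_normK ?num_real.
  have h1 := sector_segment sw sw' s01; rewrite -/dl in h1.
  have h2 := ler_wpM2r (sqr_ge0 (`|n|%N%:R / l%:R)) h1.
  have h3 : cabs (v + (v' - v) * s%:C) ^+ 2 <= V ^+ 2.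
    by rewrite lerXn2r ?nnegrE ?cabs_ge0 // cv.
  have h4 : cabs (v + (v' - v) * s%:C) * cabs (w + (w' - w) * s%:C) <= V * W.
    by rewrite ler_pM ?cabs_ge0 // cv.
  have h5 := ler_wpM2r T0 h4; lra.
have [h1 h2] := H x _ T0 x1 x2; split => // h hh.
have := h2 l%:R^-1 h; rewrite invr_ge0 ler0n hl0 ?(ltnW hl) // => /(_ isT hh).
by rewrite exprVn.
Qed.

Lemma gterm_bounded v w : sector w -> exists M : R, forall l, (0 < l)%N ->
  sum_bounded (gterm l v w) (M * l%:R).
Proof.
move=> sw.
have [C1 [e0 [C0 _ H]]] := gauss_estimates (cabs_ge0 v) (cabs_ge0 w) (lexx 0) (sector_min_gt0 sw).
exists (4 * C1) => l l1; apply: exp_sum_bounded (ltW C0) _ => // n.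
have T0 : 0 <= `|n|%N%:R / l%:R :> R by rewrite divr_ge0.
have [||h _] := H (v + w * (rpt l n)%:C) _ T0.
- by apply: (le_trans (ler_cabsD _ _)); rewrite cabsM cabsR normr_rpt.
- have := Re_sqr_line v w (rpt l n); rewrite normr_rpt; congr (_ * _ - _ - _ <= _).
  by rewrite -normr_rpt real_normK ?num_real.
apply: (le_trans h); rewrite ler_wpM2l ?(ltW C0) // ler_expR lerN2 ler_peMl //.
exact: ler1n.
Qed.

Lemma has_sum_gterm v w l : sector w -> (0 < l)%N ->
  has_sum (gterm l v w) (tsum (gterm l v w)).
Proof. by move=> /(gterm_bounded v)[M h] /h /has_sum_tsum. Qed.

Lemma riemann_bounded v w : sector w -> exists M : R,
  forall l, (0 < l)%N -> cabs (riemann l v w) <= M.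
Proof.
move=> /(gterm_bounded v)[M h]; exists (cabs w * M) => l l1.
have := has_sum_cabs_le (has_sum_tsum (h l l1)) (h l l1) => hb.
rewrite /riemann !cabsM cabsV cabs_nat -mulrA ler_wpM2l ?cabs_ge0 //.
by rewrite mulrC ler_pdivrMr ?ltr0n.
Qed.

(* The path from (v, w) to (v', w') is cut in l steps, each changing the Riemann sum by O(1 / l ^ 2). *)
Lemma riemann_homotopy v w v' w' : sector w -> sector w' ->
  exists M : R, exists2 l0 : nat, (0 < l0)%N &
  forall l, (l0 <= l)%N -> cabs (riemann l v' w' - riemann l v w) <= M / l%:R.
Proof.
move=> sw sw'.
pose dv := v' - v; pose dw := w' - w.
pose D := cabs w + cabs w' + cabs dv + cabs dw.
have D0 : 0 <= D by rewrite !addr_ge0 ?cabs_ge0.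
have [C1 [l0 [C0 l00 H]]] := line_estimates v v' sw sw' D0.
pose B := 4 * (4 * D * C1).
exists B, l0 => // l hl.
have l1 : (0 < l)%N by apply: leq_trans hl.
have lR : 0 < l%:R :> R by rewrite ltr0n.
have lC : l%:R != 0 :> C by rewrite pnatr_eq0 -lt0n.
pose sg (s : nat) : R := s%:R / l%:R.
pose vs s := v + dv * (sg s)%:C; pose ws s := w + dw * (sg s)%:C.
have sg01 s : (s <= l)%N -> 0 <= sg s <= 1.
  by move=> sl; rewrite divr_ge0 //= ler_pdivrMr // mul1r ler_nat.
pose T n : R := `|n|%N%:R / l%:R.
have T0 n : 0 <= T n by rewrite divr_ge0.
have bnd s (sl : (s <= l)%N) : has_sum (gterm l (vs s) (ws s)) (tsum (gterm l (vs s) (ws s))).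
  apply: (@has_sum_tsum _ _ (4 * C1 * l%:R)); apply: exp_sum_bounded (ltW C0) _ => // n.
  have [h _] := H l n _ hl (sg01 s sl); apply: (le_trans h).
  rewrite ler_wpM2l ?(ltW C0) // ler_expR lerN2 ler_peMl //; exact: ler1n.
suff step s : (s < l)%N -> cabs (riemann l (vs s.+1) (ws s.+1) - riemann l (vs s) (ws s)) <= B / l%:R ^+ 2.
  have tele m : (m <= l)%N -> cabs (riemann l (vs m) (ws m) - riemann l (vs 0%N) (ws 0%N)) <= m%:R * (B / l%:R ^+ 2).
    elim: m => [|m IH] ml; first by rewrite subrr cabs0 mul0r.
    have -> : riemann l (vs m.+1) (ws m.+1) - riemann l (vs 0%N) (ws 0%N) =
      (riemann l (vs m.+1) (ws m.+1) - riemann l (vs m) (ws m)) + (riemann l (vs m) (ws m) - riemann l (vs 0%N) (ws 0%N)) by ring.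
    apply: (le_trans (ler_cabsD _ _)); rewrite -natr1 [leRHS]mulrDl mul1r addrC.
    by rewrite lerD ?step ?IH // ltnW.
  have := tele l (leqnn l).
  have -> : l%:R * (B / l%:R ^+ 2) = B / l%:R by field; rewrite gt_eqF.
  have -> : vs l = v' by rewrite /vs /sg divff ?gt_eqF // mulr1 /dv; ring.
  have -> : ws l = w' by rewrite /ws /sg divff ?gt_eqF // mulr1 /dw; ring.
  have -> : vs 0%N = v by rewrite /vs /sg mul0r mulr0 addr0.
  by have -> : ws 0%N = w by rewrite /ws /sg mul0r mulr0 addr0.
move=> sl.
(* Discrete Cauchy theorem: [eta] is the step along the current line and [y n] the displacement to
   the next one; the points [x n], [x (n + 1)] and their displacements bound small
   quadrilaterals. *)
pose x n := vs s + ws s * (rpt l n)%:C.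
pose y n := (dv + dw * (rpt l n)%:C) / l%:R.
pose eta := ws s / l%:R.
have xE n : gauss (x n) = gterm l (vs s) (ws s) n by [].
have xyE n : gauss (x n + y n) = gterm l (vs s.+1) (ws s.+1) n.
  rewrite /gterm; congr gauss; rewrite /x /y /vs /ws /sg -natr1 !rmorphM !rmorphD /= !fmorphV /= !rmorph_nat.
  by field.
have xS n : x (n + 1) = x n + eta.
  rewrite /x /eta /rpt intrD !rmorphM !rmorphD /= fmorphV /= !rmorph_nat; by field.
have yS n : y (n + 1) = y n + dw / l%:R ^+ 2.
  by rewrite /y /rpt intrD !rmorphM !rmorphD /= fmorphV /= !rmorph_nat; field.
have est n := H l n _ hl (sg01 s (ltnW sl)).
have eta_le n : cabs eta <= D * (1 + T n) / l%:R.
  rewrite cabsM cabsV cabs_nat ler_wpM2r ?invr_ge0 //.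
  have : cabs (ws s) <= cabs w + cabs w'.
    have -> : ws s = w * (1 - sg s)%:C + w' * (sg s)%:C by rewrite /ws /dw rmorphB /=; ring.
    apply: (le_trans (ler_cabsD _ _)); rewrite !cabsM !cabsR.
    move: (sg01 s (ltnW sl)) => /andP[s0 s1]; rewrite !ger0_norm ?subr_ge0 //.
    by have := cabs_ge0 w; have := cabs_ge0 w'; nra.
  have DE : cabs w + cabs w' <= D by rewrite /D -addrA lerDl addr_ge0 ?cabs_ge0.
  by have := mulr_ge0 D0 (T0 n); lra.
have y_le n : cabs (y n) <= D * (1 + T n) / l%:R.
  rewrite cabsM cabsV cabs_nat ler_wpM2r ?invr_ge0 //.
  apply: (le_trans (ler_cabsD _ _)); rewrite cabsM cabsR normr_rpt -/(T n).
  have : cabs dw <= D by rewrite lerDr !addr_ge0 ?cabs_ge0.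
  have : cabs dv <= D.
    by rewrite /D; have := cabs_ge0 w; have := cabs_ge0 w'; have := cabs_ge0 dw; lra.
  have := T0 n; nra.
(* The transversal sides telescope: [yg] is summable, so its shift by one has the same sum, and
   their difference may be subtracted for free. *)
pose yg n := y n * gauss (x n).
have yg_bound : sum_bounded yg (4 * (D / l%:R * C1) * l%:R).
  apply: exp_sum_bounded => // [|n]; first by rewrite mulr_ge0 ?divr_ge0 // ltW.
  have [h _] := est n; rewrite -/(x n) -/(T n) in h *.
  rewrite /yg cabsM.
  have h2 := ler_pM (cabs_ge0 _) (cabs_ge0 _) (y_le n) h.
  apply: (le_trans h2).
  have eT : (1 + T n) * expR (- (2 * T n)) <= expR (- T n).
    exact: ler_1Dx_expRN2.
  have : 0 <= D / l%:R * C1 by rewrite mulr_ge0 ?divr_ge0 // ltW.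
  move=> /ler_wpM2l /(_ _ _ eT); lra.
have hyg := has_sum_tsum yg_bound.
have hyg1 : has_sum (fun n => yg (n + 1)) (tsum yg).
  apply: (has_sum_bij (e := fun n : int => n + 1) (f := fun n => n - 1)) hyg.
    by move=> n; rewrite addrK.
  by move=> n; rewrite subrK.
have := has_sumB (has_sumB (has_sumZ (ws s.+1 / l%:R) (bnd _ sl)) (has_sumZ (ws s / l%:R) (bnd _ (ltnW sl))))
   (has_sumB hyg1 hyg).
rewrite subrr subr0 -/(riemann l (vs s.+1) (ws s.+1)) -/(riemann l (vs s) (ws s)) => hT.
have -> : B / l%:R ^+ 2 = 4 * (4 * D * C1 / l%:R ^+ 3) * l%:R.
  by rewrite /B; field; rewrite gt_eqF.
apply: has_sum_cabs_le hT _; apply: exp_sum_bounded => // [|n].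
  by rewrite !mulr_ge0 ?invr_ge0 ?exprn_ge0 // ltW.
have [h0 hx] := est n; rewrite -/(x n) -/(T n) in h0 hx *.
have [a1 a2] := hx _ (eta_le n); have [b1 b2] := hx _ (y_le n).
have wsS : ws s.+1 / l%:R = eta + dw / l%:R ^+ 2.
  by rewrite /eta /ws /sg -natr1 !rmorphM !rmorphD /= fmorphV /= !rmorph_nat; field.
rewrite -xyE -xE /yg xS yS wsS -/eta.
set g0 := gauss (x n) in h0 a1 a2 b1 b2 *; set gy := gauss (x n + y n) in a1 a2 b1 b2 *.
set ge := gauss (x n + eta) in a1 a2 b1 b2 *.
(* To first order the increments along [eta] and [y n] cancel, both giving the same multiple of
   [eta * y n]. Two Taylor remainders and the term in [dw] are left, each of size [1 / l^3]. *)
have -> : (eta + dw / l%:R ^+ 2) * gy - eta * g0 - ((y n + dw / l%:R ^+ 2) * ge - y n * g0) =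
  eta * (gy - g0 + 2 * pi%:C * x n * y n * g0) - y n * (ge - g0 + 2 * pi%:C * x n * eta * g0)
  + dw / l%:R ^+ 2 * ((gy - g0) - (ge - g0)) by ring.
have := ler_cabsD (eta * (gy - g0 + 2 * pi%:C * x n * y n * g0) - y n * (ge - g0 + 2 * pi%:C * x n * eta * g0))
  (dw / l%:R ^+ 2 * ((gy - g0) - (ge - g0))).
have := ler_cabsB (eta * (gy - g0 + 2 * pi%:C * x n * y n * g0)) (y n * (ge - g0 + 2 * pi%:C * x n * eta * g0)).
have := ler_cabsB (gy - g0) (ge - g0).
have c3 : cabs (dw / l%:R ^+ 2) = cabs dw / l%:R ^+ 2 by rewrite cabsM cabsV cabsX cabs_nat.
rewrite (cabsM eta) (cabsM (y n)) (cabsM (dw / _)) c3.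
have i1 := ler_pM (cabs_ge0 _) (cabs_ge0 _) (eta_le n) b2.
have i2 := ler_pM (cabs_ge0 _) (cabs_ge0 _) (y_le n) a2.
have dwD : cabs dw <= D by rewrite lerDr !addr_ge0 ?cabs_ge0.
have i3 : cabs dw / l%:R ^+ 2 * cabs (gy - g0 - (ge - g0)) <=
   D / l%:R ^+ 2 * (2 * (C1 / l%:R * expR (- (2 * T n)))).
  rewrite ler_pM ?cabs_ge0 ?divr_ge0 ?cabs_ge0 ?exprn_ge0 //.
    by rewrite ler_wpM2r // invr_ge0 exprn_ge0.
  by apply: (le_trans (ler_cabsB _ _)); lra.
have eT : (1 + T n) * expR (- (2 * T n)) <= expR (- T n).
  exact: ler_1Dx_expRN2.
have eT2 : expR (- (2 * T n)) <= expR (- T n) by rewrite ler_expR lerN2 ler_peMl // ler1n.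
have DC : 0 <= D * C1 / l%:R ^+ 3 by rewrite !mulr_ge0 ?invr_ge0 ?exprn_ge0 // ltW.
have j1 := ler_wpM2l DC eT; have j2 := ler_wpM2l DC eT2.
have e1 : D * (1 + T n) / l%:R * (C1 / l%:R ^+ 2 * expR (- (2 * T n))) =
   D * C1 / l%:R ^+ 3 * ((1 + T n) * expR (- (2 * T n))) by field; rewrite gt_eqF.
have e2 : D / l%:R ^+ 2 * (2 * (C1 / l%:R * expR (- (2 * T n)))) =
   2 * (D * C1 / l%:R ^+ 3 * expR (- (2 * T n))) by field; rewrite gt_eqF.
have -> : 4 * D * C1 / l%:R ^+ 3 = 4 * (D * C1 / l%:R ^+ 3) by field; rewrite gt_eqF.
rewrite e1 in i1 i2; rewrite e2 in i3.
move: (D * C1 / l%:R ^+ 3) => A in i1 i2 i3 j1 j2 *.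
move=> k1 k2 k3; apply: (le_trans k3); apply: (le_trans (lerD k2 i3)).
lra.
Qed.

End PoissonSummation.

(** * The Poisson formula by finite Fourier analysis *)

Section PoissonSummation2.
Variable R : realType.
Local Notation C := R[i].
Implicit Types (x h v w z : C) (T e : R).

Lemma has_sum_finite (I : eqType) (F : seq I) (a : I -> C) : uniq F ->
  (forall i, i \notin F -> a i = 0) -> has_sum a (\sum_(i <- F) a i).
Proof.
move=> uF a0 e e0; exists F => // G uG FG.
have pF : perm_eq F [seq i <- G | i \in F].
  apply: uniq_perm => //; first exact: filter_uniq.
  by move=> i; rewrite mem_filter; case iF : (i \in F) => //=; rewrite FG.
rewrite (perm_big _ pF) big_filter /= (bigID (mem F)) /= [X in _ + X - _]big1 ?addr0 //.
by rewrite subrr cabs0.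
Qed.

(** Tannery's theorem. A finite set [F] carries the majorant up to a small tail, uniformly in [l];
    on [F] itself finitely many terms are made small. *)
Lemma tannery0 (I : eqType) (d : nat -> I -> C) (u : nat -> C) (B : I -> C) M :
  sum_bounded B M -> (forall l i, cabs (d l i) <= cabs (B i)) ->
  (forall i e, 0 < e -> exists l0, forall l, (l0 <= l)%N -> cabs (d l i) < e) ->
  (forall l, has_sum (d l) (u l)) ->
  forall e, 0 < e -> exists l0, forall l, (l0 <= l)%N -> cabs (u l) < e.
Proof.
move=> hB dB d0 du e e0.
have [sB hs] := sum_ge0_sup (fun i => cabs_ge0 (B i)) hB.
have e4 : 0 < e / 8 by rewrite divr_gt0.
have [F uF hF] := hs _ e4.
pose c := e / 8 / (size F).+1%:R.
have c0 : 0 < c by rewrite divr_gt0.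
have [g hg] := choice (fun i => d0 i c c0).
exists (\max_(i <- F) g i)%N => l hl.
have [G uG hG] := du l _ e4.
pose H := undup (F ++ G).
have FH : {subset F <= H} by move=> i iF; rewrite mem_undup mem_cat iF.
have GH : {subset G <= H} by move=> i iF; rewrite mem_undup mem_cat iF orbT.
have h1 := hG H (undup_uniq _) GH.
have h2 := hF H (undup_uniq _) FH; have h3 := hF F uF (fun _ => id).
have pF : perm_eq F [seq i <- H | i \in F].
  apply: uniq_perm => //; first by rewrite filter_uniq ?undup_uniq.
  by move=> i; rewrite mem_filter; case iF : (i \in F) => //=; rewrite FH.
have h4 : \sum_(i <- H | i \notin F) cabs (B i) <= e / 4.
  have : \sum_(i <- H) cabs (B i) = \sum_(i <- F) cabs (B i) + \sum_(i <- H | i \notin F) cabs (B i).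
    by rewrite (bigID (mem F)) /= -big_filter -(perm_big _ pF).
  by move: h2 h3; rewrite !ltr_norml => /andP[? ?] /andP[? ?]; lra.
have h5 : cabs (\sum_(i <- H) d l i) <= e / 8 + e / 4.
  rewrite (bigID (mem F)) /= -big_filter -(perm_big _ pF).
  apply: (le_trans (ler_cabsD _ _)); apply: lerD.
    apply: (le_trans (ler_cabs_sum _ _ _)).
    apply: (@le_trans _ _ (\sum_(i <- F) c)).
      rewrite big_seq [leRHS]big_seq; apply: ler_sum => i iF; apply: ltW; apply: hg.
      by apply: leq_trans hl; rewrite (leq_bigmax_seq (F := g)).
    rewrite big_const_seq count_predT iter_addr_0 /c -[X in X <= _]mulr_natr -mulrA.
    by rewrite ler_piMr ?[0 <= e / 8]ltW // mulrC ler_pdivrMr // mul1r ler_nat.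
  apply: (le_trans (ler_cabs_sum _ _ _)); apply: le_trans h4; exact: ler_sum.
have -> : u l = \sum_(i <- H) d l i - (\sum_(i <- H) d l i - u l) by ring.
apply: (le_lt_trans (ler_cabsB _ _)); lra.
Qed.

Lemma inv_sqr_sum_bounded : sum_bounded (fun n : int => ((1 + `|n|%N%:R ^+ 2)^-1 : R)%:C) 6.
Proof.
have -> : 6 = 2 * 3 :> R by ring.
apply: (@int_sum_bounded R (fun n => ((1 + n%:R ^+ 2)^-1)%:C)).
apply: nat_sum_bounded => [i|m]; first by rewrite invr_ge0 addr_ge0 ?sqr_ge0.
(* The half-integer shifts make [1 / ((t + 1/2) (t + 3/2))] telescope, and it dominates the next
   term [1 / (1 + (t + 1)^2)]. *)
have tele k : \sum_(i < k.+1) (1 + i%:R ^+ 2)^-1 <= 3 - (k%:R + 2^-1)^-1 :> R.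
  elim: k => [|k IH].
    by rewrite big_ord_recr big_ord0 /= expr0n /= add0r addr0 invr1 add0r invrK; lra.
  rewrite big_ord_recr /= -natr1; set t : R := k%:R in IH *.
  have t0 : 0 <= t by rewrite /t ler0n.
  suff : (1 + (t + 1) ^+ 2)^-1 <= (t + 2^-1)^-1 - (t + 1 + 2^-1)^-1.
    by move: IH; set s := \sum_(i < _) _; lra.
  have t1 : 0 < t + 2^-1 by lra.
  have t2 : 0 < t + 1 + 2^-1 by lra.
  have -> : (t + 2^-1)^-1 - (t + 1 + 2^-1)^-1 = ((t + 2^-1) * (t + 1 + 2^-1))^-1.
    have -> : t + 1 + 2^-1 = (t + 2^-1) + 1 by ring.
    set u := t + 2^-1 in t1 *; have u1 : u + 1 != 0 by rewrite gt_eqF //; lra.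
    by field; rewrite u1 gt_eqF.
  have p1 := mulr_gt0 t1 t2.
  have p2 : 0 < 1 + (t + 1) ^+ 2 by rewrite ltr_wpDr ?sqr_ge0.
  rewrite lef_pV2 ?posrE //.
  by rewrite expr2; nra.
case: m => [|m]; first by rewrite big_ord0.
apply: (le_trans (tele m)); rewrite gerBl invr_ge0 addr_ge0 // invr_ge0 //.
Qed.

Lemma cexp_tpi_neq1 (t : R) : 0 < t < 1 -> cexp (tpi * t%:C) != 1.
Proof.
move=> /andP[t0 t1].
have -> : tpi * t%:C = 0 +i* ((pi * t) *+ 2).
  by rewrite /tpi; apply/eqP; rewrite eq_complex /=; apply/andP; split; apply/eqP; ring.
rewrite /cexp /= expR0 mul1r eq_complex /= negb_and; apply/orP; left.
have : 0 < sin (pi * t).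
  by apply: sin_gt0_pi; rewrite mulr_gt0 ?pi_gt0 // gtr_pMr ?pi_gt0.
by rewrite cos_mulr2n cos2sin2 => s0; apply/eqP; nra.
Qed.

(** The modulus is odd so that the frequencies [j - L] fill the symmetric range from -L to L, which
    exhausts Z as L grows. *)
Lemma root_sum (L : nat) (n : int) :
  \sum_(j < L.*2.+1) cexp (- (tpi * ((j%:Z - L%:Z) * n)%:~R / L.*2.+1%:R) : C) =
  if (L.*2.+1 %| n)%Z then L.*2.+1%:R else 0.
Proof.
set l := L.*2.+1; have l0 : l%:R != 0 :> C by rewrite pnatr_eq0.
case: ifP => [/dvdzP[q ->]|ndvd].
  rewrite (eq_bigr (fun=> 1)) ?sumr_const ?card_ord // => j _.
  rewrite (_ : _ / _ = tpi * ((j%:Z - L%:Z) * q)%:~R) ?cexpN ?cexp_tpi_int ?invr1 //.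
  by rewrite !intrM; field.
pose ze := cexp (- (tpi * n%:~R / l%:R) : C).
have zel : ze ^+ l = 1.
  by rewrite /ze -cexpMn mulNrn -(mulr_natr (tpi * n%:~R / l%:R)) divfK // cexpN cexp_tpi_int invr1.
have ze1 : ze != 1.
  rewrite /ze cexpN invr_eq1.
  have -> : tpi * n%:~R / l%:R = tpi * (n %/ l)%Z%:~R + tpi * ((n %% l)%Z%:~R / l%:R : R)%:C :> C.
    rewrite {1}(divz_eq n l) rmorphM /= fmorphV /= rmorph_nat rmorph_int intrD intrM; by field.
  rewrite cexpD cexp_tpi_int mul1r cexp_tpi_neq1 //.
  have m0 : (0 <= n %% l)%Z by apply: modz_ge0.
  have m1 : ((n %% l)%Z < l)%R by apply: ltz_pmod.
  rewrite ltr_pdivlMr ?ltr0n // mul0r ltr0z lt_neqAle m0 andbT eq_sym.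
  rewrite ltr_pdivrMr ?ltr0n // mul1r -[l%:R]/(l%:~R) ltr_int m1 andbT.
  by apply/negP => /eqP m; move: ndvd; rewrite (introT dvdz_mod0P m).
have -> : \sum_(j < l) cexp (- (tpi * ((j%:Z - L%:Z) * n)%:~R / l%:R) : C) =
    cexp (tpi * (L%:Z * n)%:~R / l%:R) * \sum_(j < l) ze ^+ j.
  rewrite mulr_sumr; apply: eq_bigr => j _; rewrite /ze -cexpMn -cexpD; congr cexp.
  by rewrite -mulr_natr !intrM intrB; field.
have := subrX1 ze l; rewrite zel subrr => /esym/eqP; rewrite mulf_eq0 subr_eq0 (negbTE ze1) /=.
by move=> /eqP ->; rewrite mulr0.
Qed.

Section Fourier.
Variables (v w : C).
Hypothesis sw : sector w.

(** The Fourier transform of [t -> gauss (v + w t)] at k, multiplied by w. *)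
Definition dual_term (k : int) : C :=
  cexp (- (pi%:C * (k%:~R / w) ^+ 2) + tpi * k%:~R * v / w).

Let w0 : w != 0 := sector_neq0 sw.

(** Completing the square: a twist by the frequency k amounts to moving the base point v by
    [i k / w]. *)
Lemma gterm_twist l k n : (0 < l)%N ->
  gterm l v w n * cexp (- (tpi * (k * n)%:~R / l%:R)) =
  dual_term k * gterm l (v + ci * k%:~R / w) w n.
Proof.
move=> l0; have lC : l%:R != 0 :> C by rewrite pnatr_eq0 -lt0n.
rewrite /gterm /gauss /dual_term -!cexpD; congr cexp.
rewrite /rpt rmorphM /= fmorphV /= rmorph_nat rmorph_int intrM.
have i2 := ciM R; rewrite /tpi; set I := (ci : C) in i2 *; set P := (pi%:C : C).
have -> : (v + I * k%:~R / w + w * (n%:~R / l%:R)) ^+ 2 =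
  (v + w * (n%:~R / l%:R)) ^+ 2 + 2 * (v + w * (n%:~R / l%:R)) * (I * k%:~R / w) + (I * I) * (k%:~R / w) ^+ 2.
  by ring.
by rewrite i2; field; rewrite w0 lC.
Qed.

(** Averaging over the l-th roots of unity picks Z out of [Z / l]; each twisted sum is again a
    Riemann sum, on a parallel line. *)
Lemma finite_fourier (L : nat) :
  w * tsum (fun n : int => gauss (v + w * n%:~R)) =
  \sum_(j < L.*2.+1) dual_term (j%:Z - L%:Z) *
     riemann L.*2.+1 (v + ci * (j%:Z - L%:Z)%:~R / w) w.
Proof.
set l := L.*2.+1; have l0 : l%:R != 0 :> C by rewrite pnatr_eq0.
pose k (j : 'I_l) := j%:Z - L%:Z.
have h1 : has_sum (fun n => \sum_(j < l) dual_term (k j) * gterm l (v + ci * (k j)%:~R / w) w n)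
   (\sum_(j < l) dual_term (k j) * tsum (gterm l (v + ci * (k j)%:~R / w) w)).
  by apply: has_sum_sum => j _; apply: has_sumZ; exact: has_sum_gterm.
have h2 : has_sum (fun n : int => gterm l v w (n * l%:Z)) (tsum (fun n : int => gauss (v + w * n%:~R))).
  have := @has_sum_gterm _ v w 1 sw isT.
  rewrite (_ : gterm 1 v w = fun n : int => gauss (v + w * n%:~R)).
    apply: has_sum_ext => n; rewrite /gterm /rpt; congr (gauss (v + w * _)).
    by rewrite intrM -[l%:~R]/(l%:R) mulfK ?pnatr_eq0 // rmorph_int.
  by apply/funext => n; rewrite /gterm /rpt divr1 rmorph_int.
have h3 : has_sum (fun n => if (l %| n)%Z then l%:R * gterm l v w n else 0)
    (l%:R * tsum (fun n : int => gauss (v + w * n%:~R))).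
  apply: (has_sum_inj (e := fun n : int => n * l%:Z)).
  - by move=> m n /mulIf; apply.
  - by move=> i h; case: dvdzP => // -[q iq]; case: (h q).
  by apply: has_sum_ext (has_sumZ l%:R h2) => n /=; rewrite dvdz_mull.
have E : l%:R * tsum (fun n : int => gauss (v + w * n%:~R)) =
   \sum_(j < l) dual_term (k j) * tsum (gterm l (v + ci * (k j)%:~R / w) w).
  apply: has_sum_unique h3 _; apply: has_sum_ext h1 => n.
  rewrite (eq_bigr (fun j => gterm l v w n * cexp (- (tpi * (k j * n)%:~R / l%:R)))); last first.
    by move=> j _; rewrite gterm_twist.
  by rewrite -mulr_sumr root_sum; case: ifP => _; rewrite ?mulr0 // mulrC.
apply: (mulfI l0); rewrite mulrCA E !mulr_sumr; apply: eq_bigr => j _.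
by rewrite /riemann; field.
Qed.

Lemma second_difference_root (t : R) :
  cexp (tpi * t%:C) + cexp (- (tpi * t%:C)) - 2 = (- (4 * sin (pi * t) ^+ 2))%:C :> C.
Proof.
have -> : tpi * t%:C = 0 +i* ((pi * t) *+ 2).
  by rewrite /tpi; apply/eqP; rewrite eq_complex /=; apply/andP; split; apply/eqP; ring.
apply/eqP; rewrite /cexp eq_complex /= !oppr0 !expR0 !cosN !sinN cos_mulr2n cos2sin2.
by apply/andP; split; apply/eqP; ring.
Qed.

Lemma sqr_le_sin (t : R) : `|t| <= 2^-1 -> t ^+ 2 <= 4 * sin (pi * t) ^+ 2.
Proof.
wlog t0 : t / 0 <= t => [H|].
  have [/H //|/ltW t0] := leP 0 t.
  by rewrite -normrN => h; have := H (- t); rewrite oppr_ge0 mulrN sinN !sqrrN; apply.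
rewrite ger0_norm // => t1; have p2 := pi_ge2 R.
have h : pi * t / 4 <= sin (pi * t).
  by apply: sin_ge_quarter; rewrite mulr_ge0 ?pi_ge0 //= ler_wpM2l ?pi_ge0.
have h1 : t / 2 <= sin (pi * t) by apply: le_trans h; nra.
have : (t / 2) ^+ 2 <= sin (pi * t) ^+ 2.
  by rewrite lerXn2r ?nnegrE ?divr_ge0 // (le_trans _ h1) // divr_ge0.
have -> : (t / 2) ^+ 2 = t ^+ 2 / 4 by field.
lra.
Qed.

(* Two summations by parts in the n-th sum. *)
Lemma dual_term_le : exists M : R, exists L0 : nat, forall L k, (L0 <= L)%N -> (0 < `|k| <= L)%N ->
  cabs (dual_term k * riemann L.*2.+1 (v + ci * k%:~R / w) w) <= M / (1 + `|k|%N%:R ^+ 2).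
Proof.
have [C1 [l0 [C0 l00 H]]] := line_estimates v v sw sw (cabs_ge0 w).
exists (16 * cabs w * C1), l0 => L k hL /andP[k0 kL].
set l := L.*2.+1; have hl : (l0 <= l)%N by rewrite /l; lia.
have lR : 0 < l%:R :> R by rewrite ltr0n.
have lC : l%:R != 0 :> C by rewrite pnatr_eq0.
pose t : R := k%:~R / l%:R.
pose z n := cexp (- (tpi * (k * n)%:~R / l%:R)) : C.
have kR : `|k%:~R| = `|k|%N%:R :> R by rewrite -intr_norm -abszE.
have t1 : `|t| <= 2^-1.
  rewrite normrM normfV normr_nat kR ler_pdivrMr // mulrC ler_pdivlMr //.
  by rewrite -natrM ler_nat /l; lia.
pose S := dual_term k * tsum (gterm l (v + ci * k%:~R / w) w).
have hS : has_sum (fun n => gterm l v w n * z n) S.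
  apply: has_sum_ext (has_sumZ (dual_term k) (has_sum_gterm (v + ci * k%:~R / w) sw (ltn0Sn _))) => n.
  by rewrite -gterm_twist.
have zD m n : z (m + n) = z m * z n.
  by rewrite /z -cexpD; congr cexp; rewrite mulrDr intrD; field.
have tC : t%:C = k%:~R / l%:R :> C by rewrite rmorphM /= fmorphV /= rmorph_nat rmorph_int.
have z1 : z 1 = cexp (- (tpi * t%:C)) by rewrite /z mulr1 tC mulrA.
have zN1 : z (- 1) = cexp (tpi * t%:C) by rewrite /z mulrN1 mulrNz mulrN mulNr opprK tC mulrA.
have hP : has_sum (fun n => gterm l v w (n + 1) * z (n + 1)) S.
  by apply: (has_sum_bij (e := fun n : int => n + 1) (f := fun n => n - 1)) hS => n; rewrite ?addrK ?subrK.
have hM : has_sum (fun n => gterm l v w (n - 1) * z (n - 1)) S.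
  by apply: (has_sum_bij (e := fun n : int => n - 1) (f := fun n => n + 1)) hS => n; rewrite ?addrK ?subrK.
(* Shifting the index by one either way does not change the sum. The combination with weights
   [z (- 1)], -2 and [z 1] multiplies it by [- 4 sin^2 (pi t)], of modulus at least [t^2], and turns
   its terms into second differences of size [1 / l^2]. *)
have := has_sumD (has_sumB (has_sumZ (z (- 1)) hP) (has_sumZ 2 hS)) (has_sumZ (z 1) hM).
have -> : z (- 1) * S - 2 * S + z 1 * S = (- (4 * sin (pi * t) ^+ 2))%:C * S.
  by rewrite -second_difference_root zN1 z1; ring.
move=> hT.
have bT : cabs ((- (4 * sin (pi * t) ^+ 2))%:C * S) <= 4 * (2 * C1 / l%:R ^+ 2) * l%:R.
  apply: has_sum_cabs_le hT _; apply: exp_sum_bounded => // [|n].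
    by rewrite mulr_ge0 ?invr_ge0 ?exprn_ge0 // mulr_ge0 // ltW.
  have zz : z (- 1) * z 1 = 1 by rewrite -zD addNr /z mulr0 mulr0 mul0r oppr0 cexp0.
  have -> : z (- 1) * (gterm l v w (n + 1) * z (n + 1)) - 2 * (gterm l v w n * z n) +
     z 1 * (gterm l v w (n - 1) * z (n - 1)) =
     z n * ((z (-1) * z 1) * gterm l v w (n + 1) - 2 * gterm l v w n + (z (-1) * z 1) * gterm l v w (n - 1)).
    by rewrite !zD; ring.
  rewrite zz; set bp := gterm _ _ _ (n + 1); set bm := gterm _ _ _ (n - 1); set bn := gterm _ _ _ n.
  rewrite 2!(mul1r (_ : C)) cabsM.
  have -> : cabs (z n) = 1.
    have -> : z n = cexp (tpi * (- ((k * n)%:~R / l%:R) : R)%:C).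
      have E : ((k * n)%:~R / l%:R : R)%:C = (k * n)%:~R / l%:R :> C.
        by rewrite rmorphM /= fmorphV /= rmorph_nat rmorph_int.
      by rewrite /z rmorphN /= E; congr cexp; ring.
    by rewrite cabs_cexp_tpi.
  rewrite mul1r.
  have [|_ h] := H l n 0 hl; first by rewrite lexx ler01.
  rewrite !mulr0 !addr0 in h.
  have D1 : cabs (w / l%:R) <= cabs w * (1 + `|n|%N%:R / l%:R) / l%:R.
    rewrite cabsM cabsV cabs_nat ler_wpM2r ?invr_ge0 // ler_peMr ?cabs_ge0 // lerDl divr_ge0 //.
  have D2 : cabs (- (w / l%:R)) <= cabs w * (1 + `|n|%N%:R / l%:R) / l%:R by rewrite cabsN.
  have [_ h1] := h _ D1; have [_ h2] := h _ D2.
  set x := v + w * (rpt R l n)%:C in h h1 h2.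
  have e1 : gterm l v w (n + 1) = gauss (x + w / l%:R).
    congr gauss; rewrite /x /rpt intrD !rmorphM !rmorphD /= fmorphV /= rmorph_nat; by field.
  have e2 : gterm l v w (n - 1) = gauss (x + - (w / l%:R)).
    congr gauss; rewrite /x /rpt intrB !rmorphM !rmorphB /= fmorphV /= rmorph_nat; by field.
  have e3 : gterm l v w n = gauss x by [].
  rewrite /bp /bm /bn e1 e2 e3.
  have -> : gauss (x + w / l%:R) - 2 * gauss x + gauss (x + - (w / l%:R)) =
    (gauss (x + w / l%:R) - gauss x + 2 * pi%:C * x * (w / l%:R) * gauss x) +
    (gauss (x + - (w / l%:R)) - gauss x + 2 * pi%:C * x * (- (w / l%:R)) * gauss x) by ring.
  apply: (le_trans (ler_cabsD _ _)).
  have eT : expR (- (2 * (`|n|%:R / l%:R))) <= expR (- (`|n|%:R / l%:R) : R).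
    by rewrite ler_expR lerN2 ler_peMl ?divr_ge0 // ler1n.
  have c0 : 0 <= C1 / l%:R ^+ 2 by rewrite divr_ge0 ?exprn_ge0 // ltW.
  have := ler_wpM2l c0 eT; lra.
have s4 : 0 <= 4 * sin (pi * t) ^+ 2 by rewrite mulr_ge0 // sqr_ge0.
rewrite cabsM cabsR normrN ger0_norm // in bT.
have hs := ler_wpM2r (cabs_ge0 S) (sqr_le_sin t1).
have kk : 1 <= `|k|%N%:R :> R by rewrite ler1n.
have t2 : t ^+ 2 = `|k|%N%:R ^+ 2 / l%:R ^+ 2.
  by rewrite -[t ^+ 2]real_normK ?num_real // /t normrM normfV normr_nat kR expr_div_n.
have -> : dual_term k * riemann l (v + ci * k%:~R / w) w = w / l%:R * S.
  by rewrite /riemann /S; ring.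
rewrite (cabsM (w / l%:R)) (cabsM w) cabsV cabs_nat ler_pdivlMr ?ltr_wpDr ?sqr_ge0 //.
have hk : 1 + `|k|%N%:R ^+ 2 <= 2 * `|k|%N%:R ^+ 2 :> R by rewrite expr2; nra.
have h3 : `|k|%N%:R ^+ 2 * cabs S <= 8 * C1 * l%:R.
  have := le_trans hs bT; rewrite t2 => h.
  have l2 : 0 < l%:R ^+ 2 :> R by rewrite exprn_gt0.
  rewrite -(ler_pM2r (x := (l%:R ^+ 2)^-1)) ?invr_gt0 //.
  have -> : `|k|%:R ^+ 2 * cabs S / l%:R ^+ 2 = `|k|%:R ^+ 2 / l%:R ^+ 2 * cabs S by ring.
  by apply: (le_trans h); rewrite le_eqVlt; apply/orP; left; apply/eqP; field; rewrite gt_eqF.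
have S0 := cabs_ge0 S; have w00 := cabs_ge0 w.
apply: (@le_trans _ _ (cabs w / l%:R * (2 * (`|k|%:R ^+ 2 * cabs S)))).
  rewrite -[leLHS]mulrA ler_wpM2l ?divr_ge0 //.
  apply: (le_trans (ler_wpM2l S0 hk)); rewrite le_eqVlt; apply/orP; left; apply/eqP; ring.
apply: (@le_trans _ _ (cabs w / l%:R * (2 * (8 * C1 * l%:R)))).
  by rewrite ler_wpM2l ?divr_ge0 // ler_pM2l.
by rewrite le_eqVlt; apply/orP; left; apply/eqP; field; rewrite gt_eqF.
Qed.

(** The sector is stable under inversion, so up to a constant the dual terms form a Gaussian family
    again, on a line of direction [w^-1]. *)
Lemma dual_term_bounded : exists M : R, sum_bounded dual_term M.
Proof.
have sV : sector w^-1.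
  case: w sw w0 => a b; rewrite /sector /= => ab z0.
  have n0 : 0 < a ^+ 2 + b ^+ 2.
    by rewrite ltr_wpDr ?sqr_ge0 // exprn_gt0 // (le_lt_trans _ ab).
  by rewrite normrN normrM normfV (gtr0_norm n0) ltr_pM2r ?invr_gt0.
have [M hM] := gterm_bounded (- ci * v) sV.
have := hM 1%N isT; rewrite mulr1 => h.
exists (cabs (cexp (- (pi%:C * v ^+ 2))) * M).
have := sum_boundedZ (cexp (- (pi%:C * v ^+ 2))) h; congr sum_bounded.
apply/funext => k; rewrite /gterm /gauss /dual_term -cexpD; congr cexp.
rewrite /rpt divr1 rmorph_int.
have i2 := ciM R; rewrite /tpi; set I := (ci : C) in i2 *.
have -> : (- I * v + w^-1 * k%:~R) ^+ 2 = (I * I) * v ^+ 2 - 2 * I * v * k%:~R / w + (k%:~R / w) ^+ 2 by ring.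
by rewrite i2; ring.
Qed.

Lemma small_div (M e : R) : 0 < e -> exists l0 : nat, forall l, (l0 <= l)%N -> M / l.+1%:R < e.
Proof.
move=> e0; exists (Num.truncn (`|M| / e)).+1 => l hl; rewrite ltr_pdivrMr ?ltr0n //.
have h : `|M| / e < l.+1%:R.
  by apply: (lt_le_trans (truncnS_gt _)); rewrite ler_nat; exact: leqW.
by rewrite ltr_pdivrMr // in h; rewrite mulrC; apply: le_lt_trans h; exact: ler_norm.
Qed.

(** By homotopy the Riemann sums in [finite_fourier] approach the single one at [(0, 1)], and
    [dual_term_le] provides the majorant that [tannery0] asks for. The limit of that common factor
    is still unknown here. *)
Lemma poisson_approx e : 0 < e -> exists L0, forall L, (L0 <= L)%N ->
  cabs (w * tsum (fun n : int => gauss (v + w * n%:~R))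
    - riemann L.*2.+1 0 1 * tsum dual_term) < e.
Proof.
move=> e0; have s1 : sector (1 : C) by rewrite /sector /= normr0 ltr01.
have [M [N hM]] := dual_term_le; have [Md hMd] := dual_term_bounded.
have [M0 hM0] := riemann_bounded (v + ci * 0%:~R / w) sw.
have [M1 hM1] := riemann_bounded 0 s1.
(* The shift from L to [L + N] puts every index in the range where [dual_term_le] holds. *)
pose d (L : nat) (k : int) : C := (if (`|k| <= L + N)%N then dual_term k * riemann (L + N).*2.+1 (v + ci * k%:~R / w) w else 0)
   - riemann (L + N).*2.+1 0 1 * dual_term k.
pose A : R := `|M| + cabs (dual_term 0) * `|M0|.
have A0 : 0 <= A by rewrite addr_ge0 ?mulr_ge0 ?cabs_ge0.
pose B k : C := A%:C * ((1 + `|k|%N%:R ^+ 2)^-1)%:C + `|M1|%:C * (cabs (dual_term k))%:C.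
have bB := sum_boundedD (sum_boundedZ A%:C inv_sqr_sum_bounded)
  (sum_boundedZ `|M1|%:C (sum_bounded_le (fun k => _ : cabs (cabs (dual_term k))%:C <= _) hMd)).
have {}bB : exists M', sum_bounded B M'.
  by eexists; apply: bB => k; rewrite cabsR ger0_norm ?cabs_ge0.
have [M' {}bB] := bB.
have i0 (k : int) : 0 <= (1 + `|k|%N%:R ^+ 2)^-1 :> R by rewrite invr_ge0 addr_ge0 ?sqr_ge0.
have BE k : cabs (B k) = A * (1 + `|k|%N%:R ^+ 2)^-1 + `|M1| * cabs (dual_term k).
  rewrite /B -!rmorphM -rmorphD cabsR ger0_norm // addr_ge0 ?mulr_ge0 ?cabs_ge0 ?i0 //.
have hd : forall L k, cabs (d L k) <= cabs (B k).
  move=> L k; rewrite BE; apply: (le_trans (ler_cabsB _ _)); apply: lerD; last first.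
    rewrite cabsM ler_wpM2r ?cabs_ge0 // (le_trans (hM1 _ _)) ?ler_norm //.
  case: ifP => kL; last by rewrite cabs0 mulr_ge0.
  have [->|k0] := eqVneq k 0.
    rewrite absz0 expr0n /= addr0 invr1 mulr1 cabsM /A.
    apply: (@le_trans _ _ (cabs (dual_term 0) * `|M0|)); last by rewrite lerDr.
    by rewrite ler_wpM2l ?cabs_ge0 // (le_trans (hM0 _ _)) ?ler_norm.
  apply: (@le_trans _ _ (M / (1 + `|k|%N%:R ^+ 2))).
    by apply: hM; rewrite ?leq_addl // kL andbT absz_gt0.
  rewrite ler_wpM2r // /A (le_trans (ler_norm M)) // lerDl mulr_ge0 ?cabs_ge0 //.
have dlim : forall k e, 0 < e -> exists L0, forall L, (L0 <= L)%N -> cabs (d L k) < e.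
  move=> k {e0}e e0.
  have [Mh [l0 l00 hh]] := riemann_homotopy 0 (v + ci * k%:~R / w) s1 sw.
  have [l1 hl1] := small_div (cabs (dual_term k) * Mh) e0.
  exists (`|k| + l0 + l1)%N => L hL; rewrite /d ifT; last by lia.
  rewrite -[riemann _ 0 1 * _]mulrC -mulrBr cabsM.
  have := hh (L + N).*2.+1; move=> /(_ ltac:(lia)) h.
  apply: le_lt_trans (hl1 (L + N).*2 _); last by lia.
  by rewrite -[leRHS]mulrA ler_wpM2l ?cabs_ge0.
have hsum : forall L, has_sum (d L) (w * tsum (fun n : int => gauss (v + w * n%:~R))
    - riemann (L + N).*2.+1 0 1 * tsum dual_term).
  move=> L; apply: has_sumB; last by apply: has_sumZ; exact: has_sum_tsum hMd.
  pose F := [seq j%:Z - (L + N)%:Z | j <- iota 0 (L + N).*2.+1].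
  rewrite (finite_fourier (L + N)).
  have -> : \sum_(j < (L + N).*2.+1) dual_term (j%:Z - (L + N)%:Z) *
     riemann (L + N).*2.+1 (v + ci * (j%:Z - (L + N)%:Z)%:~R / w) w =
    \sum_(k <- F) (if (`|k| <= L + N)%N then dual_term k * riemann (L + N).*2.+1 (v + ci * k%:~R / w) w else 0).
    rewrite /F big_map -[iota _ _]/(index_iota 0 (L + N).*2.+1) big_mkord.
    by apply: eq_bigr => j _; rewrite ifT //; have := ltn_ord j; lia.
  apply: has_sum_finite.
    by rewrite map_inj_uniq ?iota_uniq // => i j; lia.
  move=> k kF; case: ifP => // kL; case/negP: kF.
  by apply/mapP; exists (absz (k + (L + N)%:Z)); rewrite ?mem_iota; lia.
have [L0 h] := tannery0 bB hd dlim hsum e0.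
exists (L0 + N)%N => L hL; have := h (L - N)%N; rewrite subnK; last by lia.
by apply; lia.
Qed.

End Fourier.

Lemma gauss_sum_neq0 : tsum (fun n : int => gauss (n%:~R : C)) != 0.
Proof.
have s1 : sector (1 : C) by rewrite /sector /= normr0 ltr01.
have hs : has_sum (fun n : int => gauss (n%:~R : C)) (tsum (fun n : int => gauss (n%:~R : C))).
  have [M /(_ 1%N isT)] := gterm_bounded (0 : C) s1.
  rewrite (_ : gterm 1 0 1 = fun n : int => gauss (n%:~R : C)); first exact: has_sum_tsum.
  by apply/funext => n; rewrite /gterm /rpt divr1 rmorph_int add0r mul1r.
apply/eqP => t0; rewrite t0 in hs.
have [F uF hF] := hs 1 ltr01.
pose G := undup (0 :: F).
have : cabs (\sum_(i <- G) gauss (i%:~R : C)) < 1.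
  by rewrite -[X in cabs X]subr0; apply: hF (undup_uniq _) _ => i iF; rewrite mem_undup inE iF orbT.
have gR (i : int) : gauss (i%:~R : C) = (expR (- (pi * i%:~R ^+ 2)))%:C.
  by rewrite /gauss -cexp_real; congr cexp; rewrite rmorphN rmorphM rmorphXn /= rmorph_int.
rewrite (eq_bigr _ (fun i _ => gR i)) -rmorph_sum cabsR ger0_norm; last first.
  by rewrite sumr_ge0 // => i _; exact: expR_ge0.
rewrite (bigD1_seq 0) ?undup_uniq ?mem_undup ?inE ?eqxx //=.
rewrite expr0n mulr0 oppr0 expR0 ltNge lerDl sumr_ge0 // => i _; exact: expR_ge0.
Qed.

Theorem poisson_gauss v w : sector w ->
  w * tsum (fun n : int => gauss (v + w * n%:~R)) = tsum (dual_term v w).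
Proof.
move=> sw; have s1 : sector (1 : C) by rewrite /sector /= normr0 ltr01.
have a1 := poisson_approx 0 s1; have a2 := poisson_approx v sw.
set th := tsum (fun n : int => gauss (n%:~R : C)).
have t0 : 0 < cabs th by rewrite cabs_gt0 gauss_sum_neq0.
have E1 : (fun n : int => gauss (0 + 1 * n%:~R : C)) = (fun n : int => gauss (n%:~R : C)).
  by apply/funext => n; rewrite add0r mul1r.
have E2 : dual_term 0 (1 : C) = (fun n : int => gauss (n%:~R : C)).
  by apply/funext => n; rewrite /dual_term /gauss mulr0 mul0r addr0 divr1.
(* For [v = 0], [w = 1] both sides are the same nonzero number [th], so [a1] says that the unknown
   factor tends to 1. *)
rewrite E1 E2 -/th mul1r in a1.
apply/eqP; rewrite -subr_eq0; apply/eqP; apply: small_cabs_eq0 => e e0.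
have e2 : 0 < e / 2 by rewrite divr_gt0.
pose G := tsum (dual_term v w); have G1 : 0 < cabs G + 1 by rewrite ltr_wpDl ?cabs_ge0.
have e3 : 0 < e / 2 * cabs th / (cabs G + 1) by rewrite divr_gt0 // mulr_gt0.
have [L1 h1] := a1 _ e3; have [L2 h2] := a2 _ e2.
have := h1 (L1 + L2)%N (leq_addr _ _); have := h2 (L1 + L2)%N (leq_addl _ _).
set r := riemann _ _ _; rewrite -/G => k2.
have -> : th - r * th = (1 - r) * th by ring.
move=> k1; have {}k1 : cabs (1 - r) * (cabs G + 1) < e / 2.
  by rewrite -(ltr_pM2r t0); move: k1; rewrite cabsM ltr_pdivlMr // mulrAC.
set X := w * _ in k2 *.
have -> : X - G = (X - r * G) - (1 - r) * G by ring.
apply: (le_lt_trans (ler_cabsB _ _)); rewrite cabsM.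
have := cabs_ge0 (1 - r); nra.
Qed.

End PoissonSummation2.

(** * Residue symbols and reciprocity *)

Section LegendreSymbol.
Variable p : nat.
Hypotheses (p_pr : prime p) (p_odd : odd p).
Local Notation h := p./2.
Local Notation Fp := 'F_p.

Let p_gt2 : (2 < p)%N := odd_prime_gt2 p_odd p_pr.
Let p_gt0 : (0 < p)%N := prime_gt0 p_pr.
Let charp : p \in [pchar Fp] := pchar_Fp p_pr.

Lemma double_half_prime : p = h.*2.+1.
Proof. by rewrite -[LHS]odd_double_half p_odd. Qed.

Lemma Fp_intr_eq (a b : int) : ((a%:~R : Fp) == b%:~R) = (p %| a - b)%Z.
Proof. by rewrite (dvdz_pcharf charp) intrB subr_eq0. Qed.

Lemma Fp_small_eq0 (a : int) : (`|a| < p)%N -> (p %| a)%Z -> a = 0.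
Proof.
move=> ap; rewrite dvdzE /=; case: (posnP `|a|%N) => [/eqP|a0]; first by rewrite absz_eq0 => /eqP.
by rewrite gtnNdvd.
Qed.

Lemma Fp_expr_pred (x : Fp) : x != 0 -> x ^+ p.-1 = 1.
Proof.
move=> x0; apply: (mulfI x0); rewrite -exprS prednK // mulr1.
by have := expf_card x; rewrite card_Fp.
Qed.

Lemma Fp_sqr_inj : {in [pred k | (k < h)%N] &, injective (fun k : nat => (k.+1%:R : Fp) ^+ 2)}.
Proof.
have pE := double_half_prime.
move=> k l; rewrite !inE => kh lh /eqP.
rewrite -subr_eq0 subr_sqr mulf_eq0 => /orP[|].
  rewrite -[k.+1%:R]/((k.+1%:Z)%:~R) -[l.+1%:R]/((l.+1%:Z)%:~R) -intrB -(dvdz_pcharf charp).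
  by move=> /Fp_small_eq0; lia.
rewrite -[k.+1%:R]/((k.+1%:Z)%:~R) -[l.+1%:R]/((l.+1%:Z)%:~R) -intrD -(dvdz_pcharf charp).
by move=> /Fp_small_eq0; lia.
Qed.

Lemma Fp_natr_eq0 k : (k < h)%N -> (k.+1%:R : Fp) != 0.
Proof.
have pE := double_half_prime => kh; rewrite -(dvdn_pcharf charp) gtnNdvd //; lia.
Qed.

Lemma Euler_criterion (a : int) : (legendre a p)%:~R = (a%:~R : Fp) ^+ h.
Proof.
have pE := double_half_prime; have h0 : (0 < h)%N by lia.
rewrite /legendre; case: ifP => [|na].
  by rewrite (dvdz_pcharf charp) => /eqP ->; rewrite expr0n gtn_eqF.
have a0 : (a%:~R : Fp) != 0 by rewrite -(dvdz_pcharf charp) na.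
have e2 (x : Fp) : x != 0 -> (x ^+ 2) ^+ h = 1.
  by move=> x0; rewrite -exprM mul2n -[in RHS](Fp_expr_pred x0); congr (_ ^+ _); lia.
case: ifP => [/existsP[x]|nsq].
  rewrite eqz_mod_dvd -Fp_intr_eq rmorphXn /= => /eqP xa; rewrite -xa e2 //.
  by apply: contraNneq a0; rewrite -xa => ->; rewrite expr0n.
have aa : ((a%:~R : Fp) ^+ h) ^+ 2 == 1 by rewrite exprAC e2.
rewrite mulrN1z; apply/eqP; rewrite eq_sym; move: aa; rewrite sqrf_eq1 => /orP[/eqP a1|/eqP ->//].
(* If a nonsquare a had [a^h = 1], then a and the h nonzero squares would be [h + 1] roots of
   [X^h - 1]. *)
pose rs := (a%:~R : Fp) :: [seq (k.+1%:R : Fp) ^+ 2 | k <- iota 0 h].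
have /(max_unity_roots h0) : all h.-unity_root rs.
  apply/andP; split; first by rewrite unity_rootE a1.
  apply/allP => _ /mapP[k kh ->]; rewrite mem_iota /= add0n in kh.
  by rewrite unity_rootE e2 // Fp_natr_eq0.
move=> hsz; suff /hsz : uniq rs by rewrite /= size_map size_iota ltnn.
rewrite /rs /= map_inj_in_uniq ?iota_uniq ?andbT; last first.
  by move=> k l; rewrite !mem_iota !add0n => kh lh; exact: Fp_sqr_inj.
apply/negP => /mapP[k kh ak]; rewrite mem_iota add0n /= in kh.
have kp : (k.+1 < p)%N by lia.
move/negbT/negP: nsq; apply; apply/existsP; exists (Ordinal kp).
by rewrite eqz_mod_dvd -Fp_intr_eq rmorphXn /= ak.
Qed.

(** As p > 2, the values -1, 0 and 1 are separated modulo p; identities between symbols can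
    therefore be checked in ['F_p] by means of Euler's criterion. *)
Lemma sign_Fp_inj (u v : int) : (`|u| <= 1)%N -> (`|v| <= 1)%N -> (u%:~R : Fp) = v%:~R -> u = v.
Proof.
move=> u1 v1 /eqP; rewrite Fp_intr_eq => /Fp_small_eq0; lia.
Qed.

Lemma legendre_le1 (a : int) : (`|legendre a p| <= 1)%N.
Proof. by rewrite /legendre; case: ifP => // _; case: ifP. Qed.

Lemma legendre_eq0 (a : int) : (legendre a p == 0) = (p %| a)%Z.
Proof. by rewrite /legendre; case: ifP => // _; case: ifP. Qed.

Lemma legendreM (a b : int) : legendre (a * b) p = legendre a p * legendre b p.
Proof.
apply: sign_Fp_inj; first exact: legendre_le1.
  by rewrite abszM; have := legendre_le1 a; have := legendre_le1 b; nia.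
by rewrite intrM !Euler_criterion intrM exprMn.
Qed.

Lemma eq_legendre (a b : int) : (p %| a - b)%Z -> legendre a p = legendre b p.
Proof.
rewrite -Fp_intr_eq => /eqP ab; apply: sign_Fp_inj; try exact: legendre_le1.
by rewrite !Euler_criterion ab.
Qed.

Lemma legendreN1 : legendre (-1) p = (-1) ^+ h.
Proof.
apply: sign_Fp_inj; first exact: legendre_le1.
  by rewrite -signr_odd; case: odd.
by rewrite Euler_criterion rmorphXn /= mulrN1z.
Qed.

(* Gauss's lemma: [gauss_mu] counts the multiples of a whose residue is in the upper half. *)
Section Gauss.
Variable a : nat.
Hypothesis ap : coprime a p.

Let r (k : nat) := ((a * k.+1) %% p)%N.
(** The absolute value of the least residue of [a (k + 1)]. Multiplication by a thus permutes 1,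
    ..., h up to sign, through [sperm]. *)
Let s (k : nat) := if (r k <= h)%N then r k else (p - r k)%N.
Definition gauss_mu := (\sum_(k < h) (h < (a * k.+1) %% p)%N)%N.

Let r_lt k : (r k < p)%N. Proof. by rewrite ltn_mod. Qed.

Let r_Fp k : (r k)%:R = a%:R * k.+1%:R :> Fp.
Proof.
rewrite -natrM /r [in RHS](divn_eq (a * k.+1) p) natrD natrM.
by rewrite (pcharf0 charp) mulr0 add0r.
Qed.

Let a0 : (a%:R : Fp) != 0.
Proof. by rewrite -(dvdn_pcharf charp) -prime_coprime // coprime_sym. Qed.

Let r_gt0 (k : 'I_h) : (0 < r k)%N.
Proof.
rewrite lt0n; apply/negP => /eqP r0; have := r_Fp k; rewrite r0 => /esym/eqP.
by rewrite mulf_eq0 (negbTE a0) (negbTE (Fp_natr_eq0 (ltn_ord k))).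
Qed.

Let s_bound (k : 'I_h) : (0 < s k <= h)%N.
Proof.
have pE := double_half_prime; have := r_gt0 k; have := r_lt k.
by rewrite /s; case: ifP; lia.
Qed.

Let s_Fp k : a%:R * k.+1%:R = (-1) ^+ (h < r k)%N * (s k)%:R :> Fp.
Proof.
rewrite -r_Fp /s ltnNge; case: ifP => _ /=; first by rewrite mul1r.
rewrite natrB 1?ltnW // expr1 mulN1r opprB.
by rewrite (pcharf0 charp) subr0.
Qed.

Let sperm (k : 'I_h) : 'I_h.
Proof. by apply: (@Ordinal _ (s k).-1); have := s_bound k; lia. Defined.

Let spermE k : (sperm k).+1 = s k.
Proof. by rewrite /= prednK //; have := s_bound k; lia. Qed.

Let sperm_inj : injective sperm.
Proof.
move=> k l /(congr1 val) /= skl; have := s_bound k; have := s_bound l => sl sk.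
have {}skl : s k = s l by lia.
apply: val_inj; apply: Fp_sqr_inj; rewrite ?inE ?ltn_ord //.
have : (a%:R * k.+1%:R : Fp) ^+ 2 = (a%:R * l.+1%:R) ^+ 2.
  by rewrite !s_Fp skl !exprMn -!exprM !(mulnC _ 2) !exprM !sqrrN !expr1n.
by rewrite !exprMn => /mulfI; apply; rewrite expf_neq0.
Qed.

Lemma gauss_lemma : legendre a p = (-1) ^+ gauss_mu.
Proof.
apply: sign_Fp_inj; first exact: legendre_le1.
  by rewrite -signr_odd; case: odd.
rewrite Euler_criterion rmorphXn /= mulrN1z.
have f0 : \prod_(k < h) (k.+1%:R : Fp) != 0.
  by apply/prodf_neq0 => k _; exact: Fp_natr_eq0.
apply: (mulIf f0); rewrite -[a%:~R]/(a%:R).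
have -> : (a%:R : Fp) ^+ h * \prod_(k < h) k.+1%:R = \prod_(k < h) (a%:R * k.+1%:R).
  by rewrite big_split /= prodr_const card_ord.
under eq_bigr do rewrite s_Fp.
rewrite big_split /= -[in LHS](big_morph _ (exprD (-1)) (expr0 _)) -/gauss_mu; congr (_ * _).
by rewrite [RHS](reindex_inj sperm_inj); apply: eq_bigr => k _; rewrite spermE.
Qed.

(** In [a k = p q + r] with a and p odd, k has the parity of [q + r], and r that of [s] plus the
    indicator of [h < r]. In the sum over k the contributions of k and of [s] cancel, since [s] is a
    permutation. *)
Lemma eisenstein_lemma : odd a -> legendre a p = (-1) ^+ (\sum_(k < h) (a * k.+1) %/ p)%N.
Proof.
move=> a_odd; rewrite gauss_lemma -signr_odd -[in RHS]signr_odd; congr (_ ^+ _).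
have E k : odd k.+1 = odd ((a * k.+1) %/ p) (+) odd (r k).
  have := divn_eq (a * k.+1) p; rewrite -/(r k) => /(congr1 odd).
  by rewrite oddM oddD oddM a_odd p_odd andbT.
have E2 (k : 'I_h) : odd (r k) = odd (s k) (+) (h < r k)%N.
  rewrite /s ltnNge; case: ifP => _ /=; first by rewrite addbF.
  by rewrite oddB 1?ltnW // p_odd addTb addbT negbK.
have oddsum (F : 'I_h -> nat) : odd (\sum_(k < h) F k) = \big[addb/false]_(k < h) odd (F k).
  exact: (big_morph odd oddD).
rewrite /gauss_mu !oddsum.
have : \big[addb/false]_(k < h) odd k.+1 = \big[addb/false]_(k < h) odd (s k).
  by rewrite [LHS](reindex_inj sperm_inj); apply: eq_bigr => k _; rewrite spermE.
rewrite (eq_bigr (fun k : 'I_h => odd ((a * k.+1) %/ p) (+) (odd (s k) (+) (h < r k)%N))); last first.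
  by move=> k _; rewrite E E2.
rewrite !big_split /=; have -> : \big[addb/false]_(k < h) (h < r k)%N = \big[addb/false]_(k < h) odd (h < r k)%N.
  by apply: eq_bigr => k _; case: ltnP.
case: (\big[_/_]_(k < h) odd ((a * k.+1) %/ p)); case: (\big[_/_]_(k < h) odd (s k));
 case: (\big[_/_]_(k < h) odd (h < r k)%N) => //=.
Qed.

End Gauss.

Lemma legendre2 : legendre 2 p = (-1) ^+ (h - h./2).
Proof.
have pE := double_half_prime.
rewrite (@gauss_lemma 2) ?coprime2n //; congr (_ ^+ _).
rewrite /gauss_mu (eq_bigr (fun k : 'I_h => nat_of_bool (h./2 <= k)%N)); last first.
  move=> k _; rewrite modn_small; last by have := ltn_ord k; lia.
  by congr nat_of_bool; lia.
rewrite -(big_mkord xpredT (fun k => nat_of_bool (h./2 <= k)%N)).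
rewrite (big_cat_nat (n := h./2)) //=; last by lia.
rewrite [X in (X + _)%N]big_nat_cond [X in (X + _)%N]big1 ?add0n; last by move=> k; lia.
rewrite big_nat_cond (eq_bigr (fun=> 1%N)); last by move=> k; lia.
by rewrite -big_nat_cond sum_nat_const_nat muln1.
Qed.

End LegendreSymbol.

Section QuadraticReciprocity.

Lemma sum_leq_nat m t : (t <= m)%N -> (\sum_(j < m) (j.+1 <= t) = t)%N.
Proof.
move=> tm; rewrite -(big_mkord xpredT (fun j => nat_of_bool (j.+1 <= t)%N)).
rewrite (big_cat_nat (n := t)) //= [X in (_ + X)%N]big_nat_cond [X in (_ + X)%N]big1 ?addn0; last by move=> k; lia.
rewrite big_nat_cond (eq_bigr (fun=> 1%N)); last by move=> k; lia.
by rewrite -big_nat_cond sum_nat_const_nat muln1 subn0.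
Qed.

(** Eisenstein's rectangle: the two sums count the points on either side of the line [p y = q x],
    which meets no lattice point of the rectangle because p and q are coprime. *)
Lemma lattice_count p q : odd p -> odd q -> coprime p q ->
  (\sum_(k < p./2) (q * k.+1) %/ p + \sum_(k < q./2) (p * k.+1) %/ q = p./2 * q./2)%N.
Proof.
move=> po qo cpq; have pE := odd_double_half p; have qE := odd_double_half q.
rewrite po in pE; rewrite qo in qE.
have aux p' q' (k : 'I_p'./2) : odd p' -> odd q' ->
   ((q' * k.+1) %/ p' = \sum_(j < q'./2) (p' * j.+1 <= q' * k.+1))%N.
  move=> po' qo'; have pE' := odd_double_half p'; have qE' := odd_double_half q'.
  rewrite po' in pE'; rewrite qo' in qE'; have kp := ltn_ord k.
  rewrite -[LHS](@sum_leq_nat q'./2); last first.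
    by rewrite -ltnS ltn_divLR; nia.
  apply: eq_bigr => j _; congr nat_of_bool; by rewrite leq_divRL ?odd_gt0 // mulnC.
rewrite (eq_bigr (fun k : 'I_p./2 => (\sum_(j < q./2) (p * j.+1 <= q * k.+1))%N)); last by move=> k _; rewrite aux.
rewrite [X in (_ + X)%N](eq_bigr (fun k : 'I_q./2 => (\sum_(j < p./2) (q * j.+1 <= p * k.+1))%N)); last by move=> k _; rewrite aux.
rewrite [X in (_ + X)%N]exchange_big /= -big_split /=.
rewrite (eq_bigr (fun=> q./2)) ?sum_nat_const ?card_ord // => k _.
rewrite -big_split /= (eq_bigr (fun=> 1%N)) ?sum_nat_const ?card_ord ?muln1 // => j _.
have : (p * j.+1 != q * k.+1)%N.
  apply/eqP => e; have : (p %| q * k.+1)%N by rewrite -e dvdn_mulr.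
  rewrite Gauss_dvdr // => /dvdn_leq; have := ltn_ord k; lia.
by case: ltngtP.
Qed.

Lemma quadratic_reciprocity p q : prime p -> prime q -> odd p -> odd q -> p != q ->
  legendre p q * legendre q p = (-1) ^+ (p./2 * q./2)%N.
Proof.
move=> pp qp po qo pq.
have cpq : coprime p q by rewrite prime_coprime // dvdn_prime2.
rewrite (eisenstein_lemma qp qo cpq po) (eisenstein_lemma pp po _ qo) 1?coprime_sym //.
by rewrite -exprD addnC lattice_count.
Qed.

End QuadraticReciprocity.

Section JacobiSymbol.

Definition jacobi (a : int) (n : nat) : int :=
  \prod_(q <- prime_decomp n) legendre a q.1 ^+ q.2.

(** Over a common range of primes the products attached to different integers can be compared factor
    by factor. *)
Lemma jacobi_widen a n N : (0 < n < N)%N ->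
  jacobi a n = \prod_(0 <= p < N | prime p) legendre a p ^+ logn p n.
Proof.
move=> /andP[n0 nN]; rewrite /jacobi prime_decompE big_map /=.
have pF : perm_eq (primes n) [seq p <- index_iota 0 N | p \in primes n].
  apply: uniq_perm; rewrite ?primes_uniq ?filter_uniq ?iota_uniq //.
  move=> p; rewrite mem_filter mem_index_iota /=; case pn : (p \in primes n) => //=.
  move: pn; rewrite mem_primes => /and3P[_ _ /dvdn_leq]; move=> /(_ n0); lia.
rewrite (perm_big _ pF) big_filter [RHS](bigID (mem (primes n))) /=.
rewrite [X in _ = _ * X]big1 ?mulr1.
  by apply: eq_bigl => p; rewrite mem_primes; case: prime => //=; rewrite andbF.
move=> p /andP[pp pn]; have -> : logn p n = 0%N by rewrite lognE -mem_primes (negbTE pn).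
by rewrite expr0.
Qed.

Lemma jacobi1 a : jacobi a 1 = 1.
Proof. by rewrite /jacobi big_nil. Qed.

Lemma jacobi_mulr a m n : (0 < m)%N -> (0 < n)%N -> jacobi a (m * n) = jacobi a m * jacobi a n.
Proof.
move=> m0 n0; pose N := (m * n).+1.
rewrite !(@jacobi_widen _ _ N) /N ?muln_gt0 ?m0 ?n0 //=; try nia.
rewrite -big_split; apply: eq_bigr => p _ /=.
by rewrite lognM // exprD.
Qed.

Lemma jacobi_prime a p : prime p -> jacobi a p = legendre a p.
Proof. by move=> pp; rewrite /jacobi prime_decompE primes_prime // big_map big_seq1 /= logn_prime // eqxx expr1. Qed.

Lemma odd_prime_ind (P : nat -> Prop) : P 1%N ->
  (forall p n, prime p -> odd p -> odd n -> P n -> P (p * n)%N) -> forall n, odd n -> P n.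
Proof.
move=> P1 PM n; elim/ltn_ind: n => n IH no.
have [n1|n1] := leqP n 1; first by have -> : n = 1%N by lia.
have pp := pdiv_prime n1; have /dvdnP[m nm] := pdiv_dvd n.
have p1 := prime_gt1 pp; move: no; rewrite {1}nm oddM => /andP[mo po].
have m0 : (0 < m)%N by rewrite odd_gt0.
rewrite nm mulnC; apply: PM => //; apply: IH => //; rewrite [leqRHS]nm; nia.
Qed.

Lemma jacobi_mull a b n : odd n -> jacobi (a * b) n = jacobi a n * jacobi b n.
Proof.
move: n; apply: odd_prime_ind => [|p n pp po no IH]; first by rewrite !jacobi1.
have n0 := odd_gt0 no; have p0 := prime_gt0 pp.
by rewrite !jacobi_mulr // IH !(jacobi_prime _ pp) legendreM // mulrACA.
Qed.

Lemma eq_jacobi a b n : odd n -> (n %| a - b)%Z -> jacobi a n = jacobi b n.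
Proof.
move: n; apply: odd_prime_ind => [|p n pp po no IH]; first by rewrite !jacobi1.
have n0 := odd_gt0 no; have p0 := prime_gt0 pp => ab.
rewrite !jacobi_mulr // IH; last by apply: dvdz_trans ab; rewrite PoszM dvdz_mull.
rewrite !(jacobi_prime _ pp) (@eq_legendre p pp po a b) //.
by apply: dvdz_trans ab; rewrite PoszM dvdz_mulr.
Qed.

Lemma jacobi_sqr a n : odd n -> coprime `|a| n -> jacobi a n ^+ 2 = 1.
Proof.
move: n; apply: odd_prime_ind => [|p n pp po no IH]; first by rewrite !jacobi1.
have n0 := odd_gt0 no; have p0 := prime_gt0 pp; rewrite coprimeMr => /andP[ap an].
rewrite jacobi_mulr // exprMn IH // mulr1 jacobi_prime //.
have := legendre_eq0 p a; have := legendre_le1 p a.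
have -> : (p %| a)%Z = false.
  by apply/negbTE; rewrite dvdzE /= -prime_coprime // coprime_sym.
by case: (legendre a p) => [[|[|?]]|[|?]].
Qed.

Lemma jacobi_expl a k n : odd n -> jacobi (a ^+ k) n = jacobi a n ^+ k.
Proof.
move=> no; elim: k => [|k IH]; last by rewrite !exprS jacobi_mull // IH.
rewrite !expr0; move: n no; apply: odd_prime_ind => [|p n pp po no IH]; first by rewrite jacobi1.
have n0 := odd_gt0 no; have p0 := prime_gt0 pp.
rewrite jacobi_mulr // IH // mulr1 jacobi_prime //.
have := legendre_eq0 p 1; have := legendreM pp po 1 1; rewrite mulr1.
have -> : (p %| 1)%Z = false by apply/negbTE; rewrite dvdzE /= dvdn1; have := prime_gt1 pp; lia.
move=> h /eqP h0; apply: (mulfI (x := legendre 1 p)); first exact/eqP.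
by rewrite -h mulr1.
Qed.

Lemma jacobi_1l n : odd n -> jacobi 1 n = 1.
Proof. by move=> /(jacobi_expl 1 0); rewrite !expr0. Qed.

(** On odd naturals [chi4] and [chi8] are the characters (-1 / n) modulo 4 and (2 / n) modulo 8;
    [chi4z] below extends the former to negative odd integers by periodicity. *)
Definition chi4 (n : nat) : int := (-1) ^+ n./2.
Definition chi8 (n : nat) : int := if (n %% 8 == 1)%N || (n %% 8 == 7)%N then 1 else -1.

Lemma chi4M m n : odd m -> odd n -> chi4 (m * n) = chi4 m * chi4 n.
Proof.
move=> mo no; rewrite /chi4 -exprD -signr_odd -[RHS]signr_odd; congr (_ ^+ _).
congr nat_of_bool; have := odd_double_half m; have := odd_double_half n.
rewrite mo no; move: m./2 n./2 => a b <- <-.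
have -> : ((true + a.*2) * (true + b.*2) = (a * b).*2.*2 + (a + b).*2 + 1)%N by rewrite /=; lia.
lia.
Qed.

Lemma chi8M m n : odd m -> odd n -> chi8 (m * n) = chi8 m * chi8 n.
Proof.
move=> mo no; rewrite /chi8 -modnMm.
have h k : odd k -> [\/ k %% 8 = 1, k %% 8 = 3, k %% 8 = 5 | k %% 8 = 7]%N.
  move=> ko; have : (k %% 8 = 1 \/ k %% 8 = 3 \/ k %% 8 = 5 \/ k %% 8 = 7)%N by lia.
  by move=> [|[|[|]]] ->; [constructor 1|constructor 2|constructor 3|constructor 4].
by case: (h m mo) => ->; case: (h n no) => ->.
Qed.

Lemma jacobiN1 n : odd n -> jacobi (-1) n = chi4 n.
Proof.
move: n; apply: odd_prime_ind => [|p n pp po no IH]; first by rewrite jacobi1.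
rewrite jacobi_mulr ?odd_gt0 // IH chi4M // jacobi_prime // legendreN1 //.
Qed.

Lemma jacobi2 n : odd n -> jacobi 2 n = chi8 n.
Proof.
move: n; apply: odd_prime_ind => [|p n pp po no IH]; first by rewrite jacobi1.
rewrite jacobi_mulr ?odd_gt0 // IH chi8M // jacobi_prime // legendre2 //; congr (_ * _).
rewrite /chi8 -signr_odd; case: ifP => h8.
  by have -> : odd (p./2 - p./2./2) = false by lia.
by have -> : odd (p./2 - p./2./2) by lia.
Qed.

Lemma jacobi_reciprocity m n : odd m -> odd n -> coprime m n ->
  jacobi m n * jacobi n m = (-1) ^+ (m./2 * n./2)%N.
Proof.
have sign_eq a b : odd a = odd b -> (-1) ^+ a = (-1) ^+ b :> int.
  by move=> ab; rewrite -signr_odd ab signr_odd.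
have halfM a b : odd a -> odd b -> odd (a * b)./2 = odd a./2 (+) odd b./2.
  move=> ao bo; have := chi4M ao bo; rewrite /chi4 -exprD -[LHS]signr_odd -[RHS]signr_odd oddD.
  by case: odd; case: (odd _ (+) odd _).
move=> mo; move: n; apply: odd_prime_ind => [_|p n pp po no IH].
  by rewrite jacobi1 mul1r muln0 jacobi_1l.
rewrite coprimeMr => /andP[mp mn]; have n0 := odd_gt0 no; have p0 := prime_gt0 pp.
rewrite jacobi_mulr // PoszM jacobi_mull // mulrACA IH //.
(* A nested induction, on m this time, settles the case where one entry is prime. *)
have -> : jacobi m p * jacobi p m = (-1) ^+ (m./2 * p./2)%N.
  rewrite jacobi_prime //; clear IH mn; move: m mo mp; apply: odd_prime_ind => [_|q m qq qo mo IH].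
    by rewrite jacobi1 mulr1 mul0n -(jacobi_prime _ pp) jacobi_1l.
  rewrite coprimeMl => /andP[qp mp]; have m0 := odd_gt0 mo; have q0 := prime_gt0 qq.
  rewrite jacobi_mulr // PoszM legendreM // mulrACA IH // jacobi_prime //.
  rewrite mulrC quadratic_reciprocity //; last first.
    by apply: contraTneq qp => ->; rewrite prime_coprime // dvdnn.
  rewrite -exprD; apply: sign_eq; rewrite oddD !oddM halfM //.
  by case: (odd p./2); case: (odd q./2); case: (odd m./2).
rewrite -exprD; apply: sign_eq; rewrite oddD !oddM halfM //.
by case: (odd p./2); case: (odd n./2); case: (odd m./2).
Qed.

End JacobiSymbol.

(** * Periods and signs of the Kronecker symbol *)

Section KroneckerSymbol.
Implicit Types (a b c d m : int).

Definition chi4z m : int := if (m == 1 %[mod 4])%Z then 1 else -1.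

Lemma chi4zE m : odd `|m| -> chi4z m = (if m < 0 then -1 else 1) * chi4 `|m|.
Proof.
move=> mo; rewrite /chi4z /chi4 -signr_odd.
have -> : (m == 1 %[mod 4])%Z = ((m < 0) == odd `|m|./2) by lia.
by case: ltP => _; case: odd.
Qed.

Lemma kronecker_jacobi a m : odd `|m| ->
  kronecker a m = (if (m < 0) && (a < 0) then -1 else 1) * jacobi a `|m|.
Proof.
move=> mo; rewrite /kronecker; case: eqP => [m0|_]; first by rewrite m0 in mo.
congr (_ * _); rewrite /jacobi !big_seq; apply: eq_bigr => -[q e] /mem_prime_decomp[qp e0 qm] /=.
rewrite /kronecker_prime; case: eqP => // q2; subst q.
by move: qm => /(dvdn_trans (dvdn_exp e0 (dvdnn 2))); rewrite dvdn2 mo.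
Qed.

Lemma kronecker_pos a m : odd `|m| -> 0 < m -> kronecker a m = jacobi a `|m|.
Proof. by move=> mo m0; rewrite kronecker_jacobi // ltNge ltW // mul1r. Qed.

Lemma kronecker_sqr a m : odd `|m| -> coprimez a m -> kronecker a m ^+ 2 = 1.
Proof.
move=> mo am; rewrite kronecker_jacobi // exprMn jacobi_sqr //.
by case: ifP.
Qed.

Lemma kronecker_mulr a m m' : odd `|m| -> odd `|m'| ->
  kronecker a (m * m') = kronecker a m * kronecker a m'.
Proof.
move=> mo mo'; rewrite !kronecker_jacobi //; last by rewrite abszM oddM mo.
rewrite abszM jacobi_mulr ?odd_gt0 // mulrACA; congr (_ * _).
have m0 : m != 0 by apply: contraTneq mo => ->.
have m0' : m' != 0 by apply: contraTneq mo' => ->.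
have -> : (m * m' < 0) = (m < 0) (+) (m' < 0) by nia.
by case: (m < 0); case: (m' < 0); case: (a < 0).
Qed.

Lemma kronecker_mull a b m : odd `|m| -> 0 < m ->
  kronecker (a * b) m = kronecker a m * kronecker b m.
Proof. by move=> mo m0; rewrite !kronecker_pos // jacobi_mull. Qed.

Lemma kronecker_modl a b m : odd `|m| -> 0 < m -> (m %| a - b)%Z -> kronecker a m = kronecker b m.
Proof.
by move=> mo m0 h; rewrite !kronecker_pos //; apply: eq_jacobi => //; rewrite gtz0_abs.
Qed.

(** Reciprocity in a form where [m] occurs only in functions of known period, so that periods in the
    lower entry can be read off. The convention for negative m is absorbed in [chi4z]. *)
Lemma kronecker_formula (s : bool) (e t : nat) m : odd t -> odd `|m| -> coprime t `|m| ->
  kronecker ((-1) ^+ s * (2 ^ e * t)%N%:Z) m =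
  chi4z m ^+ (s + t./2) * chi8 `|m| ^+ e * jacobi m t.
Proof.
move=> to mo tm; have t0 := odd_gt0 to.
have a0 : (0 < 2 ^ e * t)%N by rewrite muln_gt0 expn_gt0.
rewrite kronecker_jacobi // chi4zE //.
have -> : (-1) ^+ s * (2 ^ e * t)%N%:Z < 0 = s.
  by case: s; rewrite ?expr1 ?expr0 ?mulN1r ?mul1r; lia.
rewrite jacobi_mull // jacobi_expl // jacobiN1 // PoszM jacobi_mull //.
have -> : (2 ^ e)%N%:Z = 2 ^+ e by rewrite -natz natrX.
rewrite jacobi_expl // jacobi2 //.
have js : jacobi `|m|%N%:Z t ^+ 2 = 1 by rewrite jacobi_sqr //= coprime_sym.
have -> : jacobi t `|m| = jacobi `|m|%N%:Z t * (chi4 `|m| ^+ t./2).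
  rewrite /chi4 -exprM mulnC -jacobi_reciprocity // mulrCA -expr2 js mulr1 //.
have -> : jacobi `|m|%N%:Z t = (if m < 0 then chi4 t else 1) * jacobi m t.
  case: ltP => m0; last by rewrite mul1r gez0_abs.
  by rewrite ltz0_abs // -mulN1r jacobi_mull // jacobiN1.
rewrite exprMn !exprD [chi4 t]/chi4.
case: (m < 0); case: s; rewrite /= ?expr1 ?expr0 ?expr1n; ring.
Qed.

Lemma odd_part_decomposition a : a != 0 -> exists s e t, odd t /\ a = (-1) ^+ (s : bool) * (2 ^ e * t)%N%:Z.
Proof.
move=> a0; have a0' : (0 < `|a|)%N by rewrite absz_gt0.
have [t t2 at2] := pfactor_coprime (p := 2) isT a0'.
exists (a < 0), (logn 2 `|a|), t; split; first by rewrite -coprime2n.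
rewrite mulnC -at2; case: ltP => h; first by rewrite expr1 mulN1r; lia.
by rewrite mul1r; lia.
Qed.

(** In [kronecker_formula] only the power of [chi8] could have a period that does not divide c. As
    [4 | c] means [e >= 2], either e is even and this factor is 1, or [e >= 3] and [8 | c]. *)
Lemma kronecker_period4 c d k : c != 0 -> (4 %| c)%Z -> odd `|d| -> coprimez c d ->
  kronecker c (d + c * k) = kronecker c d.
Proof.
move=> c0 c4 dodd cd; have [s [e [t [to cE]]]] := odd_part_decomposition c0.
have td : coprime t `|d|.
  by move: cd; rewrite cE coprimezE abszM abszX /= exp1n mul1n coprimeMl => /andP[].
have cd' : coprimez c (d + c * k).
  by move: cd; rewrite /coprimez addrC mulrC gcdzMDl.
have dodd' : odd `|d + c * k|.
  case/dvdzP: c4 => q cq; rewrite cq; lia.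
have td' : coprime t `|d + c * k|.
  by move: cd'; rewrite {1}cE coprimezE abszM abszX /= exp1n mul1n coprimeMl => /andP[].
have e2 : (2 <= e)%N.
  have : (4 %| 2 ^ e * t)%N.
    by move: c4; rewrite cE dvdzE abszM abszX /= exp1n mul1n.
  rewrite Gauss_dvdl; last by rewrite -[4%N]/(2 ^ 2)%N coprimeXl // coprime2n.
  by rewrite -[4%N]/(2 ^ 2)%N dvdn_Pexp2l.
have KF n : odd `|n| -> coprime t `|n| ->
    kronecker c n = chi4z n ^+ (s + t./2) * chi8 `|n| ^+ e * jacobi n t.
  by move=> no tn; rewrite {1}cE kronecker_formula.
rewrite !KF //.
congr (_ ^+ _ * _ * _).
- by rewrite /chi4z; case/dvdzP: c4 => q ->; congr (if _ then _ else _); lia.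
- have [eo|ee] := boolP (odd e); last first.
    have sq n : chi8 n ^+ e = 1.
      rewrite -[e]odd_double_half (negbTE ee) add0n -mul2n exprM.
      by rewrite /chi8; case: ifP => _; rewrite ?expr1n // sqrrN !expr1n.
    by rewrite !sq.
  have : (8 %| c)%Z.
    rewrite cE dvdz_mull //; have -> : (2 ^ e = 8 * 2 ^ (e - 3))%N by rewrite -[8%N]/(2 ^ 3)%N -expnD; congr expn; lia.
    by rewrite -mulnA PoszM dvdz_mulr.
  move=> /dvdzP[q cq]; congr (_ ^+ _); rewrite /chi8 cq; congr (if _ then _ else _); lia.
- apply: eq_jacobi => //; rewrite addrC addKr cE PoszM.
  by rewrite -mulrA dvdz_mull // -mulrA dvdz_mull // dvdz_mulr.
Qed.

(** For [a = 1] modulo 4 the exponent of [chi4z] in [kronecker_formula] is even and [chi8] is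
    absent, so only a Jacobi symbol modulo [|a|] is left. The step [2 a] keeps the lower entry
    odd. *)
Lemma kronecker_period1 a m k : (a == 1 %[mod 4])%Z -> odd `|m| -> coprimez a m ->
  kronecker a (m + 2 * a * k) = kronecker a m.
Proof.
move=> a1 mo am.
have a0 : a != 0 by apply: contraTneq a1 => ->.
pose s := a < 0; pose t := `|a|%N.
have aE : a = (-1) ^+ s * (2 ^ 0 * t)%N%:Z.
  by rewrite mul1n /s /t; case: ltP => h; rewrite ?expr1 ?mulN1r ?mul1r; lia.
have to : odd t by rewrite /t; lia.
have ev : exists j, (s + t./2 = j.*2)%N.
  exists (s + t./2)./2; rewrite -[LHS]odd_double_half -[RHS]add0n; congr (_ + _)%N.
  by rewrite /s /t; case: (ltP a 0); lia.
have [j ej] := ev.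
have mo' : odd `|m + 2 * a * k| by lia.
have am' : coprime t `|m + 2 * a * k|.
  have : coprimez a (m + 2 * a * k); last by [].
  by move: am; rewrite /coprimez addrC -mulrA mulrCA mulrC gcdzMDl.
have KF n : odd `|n| -> coprime t `|n| ->
    kronecker a n = chi4z n ^+ (s + t./2) * chi8 `|n| ^+ 0 * jacobi n t.
  by move=> no tn; rewrite {1}aE kronecker_formula.
rewrite !KF //.
rewrite ej -mul2n !exprM !expr0.
have sq n : chi4z n ^+ 2 = 1 by rewrite /chi4z; case: ifP.
rewrite !sq !expr1n !mul1r; apply: eq_jacobi => //.
by rewrite addrC addKr [X in 2 * X * _]aE mul1n -!mulrA dvdz_mull // dvdz_mull // dvdz_mulr.
Qed.

(** This serves the matrix -1 in the descent for theta series: the sign compensates the change of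
    the principal root and of [epsilon]. *)
Lemma kronecker_opp c d : c != 0 -> (4 %| c)%Z -> odd `|d| -> coprimez c d ->
  kronecker (- c) (- d) = (if 0 < c then -1 else 1) * chi4z d * kronecker c d.
Proof.
move=> c0 c4 dodd cd; have [s [e [t [to cE]]]] := odd_part_decomposition c0.
have td : coprime t `|d|.
  by move: cd; rewrite cE coprimezE abszM abszX /= exp1n mul1n coprimeMl => /andP[].
have NcE : - c = (-1) ^+ (~~ s) * (2 ^ e * t)%N%:Z.
  by rewrite cE; case: s {cE} => /=; rewrite ?expr1 ?expr0; ring.
have sc : (0 < c) = ~~ s.
  have t0 := odd_gt0 to; have p0 : (0 < 2 ^ e * t)%N by rewrite muln_gt0 expn_gt0.
  by rewrite cE; case: (s); rewrite ?expr1 ?expr0 ?mulN1r ?mul1r; lia.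
rewrite NcE [in kronecker c d]cE !kronecker_formula ?abszN // sc.
have -> : jacobi (- d) t = chi4 t * jacobi d t by rewrite -mulN1r jacobi_mull // jacobiN1.
have -> : chi4z (- d) = - chi4z d.
  rewrite /chi4z; have -> : (- d == 1 %[mod 4])%Z = ~~ (d == 1 %[mod 4])%Z by lia.
  by case: (d == 1 %[mod 4])%Z.
have sq : chi4z d ^+ 2 = 1 by rewrite /chi4z; case: ifP.
have sgt : chi4 t ^+ 2 = 1 by rewrite /chi4 -exprM mulnC exprM sqrrN !expr1n.
rewrite -[- chi4z d]mulN1r exprMn !exprD -/(chi4 t).
have -> : (-1) ^+ (~~ s) * chi4 t * (chi4z d ^+ (~~ s) * chi4z d ^+ t./2) * chi8 `|d| ^+ e * (chi4 t * jacobi d t)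
  = (-1) ^+ (~~ s) * chi4 t ^+ 2 * (chi4z d ^+ (~~ s) * chi4z d ^+ t./2) * chi8 `|d| ^+ e * jacobi d t by ring.
rewrite sgt mulr1; case: (s) => /=; rewrite ?expr1 ?expr0 ?mul1r; last by ring.
have -> : chi4z d * (chi4z d * chi4z d ^+ t./2 * chi8 `|d| ^+ e * jacobi d t) =
  chi4z d ^+ 2 * (chi4z d ^+ t./2 * chi8 `|d| ^+ e * jacobi d t) by ring.
by rewrite sq mul1r.
Qed.

Lemma squarefree_part_decomposition c : c != 0 ->
  exists2 s : nat, (0 < s)%N & c = squarefree_part c * (s ^ 2)%N%:Z.
Proof.
move=> c0; exists (\prod_(p <- primes `|c|) p ^ (logn p `|c|)./2)%N.
  by rewrite big_seq prodn_cond_gt0 // => p; rewrite mem_primes => /andP[/prime_gt0 p0 _]; rewrite expn_gt0 p0.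
rewrite /squarefree_part -mulrA -(big_morph Posz PoszM (erefl 1)) -PoszM.
have -> : (\prod_(p <- primes `|c|) p ^ odd (logn p `|c|) *
    (\prod_(p <- primes `|c|) p ^ (logn p `|c|)./2) ^ 2 = `|c|)%N.
  rewrite [RHS]prod_prime_decomp ?absz_gt0 // prime_decompE big_map /=.
  rewrite (big_morph (fun x => x ^ 2)%N (fun x y => expnMn x y 2) (exp1n 2)) -big_split /=.
  by apply: eq_bigr => p _; rewrite -expnM -expnD muln2 odd_double_half.
exact: intEsg.
Qed.

(** Reconciles the automorphy factor, stated with the discriminant of c, with the symbol (c / d)
    that the descent produces: the square factors [s^2] and 4 are prime to d, so their symbol is
    1. *)
Lemma quad_charE c d : c != 0 -> odd `|d| -> coprimez c d -> quad_char c d = kronecker c d.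
Proof.
move=> c0 dodd cd; have [s s0 cE] := squarefree_part_decomposition c0.
have sd : coprime s `|d|.
  move: cd; rewrite cE coprimezE abszM coprimeMl /= => /andP[_].
  by rewrite coprime_pexpl.
have d2 : coprime 2 `|d| by rewrite coprime2n.
rewrite /quad_char /quad_disc; set f := squarefree_part c in cE *.
have sgn : (c < 0) = (f < 0).
  have : 0 < (s ^ 2)%N%:Z by rewrite ltz_nat expn_gt0 s0.
  by rewrite cE => h; rewrite pmulr_llt0.
have -> : kronecker c d = kronecker f d.
  rewrite !kronecker_jacobi // sgn; congr (_ * _); rewrite cE jacobi_mull //.
  have -> : (s ^ 2)%N%:Z = s%:Z ^+ 2 by rewrite -!natz natrX.
  by rewrite jacobi_expl // jacobi_sqr ?mulr1.
case: ifP => // _; rewrite !kronecker_jacobi // pmulr_rlt0 //; congr (_ * _).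
by rewrite jacobi_mull // (_ : 4 = 2 ^+ 2) // jacobi_expl // jacobi_sqr ?mul1r.
Qed.

Lemma quad_char0 d : `|d|%N = 1%N -> quad_char 0 d = 1.
Proof.
move=> d1; rewrite /quad_char /quad_disc /squarefree_part sgz0 mul0r /= mulr0.
by rewrite kronecker_jacobi ?d1 // ltxx andbF jacobi1.
Qed.

End KroneckerSymbol.

(** * Theta series with characteristics *)

Section SquareRoots.
Variable R : realType.
Local Notation C := R[i].
Implicit Types (z w s X Y : C).
Local Notation Re := complex.Re.
Local Notation Im := complex.Im.

Lemma ReM z w : Re (z * w) = Re z * Re w - Im z * Im w.
Proof. by case: z w => [a b] [c d]. Qed.
Lemma ImM z w : Im (z * w) = Re z * Im w + Im z * Re w.
Proof. by case: z w => [a b] [c d]. Qed.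
Lemma ReD z w : Re (z + w) = Re z + Re w.
Proof. by case: z w => [a b] [c d]. Qed.
Lemma ImD z w : Im (z + w) = Im z + Im w.
Proof. by case: z w => [a b] [c d]. Qed.
Lemma ReN z : Re (- z) = - Re z. Proof. by case: z. Qed.
Lemma ImN z : Im (- z) = - Im z. Proof. by case: z. Qed.
Lemma Re_int (n : int) : Re (n%:~R : C) = n%:~R.
Proof. by rewrite -(rmorph_int (real_complex R)). Qed.
Lemma Im_int (n : int) : Im (n%:~R : C) = 0.
Proof. by rewrite -(rmorph_int (real_complex R)). Qed.
Lemma Re_ci : Re (ci : C) = 0. Proof. by []. Qed.
Lemma Im_ci : Im (ci : C) = 1. Proof. by []. Qed.
Lemma Re_real (x : R) : Re x%:C = x. Proof. by []. Qed.
Lemma Im_real (x : R) : Im x%:C = 0. Proof. by []. Qed.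

Lemma RCD (x y : R) : (x + y)%:C = x%:C + y%:C. Proof. exact: rmorphD. Qed.
Lemma RCM (x y : R) : (x * y)%:C = x%:C * y%:C. Proof. exact: rmorphM. Qed.
Lemma RCN (x : R) : (- x)%:C = - x%:C. Proof. exact: rmorphN. Qed.
Lemma RCV (x : R) : (x^-1)%:C = (x%:C)^-1. Proof. exact: fmorphV. Qed.
Lemma RCX (x : R) n : (x ^+ n)%:C = x%:C ^+ n. Proof. exact: rmorphXn. Qed.
Lemma RC_int (n : int) : (n%:~R : R)%:C = n%:~R. Proof. exact: rmorph_int. Qed.
Lemma RC_nat (n : nat) : (n%:R : R)%:C = n%:R. Proof. exact: rmorph_nat. Qed.
Definition RCE := (RCD, RCM, RCN, RCV, RCX, RC_int, RC_nat).
Definition intE := (intrD, intrM, mulrNz, mulr1z).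

Lemma ReV z : Re z^-1 = Re z / cabs z ^+ 2.
Proof. by case: z => a b; rewrite cabs_sqr. Qed.
Lemma ImV z : Im z^-1 = - Im z / cabs z ^+ 2.
Proof. by case: z => a b; rewrite cabs_sqr /= mulNr. Qed.

Lemma Re_sqrtc_ge0 z : 0 <= Re (sqrtc z).
Proof. by case: z => a b; exact: sqrtr_ge0. Qed.

(** Reduces identities between principal roots to an identity of squares and the sign of a real
    part. *)
Lemma sqrtc_uniq s z : s ^+ 2 = z -> 0 < Re s -> sqrtc z = s.
Proof.
move=> sz s0; have := sqr_sqrtc z; rewrite -{2}sz => /eqP.
rewrite eqf_sqr => /orP[/eqP //|/eqP h].
by have := Re_sqrtc_ge0 z; rewrite h ReN oppr_ge0 leNgt s0.
Qed.

Lemma Re_sqrtc_gt0 z : (Im z != 0) || (0 < Re z) -> 0 < Re (sqrtc z).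
Proof.
move=> h; rewrite lt_neqAle Re_sqrtc_ge0 andbT eq_sym; apply/negP => /eqP s0.
move: h; rewrite -{1 2}(sqr_sqrtc z) expr2 ReM ImM s0 !mul0r mulr0 addr0 eqxx /= sub0r oppr_gt0.
by rewrite ltNge -expr2 sqr_ge0.
Qed.

Lemma Im_sqrtc_sg z : Im z != 0 -> 0 < Im z * Im (sqrtc z).
Proof.
move=> z0; have s0 : 0 < Re (sqrtc z) by apply: Re_sqrtc_gt0; rewrite z0.
have e : Im z = 2 * (Re (sqrtc z) * Im (sqrtc z)).
  by rewrite -{1}(sqr_sqrtc z) expr2 ImM; ring.
have i0 : Im (sqrtc z) != 0 by apply: contraNneq z0 => i0; rewrite e i0 !mulr0.
have i2 : 0 < Im (sqrtc z) ^+ 2 by rewrite exprn_even_gt0.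
by rewrite e; have := mulr_gt0 s0 i2; rewrite expr2; lra.
Qed.

Lemma sqrtcZ (d : R) z : 0 < d -> sqrtc (d%:C * z) = (Num.sqrt d)%:C * sqrtc z.
Proof.
move=> d0; have [z0|nz] := boolP ((Im z != 0) || (0 < Re z)).
  apply: sqrtc_uniq.
    by rewrite exprMn sqr_sqrtc -rmorphXn /= sqr_sqrtr // ltW.
  by rewrite ReM Im_real mul0r subr0 mulr_gt0 ?sqrtr_gt0 // Re_sqrtc_gt0.
(* On the closed negative real axis the root has real part 0, so [sqrtc_uniq] cannot decide and the
   definition is unfolded. *)
move: nz; rewrite negb_or negbK -leNgt; case: z => a b /= /andP[/eqP -> a0].
rewrite /sqrtc /= !mul0r !mulr0 !addr0 subr0 eqxx !mul1r expr0n /= !addr0.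
rewrite !sqrtr_sqr normrM (gtr0_norm d0) (ler0_norm a0) addNr mulrN addNr mul0r sqrtr0.
apply/eqP; rewrite eq_complex /=; apply/andP; split; apply/eqP; first by ring.
rewrite -opprD -mulrDr -mulrN -mulrA sqrtrM ?ltW // -opprD; ring.
Qed.

Lemma sector_sqrtc z : 0 < Re z -> sector (sqrtc z).
Proof.
move=> z0; have s0 : 0 < Re (sqrtc z) by apply: Re_sqrtc_gt0; rewrite z0 orbT.
have : 0 < Re (sqrtc z ^+ 2) by rewrite sqr_sqrtc.
rewrite /sector /= expr2 ReM -!expr2 subr_gt0 -(real_normK (num_real (Im _))).
by rewrite ltr_pXn2r ?nnegrE ?(ltW s0).
Qed.

Lemma sectorV w : sector w -> sector w^-1.
Proof.
move=> sw; have w0 : 0 < cabs w by rewrite cabs_gt0 sector_neq0.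
rewrite /sector /= ReV ImV normrM normrN [X in _ * X]ger0_norm ?invr_ge0 ?sqr_ge0 //.
by rewrite ltr_pM2r ?invr_gt0 ?exprn_gt0.
Qed.

Lemma Re_sector_div w w' : sector w -> sector w' -> 0 < Re (w / w').
Proof.
move=> sw /sectorV; move: w'^-1 => u su.
rewrite ReM subr_gt0; apply: (le_lt_trans (ler_norm _)); rewrite normrM.
by apply: ltr_pM => //; exact: normr_ge0.
Qed.

Lemma sqrtc_opp X : Im X != 0 -> sqrtc (- X) = (if 0 < Im X then - ci else ci) * sqrtc X.
Proof.
move=> X0; have s0 : 0 < Re (sqrtc X) by apply: Re_sqrtc_gt0; rewrite X0.
have := Im_sqrtc_sg X0; case: (ltP 0 (Im X)) => h hs; apply: sqrtc_uniq.
- by rewrite exprMn sqr_sqrtc sqrrN expr2 ciM mulN1r.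
- by rewrite mulNr ReN ReM Re_ci Im_ci mul0r mul1r sub0r opprK -(pmulr_rgt0 _ h).
- by rewrite exprMn sqr_sqrtc expr2 ciM mulN1r.
- by rewrite ReM Re_ci Im_ci mul0r mul1r sub0r oppr_gt0; nra.
Qed.

(* Seen from 0 the line 1 + R w spans an angle < pi, so no branch is crossed. *)
Lemma sqrtc_line w (e f : R) : 0 < Im w ->
  sqrtc ((1 + f%:C * w) / (1 + e%:C * w)) * sqrtc (1 + e%:C * w) = sqrtc (1 + f%:C * w).
Proof.
move=> w0; set Y := 1 + e%:C * w; set Z := 1 + f%:C * w.
have ImL (t : R) : Im (1 + t%:C * w) = t * Im w.
  by rewrite ImD ImM /= mul0r addr0 add0r.
have ReL (t : R) : Re (1 + t%:C * w) = 1 + t * Re w.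
  by rewrite ReD ReM /= mul0r subr0.
have nz (t : R) : (Im (1 + t%:C * w) != 0) || (0 < Re (1 + t%:C * w)).
  rewrite ImL ReL; have [->|t0] := eqVneq t 0; first by rewrite !mul0r addr0 ltr01 orbT.
  by rewrite mulf_neq0 // gt_eqF.
have y0 : 0 < Re (sqrtc Y) := Re_sqrtc_gt0 (nz e).
have z0 : 0 < Re (sqrtc Z) := Re_sqrtc_gt0 (nz f).
have Yn : sqrtc Y != 0 by apply: contraTneq y0 => ->; rewrite ltxx.
have sg (t : R) : 0 <= t * Im (sqrtc (1 + t%:C * w)).
  have [->|t0] := eqVneq t 0; first by rewrite mul0r.
  have : Im (1 + t%:C * w) != 0 by rewrite ImL mulf_neq0 // gt_eqF.
  move=> /Im_sqrtc_sg; rewrite ImL -mulrA [Im w * _]mulrC mulrA pmulr_lgt0 //; exact: ltW.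
suff -> : sqrtc (Z / Y) = sqrtc Z / sqrtc Y by rewrite divfK.
apply: sqrtc_uniq; first by rewrite expr_div_n !sqr_sqrtc.
rewrite ReM ReV ImV mulNr mulrN opprK !mulrA -mulrDl.
rewrite divr_gt0 ?exprn_gt0 ?cabs_gt0 //.
set y1 := Re (sqrtc Y); set y2 := Im (sqrtc Y); set z1 := Re (sqrtc Z); set z2 := Im (sqrtc Z).
have hs := sg e; have hf := sg f; rewrite -/Y -/y2 in hs; rewrite -/Z -/z2 in hf.
have [h|h] := leP 0 (z2 * y2); first by rewrite ltr_wpDr // mulr_gt0.
have Y1 : y1 ^+ 2 - y2 ^+ 2 = 1 + e * Re w by rewrite -ReL -/Y -(sqr_sqrtc Y) [in RHS]expr2 ReM -!expr2.
have Y2 : 2 * (y1 * y2) = e * Im w by rewrite -ImL -/Y -(sqr_sqrtc Y) [in RHS]expr2 ImM; rewrite -/y1 -/y2; ring.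
have Z1 : z1 ^+ 2 - z2 ^+ 2 = 1 + f * Re w by rewrite -ReL -/Z -(sqr_sqrtc Z) [in RHS]expr2 ReM -!expr2.
have Z2 : 2 * (z1 * z2) = f * Im w by rewrite -ImL -/Z -(sqr_sqrtc Z) [in RHS]expr2 ImM; rewrite -/z1 -/z2; ring.
(* Writing [p + i q] for [sqrtc Z] times the conjugate of [sqrtc Y], this is [2 p q = (f - e) Im w],
   the imaginary part of its square. When [z2 * y2 < 0], f is 0 or of sign opposite to e, so q and
   [f - e] have the same sign and p > 0. *)
have key : 2 * ((z1 * y1 + z2 * y2) * (z2 * y1 - z1 * y2)) = (f - e) * Im w.
  have -> : 2 * ((z1 * y1 + z2 * y2) * (z2 * y1 - z1 * y2)) =
    (2 * (z1 * z2)) * (y1 ^+ 2 - y2 ^+ 2) - (z1 ^+ 2 - z2 ^+ 2) * (2 * (y1 * y2)) by ring.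
  by rewrite Y1 Y2 Z1 Z2; ring.
have y1p : 0 < y1 by []; have z1p : 0 < z1 by [].
have y20 : y2 != 0 by apply: contraTneq h => ->; rewrite mulr0 ltxx.
have e0 : e != 0.
  apply: contraTneq y20 => e0; move: Y2; rewrite e0 mul0r => /eqP.
  by rewrite mulf_eq0 pnatr_eq0 /= mulf_eq0 gt_eqF //= => /eqP ->; rewrite negbK.
have [en|ep|ee] := ltgtP e 0; last by rewrite ee eqxx in e0.
  have y2n : y2 < 0 by rewrite lt_neqAle y20 -(nmulr_rge0 _ en).
  have z2p : 0 < z2 by rewrite -(nmulr_llt0 z2 y2n).
  have f0 : 0 <= f by rewrite -(pmulr_lge0 _ z2p).
  have A0 : 0 < z2 * y1 - z1 * y2 by rewrite subr_gt0 (lt_trans (y := 0)) ?mulr_gt0 // nmulr_llt0.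
  have : 0 < (f - e) * Im w by rewrite mulr_gt0 // subr_gt0 (lt_le_trans en).
  by rewrite -key pmulr_rgt0 // pmulr_lgt0.
have y2p : 0 < y2 by rewrite lt_neqAle eq_sym y20 -(pmulr_rge0 _ ep).
have z2n : z2 < 0 by rewrite -(pmulr_llt0 z2 y2p).
have f0 : f <= 0 by rewrite -(nmulr_lge0 _ z2n).
have A0 : z2 * y1 - z1 * y2 < 0 by rewrite subr_lt0 (lt_trans (y := 0)) ?mulr_gt0 // nmulr_rlt0 // mulrC nmulr_rlt0.
have : (f - e) * Im w < 0 by rewrite pmulr_llt0 // subr_lt0 (le_lt_trans f0).
by rewrite -key pmulr_rlt0 // nmulr_llt0.
Qed.

(** The cocycle relation for the factor (1 0; e 1). It holds without sign because division by d > 0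
    brings all points to the line [1 + R w]; hence the recurring hypothesis on d. *)
Lemma sqrtc_unipotent w (c d e : R) : 0 < Im w -> 0 < d ->
  sqrtc (c%:C * (w / (e%:C * w + 1)) + d%:C) * sqrtc (e%:C * w + 1) = sqrtc ((c + e * d)%:C * w + d%:C).
Proof.
move=> w0 d0; have Y0 : 1 + e%:C * w != 0.
  rewrite eq_complex ReD ImD ReM ImM /= !mul0r addr0 subr0 add0r negb_and.
  have [->|e0] := eqVneq e 0; first by rewrite !mul0r addr0 oner_eq0.
  by rewrite orbC mulf_neq0 // gt_eqF.
have dC : d%:C != 0 :> C by rewrite eq_complex /= eqxx andbT gt_eqF.
have := sqrtc_line e (c / d + e) w0.
have E : (c / d + e)%:C = c%:C / d%:C + e%:C :> C by rewrite rmorphD rmorphM fmorphV.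
move=> h; rewrite [e%:C * w + 1]addrC.
have -> : c%:C * (w / (1 + e%:C * w)) + d%:C = d%:C * ((1 + (c / d + e)%:C * w) / (1 + e%:C * w)).
  by rewrite E; field; rewrite Y0 dC.
have -> : (c + e * d)%:C * w + d%:C = d%:C * (1 + (c / d + e)%:C * w).
  by rewrite E rmorphD rmorphM /=; field.
by rewrite !sqrtcZ // -mulrA h.
Qed.

End SquareRoots.

(** * Theta series in one variable *)

Section ThetaCharacteristics.
Variable R : realType.
Local Opaque cexp.
Local Notation C := R[i].
Local Notation Re := complex.Re.
Local Notation Im := complex.Im.
Implicit Types (w : C) (al be : R).

(** A character is a shift of the base point: completing the square hides the phase
    [exp (2 pi i (n + u) v)] in [v'], at the cost of the factor [K]. *)
Lemma poisson_char w (u v : C) : sector w ->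
  w * tsum (fun n : int => cexp (- (pi%:C * (w * (n%:~R + u)) ^+ 2) + tpi * (n%:~R + u) * v)) =
  tsum (fun k : int => cexp (- (pi%:C * ((k%:~R - v) / w) ^+ 2) + tpi * k%:~R * u)).
Proof.
move=> sw; have w0 := sector_neq0 sw.
pose v' := w * u - ci * v / w; pose K := cexp (- (pi%:C * (v / w) ^+ 2)).
have h := poisson_gauss v' sw.
have hb1 : has_sum (fun n : int => gauss (v' + w * n%:~R)) (tsum (fun n : int => gauss (v' + w * n%:~R))).
  have [M /(_ 1%N isT)] := gterm_bounded v' sw.
  rewrite (_ : gterm 1 v' w = fun n : int => gauss (v' + w * n%:~R)); first exact: has_sum_tsum.
  by apply/funext => n; rewrite /gterm /rpt divr1 rmorph_int.
have [M /has_sum_tsum hb2] := dual_term_bounded v' sw.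
have -> : tsum (fun n : int => cexp (- (pi%:C * (w * (n%:~R + u)) ^+ 2) + tpi * (n%:~R + u) * v)) =
   K * tsum (fun n : int => gauss (v' + w * n%:~R)).
  apply: tsumE; apply: has_sum_ext (has_sumZ K hb1) => n; rewrite /K /gauss -cexpD; congr cexp.
  have i2 := ciM R; rewrite /v' /tpi; set I := (ci : C) in i2 *.
  have -> : (w * u - I * v / w + w * n%:~R) ^+ 2 = (w * (n%:~R + u)) ^+ 2 - 2 * (n%:~R + u) * (I * v) + (I * I) * (v / w) ^+ 2.
    by field.
  by rewrite i2; ring.
rewrite mulrCA h; apply/esym; apply: tsumE; apply: has_sum_ext (has_sumZ K hb2) => k.
rewrite /K /dual_term -cexpD; congr cexp.
have i2 := ciM R; rewrite /v' /tpi; set I := (ci : C) in i2 *.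
have -> : 2 * pi%:C * I * k%:~R * (w * u - I * v / w) / w = 2 * pi%:C * I * k%:~R * u - 2 * pi%:C * (I * I) * k%:~R * v / w ^+ 2.
  by field.
by rewrite i2; field.
Qed.

Definition theta_term al be w (n : int) : C :=
  cexp (tpi * (n%:~R + al%:C) ^+ 2 * w + tpi * (n%:~R + al%:C) * be%:C).

(** The factor [exp (- pi i al be)] makes the group act linearly on the characteristics:
    translation, inversion and [w -> w / (4 k w + 1)] introduce no further root of unity. *)
Definition theta1 al be w : C :=
  cexp (- (pi%:C * ci * al%:C * be%:C)) * tsum (theta_term al be w).

Lemma eq_theta1 al be al' be' w : al = al' -> be = be' -> theta1 al be w = theta1 al' be' w.
Proof. by move=> -> ->. Qed.

Lemma sector_sqrt_upper w : 0 < Im w -> sector (sqrtc (- (2 * ci * w))).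
Proof.
move=> w0; apply: sector_sqrtc; case: w w0 => a b /= b0.
by rewrite /=; lra.
Qed.

Lemma theta_term_bounded al be w : 0 < Im w -> exists M, sum_bounded (theta_term al be w) M.
Proof.
move=> w0; have sw := sector_sqrt_upper w0; set s := sqrtc _ in sw.
have s0 := sector_neq0 sw; have s2 : s ^+ 2 = - (2 * ci * w) by rewrite sqr_sqrtc.
have i2 := ciM R.
pose v' := s * al%:C - ci * be%:C / s.
have [M /(_ 1%N isT) hM] := gterm_bounded v' sw.
exists (cabs (cexp (- (pi%:C * (be%:C / s) ^+ 2))) * (M * 1%:R)).
have := sum_boundedZ (cexp (- (pi%:C * (be%:C / s) ^+ 2))) hM; congr sum_bounded.
apply/funext => n; rewrite /gterm /rpt divr1 rmorph_int /gauss /theta_term -cexpD; congr cexp.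
rewrite /v' /tpi; set I := (ci : C) in i2 s2 *.
have -> : (s * al%:C - I * be%:C / s + s * n%:~R) ^+ 2 =
   s ^+ 2 * (n%:~R + al%:C) ^+ 2 - 2 * (n%:~R + al%:C) * (I * be%:C) + (I * I) * (be%:C / s) ^+ 2 by field.
by rewrite i2 s2; ring.
Qed.

Lemma has_sum_theta al be w : 0 < Im w -> has_sum (theta_term al be w) (tsum (theta_term al be w)).
Proof. by move=> /(theta_term_bounded al be)[M /has_sum_tsum]. Qed.

Lemma ciV : ci^-1 = - ci :> C.
Proof.
have cn : ci != 0 :> C by rewrite -cabs_eq0 cabs_ci oner_eq0.
by apply: (mulfI cn); rewrite divff // mulrN ciM opprK.
Qed.

Lemma cexpD_int z (k : int) : cexp (z + tpi * k%:~R) = cexp z :> C.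
Proof. by rewrite cexpD cexp_tpi_int mulr1. Qed.

Lemma tsum_bij (I J : eqType) (e : J -> I) (f : I -> J) (a : I -> C) :
  cancel e f -> cancel f e -> tsum (a \o e) = tsum a.
Proof.
move=> ef fe; rewrite /tsum; congr xget; apply/seteqP; split => s /= h.
  have := has_sum_bij fe ef h; apply: has_sum_ext => i /=; by rewrite fe.
exact: has_sum_bij ef fe h.
Qed.

Lemma theta1_translate al be w (t : int) : 0 < Im w ->
  theta1 al be (w + t%:~R) = theta1 al (be + 2 * t%:~R * al) w.
Proof.
move=> w0.
have E : theta_term al be (w + t%:~R) = fun n => cexp (- (tpi * t%:~R * al%:C ^+ 2)) * theta_term al (be + 2 * t%:~R * al) w n.
  apply/funext => n; rewrite /theta_term -cexpD -[RHS](cexpD_int _ (t * n ^+ 2)); congr cexp.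
  by rewrite !RCE !intE; ring.
rewrite /theta1 E (tsumE (has_sumZ _ (has_sum_theta _ _ w0))) mulrA -cexpD; congr (cexp _ * _).
by rewrite !RCE /tpi; ring.
Qed.

Lemma theta1_opp al be w : theta1 (- al) (- be) w = theta1 al be w.
Proof.
rewrite /theta1 !rmorphN !mulrN mulNr opprK; congr (_ * _).
rewrite -(@tsum_bij _ _ -%R -%R) //; [|exact: opprK..].
by congr tsum; apply/funext => n; congr cexp; rewrite rmorphN !rmorphN /=; ring.
Qed.

Lemma theta1_addl al be w : theta1 (al + 1) be w = cexp (- (pi%:C * ci * be%:C)) * theta1 al be w.
Proof.
rewrite /theta1 mulrA -cexpD; congr (cexp _ * _); first by rewrite RCD; ring.
rewrite -[RHS](@tsum_bij _ _ (fun n : int => n + 1) (fun n => n - 1)); [|exact: addrK|exact: subrK].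
by congr tsum; apply/funext => n; congr cexp; rewrite /= RCD !intE; ring.
Qed.

Lemma theta1_addr al be w (t : int) : 0 < Im w ->
  theta1 al (be + t%:~R) w = cexp (pi%:C * ci * t%:~R * al%:C) * theta1 al be w.
Proof.
move=> w0.
have E : theta_term al (be + t%:~R) w = fun n => cexp (tpi * t%:~R * al%:C) * theta_term al be w n.
  apply/funext => n; rewrite /theta_term -cexpD -[RHS](cexpD_int _ (n * t)); congr cexp.
  by rewrite !RCE !intE; ring.
rewrite /theta1 E (tsumE (has_sumZ _ (has_sum_theta _ _ w0))) [LHS]mulrA [RHS]mulrA -!cexpD; congr (cexp _ * _).
by rewrite !RCE /tpi; ring.
Qed.

Lemma upper_inv w : 0 < Im w -> 0 < Im (- (4 * w)^-1).
Proof.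
move=> w0; rewrite ImN ImV mulNr opprK divr_gt0 //.
  by rewrite ImM -[4]/(4%:~R) Re_int Im_int mul0r addr0 mulr_gt0.
by rewrite exprn_gt0 // cabs_gt0 mulf_neq0 //; apply: contraTneq w0 => ->; rewrite ltxx.
Qed.

(** Poisson summation at [s^-1], where [s^2 = - 2 i w]. As [Re (- 2 i w) = 2 Im w > 0], the
    principal root s and its inverse lie in the sector. *)
Lemma theta1_inversion al be w : 0 < Im w ->
  theta1 al be (- (4 * w)^-1) = sqrtc (- (2 * ci * w)) * theta1 (- be) al w.
Proof.
move=> w0; have sw := sector_sqrt_upper w0; set s := sqrtc _ in sw *.
have s0 := sector_neq0 sw; have s2 : s ^+ 2 = - (2 * ci * w) by rewrite sqr_sqrtc.
have wn : w != 0 by apply: contraTneq w0 => ->; rewrite ltxx.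
have cn : ci != 0 :> C by rewrite -cabs_eq0 cabs_ci oner_eq0.
have h := poisson_char al%:C be%:C (sectorV sw).
rewrite /theta1.
have -> : theta_term al be (- (4 * w)^-1) =
   (fun n : int => cexp (- (pi%:C * (s^-1 * (n%:~R + al%:C)) ^+ 2) + tpi * (n%:~R + al%:C) * be%:C)).
  apply/funext => n; congr cexp; congr (_ + _); rewrite exprMn exprVn s2.
  have -> : (- (2 * ci * w))^-1 = - ci^-1 / (2 * w) by field; rewrite wn cn.
  by rewrite ciV /tpi; field.
have -> : tsum (fun n : int => cexp (- (pi%:C * (s^-1 * (n%:~R + al%:C)) ^+ 2) + tpi * (n%:~R + al%:C) * be%:C)) =
   s * tsum (fun k : int => cexp (- (pi%:C * ((k%:~R - be%:C) / s^-1) ^+ 2) + tpi * k%:~R * al%:C)).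
  by rewrite -h mulrA divff // mul1r.
have -> : (fun k : int => cexp (- (pi%:C * ((k%:~R - be%:C) / s^-1) ^+ 2) + tpi * k%:~R * al%:C)) =
   (fun k => cexp (tpi * al%:C * be%:C) * theta_term (- be) al w k).
  apply/funext => k; rewrite /theta_term -cexpD; congr cexp.
  rewrite invrK exprMn s2 rmorphN /tpi; ring.
rewrite (tsumE (has_sumZ _ (has_sum_theta _ _ w0))).
set T := tsum _; rewrite -[LHS]/(cexp (- (pi%:C * ci * al%:C * be%:C)) * (s * (cexp (tpi * al%:C * be%:C) * T))).
have -> : cexp (- (pi%:C * ci * (- be)%:C * al%:C)) =
  cexp (- (pi%:C * ci * al%:C * be%:C)) * cexp (tpi * al%:C * be%:C) :> C.
  by rewrite -cexpD; congr cexp; rewrite rmorphN /tpi; ring.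
ring.
Qed.

(** The map is translation by -k conjugated by [w -> - 1 / (4 w)]. The roots from the two inversions
    combine, since a quotient of two points of the sector has positive real part. *)
Lemma theta1_unipotent al be w (k : int) : 0 < Im w ->
  theta1 al be (w / (4 * k%:~R * w + 1)) =
  sqrtc (4 * k%:~R * w + 1) * theta1 (al + 2 * k%:~R * be) be w.
Proof.
move=> w0; have w1 := upper_inv w0; set w' := - (4 * w)^-1 in w1.
have wn : w != 0 by apply: contraTneq w0 => ->; rewrite ltxx.
have w'n : w' != 0 by apply: contraTneq w1 => ->; rewrite ltxx.
have w2 : 0 < Im (w' + (- k)%:~R) by rewrite ImD Im_int addr0.
have w2n : w' + (- k)%:~R != 0 by apply: contraTneq w2 => ->; rewrite ltxx.
have E : 4 * k%:~R * w + 1 = (w' + (- k)%:~R) / w' by rewrite /w' rmorphN /=; field.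
have En : 4 * k%:~R * w + 1 != 0 by rewrite E mulf_neq0 // invr_neq0.
have -> : w / (4 * k%:~R * w + 1) = - (4 * (w' + (- k)%:~R))^-1.
  rewrite /w' rmorphN /= in w2n *; field.
  have -> : -1 + - k%:~R * (4 * w) = - (4 * k%:~R * w + 1) by ring.
  by rewrite oppr_eq0 En wn.
rewrite theta1_inversion // theta1_translate //.
have e2 := theta1_inversion (al + 2 * k%:~R * be) be w1.
have wE : - (4 * w')^-1 = w by rewrite /w'; field.
rewrite {}wE in e2; rewrite e2.
have -> : al + 2 * (- k)%:~R * - be = al + 2 * k%:~R * be by rewrite rmorphN /=; ring.
have s1 := sector_sqrt_upper w2; have s2 := sector_sqrt_upper w1.
set a := sqrtc (- (2 * ci * (w' + _))) in s1 *; set b := sqrtc (- (2 * ci * w')) in s2 *.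
suff -> : sqrtc (4 * k%:~R * w + 1) = a / b by rewrite mulrA divfK // sector_neq0.
apply: sqrtc_uniq; last exact: Re_sector_div.
have cn : ci != 0 :> C by rewrite -cabs_eq0 cabs_ci oner_eq0.
by rewrite E expr_div_n !sqr_sqrtc; field; rewrite w'n cn.
Qed.

Lemma Im_moebius (a b c d : int) w : a * d - b * c = 1 -> c%:~R * w + d%:~R != 0 ->
  Im ((a%:~R * w + b%:~R) / (c%:~R * w + d%:~R)) = Im w / cabs (c%:~R * w + d%:~R) ^+ 2.
Proof.
move=> det X0; rewrite ImM ReV ImV !mulrA -mulrDl; congr (_ / _).
rewrite !(ReD, ImD, ReM, ImM, Re_int, Im_int).
have : (a%:~R * d%:~R - b%:~R * c%:~R : R) = 1 by rewrite -!intrM -intrB det.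
move=> h; transitivity ((a%:~R * d%:~R - b%:~R * c%:~R) * Im w); first by ring.
by rewrite h mul1r.
Qed.

Lemma denom_neq0 (c d : int) w : (c != 0) || (d != 0) -> 0 < Im w -> c%:~R * w + d%:~R != 0 :> C.
Proof.
move=> cd w0; have [c0|c0] := eqVneq c 0; first by move: cd; rewrite c0 eqxx mul0r add0r intr_eq0.
apply/eqP => /(congr1 (@complex.Im R)).
rewrite ImD ImM !Im_int Re_int mul0r !addr0 -[complex.Im 0]/(0 : R) => /eqP.
by rewrite mulf_eq0 intr_eq0 (negbTE c0) gt_eqF.
Qed.

Lemma centered_residue (c d : int) : c != 0 -> exists t : int, (2 * `|(d + c * t)%R| <= `|c|)%N.
Proof.
move=> c0; have := divz_eq d c; have := modz_ge0 d c0; have := ltz_mod d c0.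
set q := (d %/ c)%Z; set r := (d %% c)%Z => r1 r0 de.
have [h|h] := leP (2 * r) `|c|.
  by exists (- q); rewrite (_ : d + c * - q = r) ?de; [lia|ring].
exists (- q - sgz c); rewrite (_ : d + c * (- q - sgz c) = r - `|c|); last first.
  by have := abszEsg c; rewrite de abszE => ->; ring.
lia.
Qed.

Definition theta_multiplier (c d : int) : C := (kronecker c d)%:~R * (epsilon _ d)^-1.

Lemma epsilonN (d : int) : odd `|d| -> ci * (chi4z d)%:~R * (epsilon R (- d))^-1 = (epsilon R d)^-1.
Proof.
move=> dodd; rewrite /epsilon /chi4z; have -> : (- d == 1 %[mod 4])%Z = ~~ (d == 1 %[mod 4])%Z by lia.
case: (d == 1 %[mod 4])%Z => /=; rewrite -/(ci : C).
  by rewrite mulr1 divff ?invr1 // -cabs_eq0 cabs_ci oner_eq0.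
by rewrite invr1 mulr1 ciV mulrN1z mulrN mulr1.
Qed.

(* The descent: right multiplication by (1 t; 0 1), (1 0; 4k 1) and -1 makes |c| decrease. *)
Theorem theta1_gamma0_4 (a b c d : int) al be w : a * d - b * c = 1 -> (4 %| c)%Z -> 0 < Im w ->
  theta1 al be ((a%:~R * w + b%:~R) / (c%:~R * w + d%:~R)) =
  theta_multiplier c d * sqrtc (c%:~R * w + d%:~R) *
  theta1 (a%:~R * al + c%:~R * be / 2) (2 * b%:~R * al + d%:~R * be) w.
Proof.
pose P (a b c d : int) := forall al be w, 0 < Im w ->
  theta1 al be ((a%:~R * w + b%:~R) / (c%:~R * w + d%:~R)) =
  theta_multiplier c d * sqrtc (c%:~R * w + d%:~R) *
  theta1 (a%:~R * al + c%:~R * be / 2) (2 * b%:~R * al + d%:~R * be) w.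
suff H n : forall a b c d : int, (`|c| < n)%N -> a * d - b * c = 1 -> (4 %| c)%Z -> P a b c d.
  by move=> det c4; exact: (H `|c|.+1).
have dodd (a' b' c' d' : int) : a' * d' - b' * c' = 1 -> (4 %| c')%Z -> odd `|d'|.
  move=> det /dvdzP[q cq].
  have e : a' * d' = 1 + 4 * (b' * q).
    have -> : a' * d' = (a' * d' - b' * (q * 4)) + 4 * (b' * q) by ring.
    by rewrite -cq det.
  have : odd `|(a' * d')%R| by rewrite e; lia.
  by rewrite abszM oddM => /andP[].
have cop (a' b' c' d' : int) : a' * d' - b' * c' = 1 -> coprimez c' d'.
  by move=> det; apply/coprimezP; exists (- b', a') => /=; rewrite -det; ring.
have trans (a' b' c' d' t : int) : a' * d' - b' * c' = 1 -> (4 %| c')%Z -> c' != 0 ->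
    P a' (b' + t * a') c' (d' + c' * t) -> P a' b' c' d'.
  move=> det c4 c0 IH al' be' w' w0.
  have w1 : 0 < Im (w' + (- t)%:~R) by rewrite ImD Im_int addr0.
  have := IH al' be' _ w1.
  have -> : a'%:~R * (w' + (- t)%:~R) + (b' + t * a')%:~R = a'%:~R * w' + b'%:~R :> C.
    by rewrite rmorphN rmorphD rmorphM /=; ring.
  have -> : c'%:~R * (w' + (- t)%:~R) + (d' + c' * t)%:~R = c'%:~R * w' + d'%:~R :> C.
    by rewrite rmorphN rmorphD rmorphM /=; ring.
  move=> ->; rewrite theta1_translate //; congr (_ * _ * _).
    rewrite /theta_multiplier kronecker_period4 ?(dodd _ _ _ _ det) ?(cop _ _ _ _ det) //; congr (_ * _^-1).
    rewrite /epsilon; have -> // : (d' + c' * t == 1 %[mod 4])%Z = (d' == 1 %[mod 4])%Z.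
    by case/dvdzP: c4 => q ->; lia.
  by apply: eq_theta1 => //; rewrite !rmorphD rmorphN !rmorphM /=; field.
have neg (a' b' c' d' : int) : a' * d' - b' * c' = 1 -> (4 %| c')%Z -> c' != 0 ->
    P (- a') (- b') (- c') (- d') -> P a' b' c' d'.
  move=> det c4 c0 IH al' be' w' w0.
  have D0 : c'%:~R * w' + d'%:~R != 0 by apply: denom_neq0; rewrite ?c0.
  have := IH al' be' _ w0; rewrite !rmorphN /= !mulNr -!opprD invrN mulrNN => ->.
  rewrite !mulrN !mulNr -!opprD theta1_opp; congr (_ * _).
  have ImX : Im (c'%:~R * w' + d'%:~R) = c'%:~R * Im w' by rewrite ImD ImM Im_int Re_int Im_int mul0r !addr0.
  rewrite sqrtc_opp; last by rewrite ImX mulf_neq0 ?intr_eq0 // gt_eqF.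
  rewrite ImX pmulr_lgt0 // ltr0z /theta_multiplier kronecker_opp ?(dodd _ _ _ _ det) ?(cop _ _ _ _ det) //.
  rewrite -(epsilonN (dodd _ _ _ _ det c4)) !rmorphM /=.
  by case: ifP => _; rewrite ?mulrN1z ?mulr1z; ring.
have unip (a' b' c' d' k : int) : a' * d' - b' * c' = 1 -> (4 %| c')%Z -> 0 < d' ->
    P (a' + 4 * k * b') b' (c' + 4 * k * d') d' -> P a' b' c' d'.
  move=> det c4 d0 IH al' be' w' w0.
  have det1 : 1 * 1 - 0 * (- (4 * k)) = 1 :> int by ring.
  have N0 := @denom_neq0 (- (4 * k)) 1 w' (orbT _) w0.
  have w1E := Im_moebius det1 N0.
  set w1 := (_ / _) in w1E.
  have w1p : 0 < Im w1 by rewrite w1E divr_gt0 // exprn_gt0 // cabs_gt0.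
  have YE : (4 * k)%:~R * w1 + 1 = (- (4 * k)%:~R * w' + 1)^-1.
    by rewrite /w1 in N0 *; rewrite !intE in N0 *; rewrite mulr0z; field.
  have w'E : w' = w1 / ((4 * k)%:~R * w1 + 1).
    by rewrite YE invrK /w1; rewrite !intE in N0 *; rewrite mulr0z; field.
  have Y0 : (4 * k)%:~R * w1 + 1 != 0.
    by rewrite YE invr_eq0; move: N0; rewrite !intE.
  have D0 : c'%:~R * w' + d'%:~R != 0 by apply: denom_neq0; rewrite ?(gt_eqF d0) ?orbT.
  have := IH al' be' _ w1p.
  have -> : (a' + 4 * k * b')%:~R * w1 + b'%:~R = (a'%:~R * w' + b'%:~R) * ((4 * k)%:~R * w1 + 1) :> C.
    by rewrite w'E !intE; rewrite !intE in Y0; field.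
  have E : (c' + 4 * k * d')%:~R * w1 + d'%:~R = (c'%:~R * w' + d'%:~R) * ((4 * k)%:~R * w1 + 1) :> C.
    by rewrite w'E !intE; rewrite !intE in Y0; field.
  rewrite {1}E -mulf_div divff // mulr1 => ->.
  have -> : theta_multiplier (c' + 4 * k * d') d' = theta_multiplier c' d'.
    rewrite /theta_multiplier (@kronecker_modl _ c') ?(dodd _ _ _ _ det c4) //.
    by rewrite addrC addKr dvdz_mull.
  rewrite -[LHS]mulrA -[RHS]mulrA; congr (_ * _); rewrite [in RHS]w'E.
  have dR : 0 < d'%:~R :> R by rewrite ltr0z.
  have := sqrtc_unipotent c'%:~R (4 * k)%:~R w1p dR.
  rewrite !RC_int => sq.
  have -> : sqrtc ((c' + 4 * k * d')%:~R * w1 + d'%:~R) =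
    sqrtc (c'%:~R * (w1 / ((4 * k)%:~R * w1 + 1)) + d'%:~R) * sqrtc ((4 * k)%:~R * w1 + 1).
    by rewrite sq !RCE !intE.
  rewrite -[LHS]mulrA; congr (_ * _).
  have := theta1_unipotent (a'%:~R * al' + c'%:~R * be' / 2) (2 * b'%:~R * al' + d'%:~R * be') k w1p.
  rewrite -[4 * k%:~R](_ : (4 * k)%:~R = _); last by rewrite intrM.
  by move=> ->; congr (_ * _); apply: eq_theta1 => //; rewrite !rmorphD !rmorphM /=; field.
elim: n => [|n IH] a' b' c' d'; first by rewrite ltn0.
rewrite ltnS => cn det c4.
have [c0|c0] := eqVneq c' 0.
  move: det; rewrite c0 mulr0 subr0 => det al' be' w' w0.
  have [[a1 d1]|[a1 d1]] : (a' = 1 /\ d' = 1) \/ (a' = -1 /\ d' = -1).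
  - have : (`|a'| * `|d'| = 1)%N by rewrite -abszM det.
    by move=> /eqP; rewrite muln_eq1 => /andP[/eqP ha /eqP hd]; nia.
  - rewrite a1 d1 mul0r !add0r divr1 mul1r theta1_translate //.
    rewrite /theta_multiplier /epsilon eqxx invr1 mulr1 kronecker_jacobi // andbF jacobi1 sqrtc1 !mulr1 mul1r.
    by apply: eq_theta1; rewrite ?mulr0z ?mulr1z; ring.
  rewrite a1 d1 mul0r add0r !mulrNz !mulr1z invrN invr1 mulrN1 mulN1r opprD opprK.
  have -> : - b'%:~R = (- b')%:~R :> C by rewrite mulrNz.
  rewrite theta1_translate //.
  (* At -1 the conventions match: the principal root of -1 and [epsilon (-1)] are both i. *)
  have -> : theta_multiplier 0 (-1) * sqrtc (-1) = 1 :> C.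
    rewrite /theta_multiplier kronecker_jacobi // andbF jacobi1 sqrtN1 mul1r mul1r /epsilon /=.
    by rewrite mulVf // -/(ci : C) -cabs_eq0 cabs_ci oner_eq0.
  rewrite mul1r -[RHS]theta1_opp; by apply: eq_theta1; rewrite ?mulr0z ?mulrNz ?mulr1z; ring.
have [t ht] := centered_residue d' c0.
apply: (trans _ _ _ _ t) => //.
have det1 : a' * (d' + c' * t) - (b' + t * a') * c' = 1 by rewrite -det; ring.
move: (b' + t * a') (d' + c' * t) ht det1 => {b' d' det} b' d' ht det.
have do' := dodd _ _ _ _ det c4.
(* The unipotent step asks for d > 0; a negative d is handled through -1, which preserves [|c|] and
   [|d|]. *)
have pos (a2 b2 c2 d2 : int) : a2 * d2 - b2 * c2 = 1 -> (4 %| c2)%Z -> `|c2|%N = `|c'|%N -> `|d2|%N = `|d'|%N -> 0 < d2 -> P a2 b2 c2 d2.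
  move=> det2 c42 cc dd d20.
  have [k hk] : exists k, (`|(c2 + 4 * k * d2)%R| <= 2 * `|d2|)%N.
    have d40 : 4 * d2 != 0 by rewrite mulf_neq0 // gt_eqF.
    have [k hk] := centered_residue c2 d40; exists k.
    by move: hk; rewrite (_ : 4 * d2 * k = 4 * k * d2); [lia|ring].
  have c43 : (4 %| c2 + 4 * k * d2)%Z.
    by case/dvdzP: c42 => q ->; apply/dvdzP; exists (q + k * d2); ring.
  apply: (unip _ _ _ _ k) => //; apply: IH => //; last by rewrite -det2; ring.
  (* The decrease is strict: [2 |d|] is 2 modulo 4 because d is odd, whereas the new c is divisible
     by 4, so its absolute value is less than [2 |d| <= |c|]. *)
  case/dvdzP: c43 hk => q ->; lia.
have [d0|d0] := leP d' 0; last exact: pos.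
apply: neg => //; apply: pos.
- by rewrite -det; ring.
- by case/dvdzP: c4 => q ->; apply/dvdzP; exists (- q); rewrite mulNr.
- exact: abszN.
- exact: abszN.
- have : d' != 0 by apply: contraTneq do' => ->.
  lia.
Qed.

End ThetaCharacteristics.

(** * Theta series of even lattices *)

Section HasSumProduct.
Variable R : realType.
Local Notation C := R[i].

(** In C unconditional convergence is absolute. Finite sums outside [F] have modulus at most 2;
    selecting the terms by the sign of their real, then of their imaginary part, gives four such
    sums, whence 8. *)
Lemma has_sum_sum_bounded (I : eqType) (a : I -> C) s : has_sum a s -> exists M, sum_bounded a M.
Proof.
move=> h; have [F uF hF] := h 1 ltr01.
exists (\sum_(i <- F) cabs (a i) + 8) => G uG.
rewrite (bigID (fun i => i \in F)) /= lerD //.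
  rewrite -big_filter [leRHS](bigID (fun i => i \in G)) /= ler_wpDr ?sumr_ge0 // => [i _|]; first exact: cabs_ge0.
  rewrite -[leRHS]big_filter le_eqVlt; apply/orP; left; apply/eqP/perm_big/uniq_perm; rewrite ?filter_uniq // => i.
  by rewrite !mem_filter andbC.
have key (Q : pred I) : cabs (\sum_(i <- G | (i \notin F) && Q i) a i) <= 2.
  have u : uniq (F ++ [seq i <- G | (i \notin F) && Q i]).
    rewrite cat_uniq uF filter_uniq //= andbT; apply/hasPn => i; rewrite mem_filter => /andP[/andP[]] //.
  have sub : {subset F <= F ++ [seq i <- G | (i \notin F) && Q i]} by move=> i; rewrite mem_cat => ->.
  have h1 := hF _ u sub; have h2 := hF _ uF (fun _ => id).
  rewrite big_cat /= big_filter in h1.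
  have := ler_cabsB (\sum_(i <- F) a i + \sum_(i <- G | (i \notin F) && Q i) a i - s) (\sum_(i <- F) a i - s).
  rewrite (_ : _ - s - _ = \sum_(i <- G | (i \notin F) && Q i) a i); last by ring.
  by move=> h3; apply: (le_trans h3); rewrite -[2]/(1 + 1) ltW // ltrD.
have part (rho : {additive C -> R}) : (forall z, `|rho z| <= cabs z) ->
    \sum_(i <- G | i \notin F) `|rho (a i)| <= 4.
  move=> rc; rewrite (bigID (fun i => 0 <= rho (a i))) /=.
  have -> : \sum_(i <- G | (i \notin F) && (0 <= rho (a i))) `|rho (a i)| =
     rho (\sum_(i <- G | (i \notin F) && (0 <= rho (a i))) a i).
    by rewrite raddf_sum; apply: eq_bigr => i /andP[_]; exact: ger0_norm.
  have -> : \sum_(i <- G | (i \notin F) && ~~ (0 <= rho (a i))) `|rho (a i)| =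
     - rho (\sum_(i <- G | (i \notin F) && ~~ (0 <= rho (a i))) a i).
    by rewrite raddf_sum -sumrN; apply: eq_bigr => i /andP[_]; rewrite -ltNge; exact: ltr0_norm.
  have -> : 4 = 2 + 2 :> R by ring.
  apply: lerD; first exact: le_trans (ler_norm _) (le_trans (rc _) (key _)).
  by apply: le_trans (ler_norm _) _; rewrite normrN; exact: le_trans (rc _) (key _).
have -> : 8 = 4 + 4 :> R by ring.
have hR := part (@complex.Re R) (fun z => Re_le_cabs z).
have hI := part (@complex.Im R) (fun z => Im_le_cabs z).
apply: le_trans (lerD hR hI); rewrite -big_split; apply: ler_sum => i _ /=.
exact: cabs_le.
Qed.

Lemma has_sumM (I J : eqType) (a : I -> C) (b : J -> C) s t : has_sum a s -> has_sum b t ->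
  has_sum (fun ij : I * J => a ij.1 * b ij.2) (s * t).
Proof.
move=> ha hb; have [M hM] := has_sum_sum_bounded ha; have [N hN] := has_sum_sum_bounded hb.
exact: has_sum_prod hM hN ha hb.
Qed.

Lemma has_sum_col r (a : 'I_r -> int -> C) s : (forall i, has_sum (a i) (s i)) ->
  has_sum (fun y : 'cV[int]_r => \prod_i a i (y i 0)) (\prod_i s i).
Proof.
elim: r a s => [|r IH] a s ha.
  have := @has_sum_finite _ 'cV[int]_0 [:: 0] (fun y => \prod_i a i (y i 0)) isT.
  rewrite big_seq1 !big_ord0; apply => i.
  by rewrite (_ : i = 0) ?inE ?eqxx //; apply/matrixP => -[].
have h := has_sumM (ha ord0) (IH _ _ (fun i => ha (lift ord0 i))).
pose e (y : 'cV[int]_r.+1) : int * 'cV[int]_r := (y ord0 0, \col_i y (lift ord0 i) 0).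
pose f (p : int * 'cV[int]_r) : 'cV[int]_r.+1 :=
  \col_i (if unlift ord0 i is Some j then p.2 j 0 else p.1).
have ef : cancel e f.
  move=> y; apply/matrixP => i j; rewrite !mxE (ord1 j); case: unliftP => [k ->|->] //=.
  by rewrite mxE.
have fe : cancel f e.
  move=> [x y]; congr pair; first by rewrite mxE unlift_none.
  by apply/matrixP => i j; rewrite !mxE (ord1 j) liftK.
rewrite big_ord_recl; apply: has_sum_ext (has_sum_bij ef fe h) => y /=.
by rewrite big_ord_recl; congr (_ * _); apply: eq_bigr => i _; rewrite mxE.
Qed.

End HasSumProduct.

(** * Lattice theta series in diagonal coordinates *)

Section LatticeTheta.
Variable R : realType.
Local Opaque cexp.
Local Notation C := R[i].
Local Notation Im := complex.Im.
Local Notation Re := complex.Re.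

Lemma cexp_tpi_eq1 (x : int) m : (0 < m)%N -> cexp (tpi * (x%:~R / m%:R)) = 1 :> C -> (m%:Z %| x)%Z.
Proof.
move=> m0 h; have mz : (m%:Z != 0) by lia.
have := divz_eq x m; set q := (x %/ m)%Z; set t := (x %% m)%Z => xE.
have mC : (m%:R != 0 :> C) by rewrite pnatr_eq0 -lt0n.
have t0 : 0 <= t by apply: modz_ge0.
have tm : t < m%:Z by rewrite ltz_pmod // ltz_nat.
have [tE|tn] := eqVneq t 0; first by apply/dvdzP; exists q; rewrite xE tE addr0.
have : cexp (tpi * ((t%:~R / m%:R : R)%:C)) != 1 :> C.
  have mR : 0 < m%:R :> R by rewrite ltr0n.
  have tp : 0 < t by rewrite lt_neqAle eq_sym tn t0.
  apply: cexp_tpi_neq1; rewrite divr_gt0 ?ltr0z //=.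
  by rewrite ltr_pdivrMr // mul1r -[m%:R]/((m%:Z)%:~R) ltr_int.
rewrite !RCE; case/eqP; rewrite -[RHS]h -[LHS](cexpD_int _ q); congr cexp.
have -> : x%:~R = q%:~R * m%:R + t%:~R :> C by rewrite xE intrD intrM.
by field.
Qed.

Lemma residue_theta1 (h m : nat) (w : C) : (0 < m)%N -> 0 < Im w ->
  has_sum (fun y : int => if (m%:Z %| y - h%:Z)%Z then cexp (tpi * (y%:~R / m%:R) ^+ 2 * w) else 0)
    (theta1 (h%:R / m%:R) 0 w).
Proof.
move=> m0 w0; have mC : (m%:R != 0 :> C) by rewrite pnatr_eq0 -lt0n.
pose e (n : int) := h%:Z + m%:Z * n.
have ei : injective e by move=> x y; rewrite /e => /addrI /mulfI; apply; lia.
apply: (has_sum_inj ei) => [y hy|].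
  by case: ifP => // /dvdzP[q yq]; case: (hy q); rewrite /e mulrC -yq; lia.
rewrite /theta1 !rmorph0 mulr0 oppr0 cexp0 mul1r.
apply: has_sum_ext (has_sum_theta _ _ w0) => n.
rewrite /= /e [X in (_ %| X)%Z](_ : _ = n * m%:Z) ?dvdz_mull //; last by ring.
rewrite /theta_term rmorph0 mulr0 addr0; congr cexp; rewrite !RCE intrD intrM.
by congr (tpi * _ ^+ 2 * w); rewrite -[h%:~R]/(h%:R) -[m%:~R]/(m%:R); field.
Qed.

Variables (r m0 : nat) (A P Q : 'M[int]_r) (s : 'I_r -> nat).
Local Notation m := m0.+1.
Hypothesis s_gt0 : forall i, (0 < s i)%N.
Hypothesis PQ : P *m Q = (m%:Z)%:M.
Hypothesis QP : Q *m P = (m%:Z)%:M.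
Hypothesis PAP : P^T *m A *m P = diag_mx (\row_i (2 * s i)%N%:Z).

Definition lattice_norm (x : 'cV[int]_r) : int := (x^T *m A *m x) 0 0.

Definition lattice_term (z : C) (x : 'cV[int]_r) : C :=
  cexp (pi%:C * ci * (lattice_norm x)%:~R * z).

Definition lattice_theta (z : C) : C := tsum (lattice_term z).

Let col (h : {ffun 'I_r -> 'I_m}) : 'cV[int]_r := \col_i (h i)%:Z.
Let res (y : 'cV[int]_r) : {ffun 'I_r -> 'I_m} := [ffun i => inord `|(y i 0%R %% m)%Z|%N].
(** Membership in the sublattice [Q Z^r], by [LP], in a form that visibly depends only on y modulo
    m. *)
Let L (y : 'cV[int]_r) := [forall i, (m%:Z %| (P *m y) i 0%R)%Z].

Lemma col_res y : exists z, y = col (res y) + m%:Z *: z.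
Proof.
exists (\col_i (y i 0%R %/ m)%Z); apply/matrixP => i j; rewrite !mxE (ord1 j) ffunE inordK.
  rewrite {1}(divz_eq (y i 0) m%:Z) gez0_abs; last by apply: modz_ge0.
  by ring.
have := @ltz_mod (y i 0) m%:Z isT; have := @modz_ge0 (y i 0) m%:Z isT; lia.
Qed.

Lemma res_add y z : res (y + m%:Z *: z) = res y.
Proof. by apply/ffunP => i; rewrite !ffunE !mxE addrC mulrC modzMDl. Qed.

Lemma res_col h : res (col h) = h.
Proof.
apply/ffunP => i; rewrite !ffunE mxE modz_small /=; last by rewrite ltz_nat ltn_ord.
exact: inord_val.
Qed.

Lemma eq_res y y' : res y = res y' -> exists z, y = y' + m%:Z *: z.
Proof.
move=> e; have [z ->] := col_res y; have [z' ->] := col_res y'; rewrite e.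
by exists (z - z'); rewrite scalerBr -addrA [_ *: z' + _]addrC subrK.
Qed.

Lemma L_add y z : L (y + m%:Z *: z) = L y.
Proof.
apply: eq_forallb => i; rewrite mulmxDr -scalemxAr !mxE.
by apply: rpredDr; exact: dvdz_mulr.
Qed.

Lemma L_res y : L (col (res y)) = L y.
Proof. by have [z {2}->] := col_res y; rewrite L_add. Qed.

Lemma LP y : reflect (exists x, y = Q *m x) (L y).
Proof.
apply: (iffP forallP) => [h|[x ->] i]; last first.
  by rewrite mulmxA PQ mul_scalar_mx mxE dvdz_mulr.
exists (\col_i ((P *m y) i 0%R %/ m)%Z).
have E : P *m y = m%:Z *: \col_i ((P *m y) i 0%R %/ m)%Z.
  apply/matrixP => i j; rewrite (ord1 j) [RHS]mxE [X in _ * X]mxE.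
  by have := h i; rewrite dvdz_eq mulrC => /eqP ->.
apply: (@scalemx_inj _ _ _ m%:Z) => //.
by rewrite scalemxAr -E mulmxA QP mul_scalar_mx.
Qed.

Lemma LD y y' : L y -> L y' -> L (y + y').
Proof. by move=> /LP[x ->] /LP[x' ->]; apply/LP; exists (x + x'); rewrite mulmxDr. Qed.

Lemma LZ a y : L y -> L (a *: y).
Proof. by move=> /LP[x ->]; apply/LP; exists (a *: x); rewrite scalemxAr. Qed.

Lemma mulQ_inj : injective (fun x : 'cV[int]_r => Q *m x).
Proof.
move=> x y /(congr1 (mulmx P)); rewrite !mulmxA PQ !mul_scalar_mx.
exact: scalemx_inj.
Qed.

Lemma lattice_normE x :
  m%:Z ^+ 2 * lattice_norm x = \sum_i (2 * s i)%N%:Z * ((Q *m x) i 0) ^+ 2.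
Proof.
have E : m%:Z *: x = P *m (Q *m x) by rewrite mulmxA PQ mul_scalar_mx.
have -> : m%:Z ^+ 2 * lattice_norm x = ((m%:Z *: x)^T *m A *m (m%:Z *: x)) 0 0.
  have -> : (m%:Z *: x)^T = m%:Z *: x^T by rewrite linearZ.
  by rewrite /lattice_norm -scalemxAr -!scalemxAl [RHS]mxE [X in _ = _ * X]mxE expr2 mulrA.
rewrite E trmx_mul !mulmxA -(mulmxA _ P^T) -(mulmxA _ _ P) PAP -mulmxA mxE.
apply: eq_bigr => i _; rewrite mul_mx_diag !mxE; ring.
Qed.

Local Notation al h := (h%:R / m%:R : R).

(** In the coordinates [y = Q x] the form is diagonal and the lattice is a union of classes modulo
    m; over one class the series is a product of one-variable series with characteristics
    [h i / m]. *)
Lemma has_sum_lattice (z : C) : 0 < Im z -> has_sum (lattice_term z)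
  (\sum_(h | L (col h)) \prod_i theta1 (al (h i)) 0 ((s i)%:R * z)).
Proof.
move=> z0; have mC : (m%:R != 0 :> C) by rewrite pnatr_eq0.
have sz i : 0 < Im ((s i)%:R * z).
  by rewrite ImM -[(s i)%:R]/(((s i)%:Z)%:~R) Re_int Im_int mul0r addr0 mulr_gt0 // ltr0z ltz_nat.
pose T (h : {ffun 'I_r -> 'I_m}) (y : 'cV[int]_r) : C := \prod_i (if (m%:Z %| y i 0%R - (h i)%:Z)%Z
   then cexp (tpi * ((y i 0)%:~R / m%:R) ^+ 2 * ((s i)%:R * z)) else 0).
have hT h : has_sum (T h) (\prod_i theta1 (al (h i)) 0 ((s i)%:R * z)).
  apply: (has_sum_col (a := fun i y => if (m%:Z %| y - (h i)%:Z)%Z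
    then cexp (tpi * (y%:~R / m%:R) ^+ 2 * ((s i)%:R * z)) else 0)) => i.
  exact: residue_theta1.
pose G (y : 'cV[int]_r) : C := \prod_i cexp (tpi * ((y i 0)%:~R / m%:R) ^+ 2 * ((s i)%:R * z)).
have TE h y : T h y = if h == res y then G y else 0.
  case: eqP => [->|hy].
    apply: eq_bigr => i _; have [z' yE] := col_res y.
    by rewrite {1}yE !mxE addrAC subrr add0r dvdz_mulr.
  have [i hi] : exists i, ~~ (m%:Z %| y i 0%R - (h i)%:Z)%Z.
    apply/existsP; rewrite -negb_forall; apply/negP => /forallP hi; apply: hy.
    rewrite -[LHS]res_col -(res_add (col h) (\col_i ((y i 0%R - (h i)%:Z) %/ m)%Z)); congr res.
    apply/matrixP => i j; rewrite (ord1 j) !mxE; have := hi i; rewrite dvdz_eq mulrC => /eqP ->.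
    by ring.
  by rewrite /T (bigD1 i) //= (negbTE hi) mul0r.
have hS : has_sum (fun y => if L y then G y else 0)
   (\sum_(h | L (col h)) \prod_i theta1 (al (h i)) 0 ((s i)%:R * z)).
  apply: has_sum_ext (has_sum_sum _ (fun h _ => hT h)) => y /=.
  under eq_bigr do rewrite TE.
  rewrite -big_mkcondr /=; case: ifP => Ly.
    by rewrite (big_pred1 (res y)) // => h /=; case: eqP => [->|_]; rewrite ?andbF // L_res Ly.
  by rewrite big_pred0 // => h /=; case: eqP => [->|_]; rewrite ?andbF // L_res Ly.
have := has_sum_comp mulQ_inj (a := fun y => if L y then G y else 0) _ hS.
move=> H; apply: has_sum_ext (H _) => [x|y hy]; last first.
  by case: ifP => // /LP[x yx]; case: (hy x).
rewrite /= ifT; last by apply/LP; exists x.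
rewrite /G /lattice_term -cexp_sum; congr cexp.
have h : (m%:R ^+ 2 * (lattice_norm x)%:~R : C) = \sum_i 2 * (s i)%:R * ((Q *m x) i 0)%:~R ^+ 2.
  rewrite -[m%:R]/((m%:Z)%:~R) -rmorphXn -rmorphM /= lattice_normE rmorph_sum; apply: eq_bigr => i _.
  by rewrite rmorphM rmorphXn /= -[_%:~R]/((2 * s i)%N%:R) natrM.
apply: (mulfI (expf_neq0 2 mC)).
transitivity (pi%:C * ci * z * (m%:R ^+ 2 * (lattice_norm x)%:~R)); last by ring.
rewrite h !mulr_sumr; apply: eq_bigr => i _; rewrite /tpi; field.
by rewrite nat1r pnatr_eq0.
Qed.

Lemma lattice_thetaE (z : C) : 0 < Im z -> lattice_theta z =
  \sum_(h | L (col h)) \prod_i theta1 (al (h i)) 0 ((s i)%:R * z).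
Proof. by move=> z0; apply/tsumE/has_sum_lattice. Qed.

Lemma theta1_residue (h : nat) (y : int) (w : C) : (m%:Z %| y - h%:Z)%Z -> theta1 (y%:~R / m%:R) 0 w = theta1 (al h) 0 w.
Proof.
have shift (n : int) : theta1 (al h + n%:~R) 0 w = theta1 (al h) 0 w.
  have up a : theta1 (a + 1) 0 w = theta1 a 0 w by rewrite theta1_addl rmorph0 mulr0 oppr0 cexp0 mul1r.
  elim/int_rec: n => [|n IH|n IH]; first by rewrite addr0.
    by rewrite -[RHS]IH -[RHS]up intS; apply: eq_theta1 => //; rewrite rmorphD /=; ring.
  by rewrite -[RHS]IH -[LHS]up intS; apply: eq_theta1 => //; rewrite opprD rmorphD /= rmorphN1; ring.
move=> /dvdzP[q yq]; rewrite -(shift q); apply: eq_theta1 => //.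
have -> : y = q * m%:Z + h%:Z by rewrite -yq subrK.
rewrite intrD intrM -[h%:~R]/(h%:R) -[m%:~R]/(m%:R); field.
by rewrite nat1r pnatr_eq0.
Qed.

(** In the variable [s_i z] the matrix is [(a, b s_i; c_i, d)], to which the law on Gamma_0(4)
    applies. Of the factor [m^2] in b, one m makes the second characteristic an integer and the
    other makes its phase trivial. *)
Lemma lattice_theta_diagonal (a b c d : int) (cs : 'I_r -> int) (z : C) :
  a * d - b * c = 1 -> 0 < d -> (m%:Z ^+ 2 %| b)%Z ->
  (forall i, c = (s i)%:Z * cs i) -> (forall i, (4 %| cs i)%Z) -> 0 < Im z ->
  lattice_theta ((a%:~R * z + b%:~R) / (c%:~R * z + d%:~R)) =
  (\prod_i theta_multiplier R (cs i) d) * sqrtc (c%:~R * z + d%:~R) ^+ r * lattice_theta z.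
Proof.
move=> det d0 /dvdzP[q bq] cE c4 z0.
have D0 : c%:~R * z + d%:~R != 0 by apply: denom_neq0; rewrite ?(gt_eqF d0) ?orbT.
have z1 : 0 < Im ((a%:~R * z + b%:~R) / (c%:~R * z + d%:~R)).
  by rewrite Im_moebius // divr_gt0 // exprn_gt0 // cabs_gt0.
have mR : (m%:R != 0 :> R) by rewrite pnatr_eq0.
have term i (h : 'I_m) : theta1 (al h) 0 ((s i)%:R * ((a%:~R * z + b%:~R) / (c%:~R * z + d%:~R))) =
   theta_multiplier R (cs i) d * sqrtc (c%:~R * z + d%:~R) * theta1 ((a * h)%:~R / m%:R) 0 ((s i)%:R * z).
  have sC : ((s i)%:R != 0 :> C) by rewrite pnatr_eq0 -lt0n.
  have sz : 0 < Im ((s i)%:R * z).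
    by rewrite ImM -[(s i)%:R]/(((s i)%:Z)%:~R) Re_int Im_int mul0r addr0 mulr_gt0 // ltr0z ltz_nat.
  have dt : a * d - (b * (s i)%:Z) * cs i = 1 by rewrite -det (cE i); ring.
  have := theta1_gamma0_4 (al h) 0 dt (c4 i) sz.
  have E1 : (cs i)%:~R * ((s i)%:R * z) = c%:~R * z :> C by rewrite (cE i) intrM; ring.
  have E2 : a%:~R * ((s i)%:R * z) + (b * (s i)%:Z)%:~R = (s i)%:R * (a%:~R * z + b%:~R) :> C.
    by rewrite intrM; ring.
  rewrite E1 E2 -[(s i)%:R * _ / _]mulrA => ->; congr (_ * _); rewrite !mulr0 mul0r !addr0.
  have -> : 2 * (b * (s i)%:Z)%:~R * al h = 0 + (2 * q * (s i)%:Z * m%:Z * h%:Z)%:~R :> R.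
    by rewrite add0r bq !rmorphM /= -[m%:~R]/(m%:R); field.
  rewrite theta1_addr //.
  have -> : a%:~R * al h = (a * h)%:~R / m%:R :> R by rewrite rmorphM /= mulrA.
  rewrite [X in cexp X](_ : _ = tpi * (q * (s i)%:Z * h%:Z * (a * h))%:~R) ?cexp_tpi_int ?mul1r //.
  rewrite !RCE !rmorphM /= /tpi -[m%:~R]/(m%:R); field.
  by rewrite nat1r pnatr_eq0.
rewrite !lattice_thetaE // mulr_sumr.
have ad : exists k, d * a = 1 + m%:Z * k.
  by exists (m%:Z * q * c); rewrite mulrC -[LHS](subrK (b * c)) det bq; ring.
case: ad => k ad.
(* As [a d = 1] modulo m, multiplication by a permutes the classes, and it preserves those in
   [L]. *)
pose f (h : {ffun 'I_r -> 'I_m}) := res (a *: col h).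
have fi : injective f.
  have E y : res (d *: (a *: y)) = res y by rewrite scalerA ad scalerDl scale1r -scalerA res_add.
  move=> h h' /eq_res[x e].
  have E2 : d *: (m%:Z *: x) = m%:Z *: (d *: x) by rewrite !scalerA mulrC.
  by rewrite -(res_col h) -(res_col h') -E -[RHS]E e scalerDr E2 res_add.
rewrite [RHS](reindex_inj fi) /=.
have LE h : L (col (f h)) = L (col h).
  rewrite /f L_res; apply/idP/idP => [|/LZ //] /(LZ d).
  by rewrite scalerA ad scalerDl scale1r -scalerA L_add.
apply: eq_big => [h|h Lh]; first by rewrite LE.
rewrite (eq_bigr _ (fun i _ => term i (h i))) big_split /= big_split /= prodr_const card_ord; congr (_ * _).
apply: eq_bigr => i _; apply: theta1_residue.
have [y yE] := col_res (a *: col h); have := congr1 (fun M : 'cV[int]_r => M i 0) yE.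
rewrite /f !mxE => ->; by rewrite addrAC subrr add0r dvdz_mulr.
Qed.

Lemma upper_neg_inv (z : C) : 0 < Im z -> 0 < Im (- z^-1).
Proof.
move=> z0; rewrite ImN ImV mulNr opprK divr_gt0 // exprn_gt0 // cabs_gt0.
by apply: contraTneq z0 => ->; rewrite ltxx.
Qed.

Let dual_theta (u : C) : C :=
  \sum_(h | L (col h)) \prod_i theta1 0 (al (h i)) (u / (4 * (s i)%:R)).

Lemma upper_scaled i (u : C) : 0 < Im u -> 0 < Im (u / (4 * (s i)%:R)).
Proof.
move=> u0; have -> : u / (4 * (s i)%:R) = ((4 * (s i)%:R)^-1 : R)%:C * u by rewrite !RCE mulrC.
by rewrite ImM Re_real Im_real mul0r addr0 mulr_gt0 // invr_gt0 mulr_gt0 // ltr0n.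
Qed.

Lemma lattice_theta_inversion (u : C) : 0 < Im u ->
  lattice_theta (- u^-1) = (\prod_i sqrtc (- (2 * ci * (u / (4 * (s i)%:R))))) * dual_theta u.
Proof.
move=> u0; rewrite lattice_thetaE ?upper_neg_inv // /dual_theta mulr_sumr.
have un : u != 0 by apply: contraTneq u0 => ->; rewrite ltxx.
apply: eq_bigr => h _; rewrite -big_split; apply: eq_bigr => i _ /=.
have sC : ((s i)%:R != 0 :> C) by rewrite pnatr_eq0 -lt0n.
have := theta1_inversion (al (h i)) 0 (upper_scaled i u0).
rewrite oppr0 => <-; congr theta1; field; by rewrite un sC.
Qed.

(** A character sum over the group of classes in [L] vanishes unless the character is trivial, since
    translation by [h0] multiplies it by [e (col h0)]. Triviality on [Q Z^r] says that m divides
    [k^T Q], hence that k lies in [P^T Z^r], the dual lattice in these coordinates. *)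
Lemma dual_support (k : 'cV[int]_r) :
  \sum_(h | L (col h)) cexp (tpi * (((k^T *m col h) 0 0)%:~R / m%:R)) != 0 :> C ->
  exists t, k = P^T *m t.
Proof.
move=> nz; have mC : (m%:R != 0 :> C) by rewrite pnatr_eq0.
pose e (y : 'cV[int]_r) : C := cexp (tpi * (((k^T *m y) 0 0)%:~R / m%:R)).
have eD y y' : e (y + y') = e y * e y'.
  by rewrite /e -cexpD mulmxDr mxE intrD; congr cexp; field.
have em y : e (m%:Z *: y) = 1.
  rewrite /e -scalemxAr mxE intrM [X in cexp X](_ : _ = tpi * ((k^T *m y) 0 0)%:~R) ?cexp_tpi_int //.
  by rewrite -[m%:~R]/(m%:R); field.
have eres y : e (col (res y)) = e y by have [x {2}->] := col_res y; rewrite eD em mulr1.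
have all1 h0 : L (col h0) -> e (col h0) = 1.
  move=> Lh0; pose f (h : {ffun 'I_r -> 'I_m}) := res (col h + col h0).
  have fi : injective f.
    move=> h h' /eq_res[x]; rewrite addrAC => /addIr E.
    by rewrite -(res_col h) E res_add res_col.
  have LE h : L (col (f h)) = L (col h).
    rewrite /f L_res; apply/idP/idP => [hL|/LD]; last exact.
    have := LD hL (LZ (-1) Lh0); rewrite scaleN1r addrK //.
  have : \sum_(h | L (col h)) e (col h) = (\sum_(h | L (col h)) e (col h)) * e (col h0).
    rewrite {1}(reindex_inj fi) mulr_suml; apply: eq_big => h; first exact: LE.
    by move=> _; rewrite /f eres eD.
  by move=> E; apply: (mulfI nz); rewrite mulr1 -E.
have dv y : L y -> (m%:Z %| (k^T *m y) 0%R 0%R)%Z.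
  move=> Ly; apply: cexp_tpi_eq1 => //; rewrite -/(e y) -eres; apply: all1.
  by rewrite L_res.
have E : k^T *m Q = m%:Z *: \row_j ((k^T *m Q) 0%R j %/ m)%Z.
  apply/matrixP => i j; rewrite (ord1 i) [RHS]mxE [X in _ * X]mxE.
  have LQ : L (Q *m delta_mx j 0) by apply/LP; exists (delta_mx j 0).
  by have := dv _ LQ; rewrite mulmxA -colE mxE dvdz_eq mulrC => /eqP ->.
exists (\row_j ((k^T *m Q) 0%R j %/ m)%Z)^T.
apply: trmx_inj; rewrite trmx_mul !trmxK; apply: (@scalemx_inj _ _ _ m%:Z) => //.
by rewrite scalemxAl -E -mulmxA QP mul_mx_scalar.
Qed.

(** The integer is the adjugate form [t^T adj(A) t]: the sum of the [k_i^2 / (2 s_i)] is the inverse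
    form of A at t, and [det A] times the inverse is the adjugate. *)
Lemma dual_norm_integral (k t : 'cV[int]_r) : k = P^T *m t ->
  exists n : int, \sum_i (2 * \det A)%:~R * ((k i 0)%:~R ^+ 2 / (4 * (s i)%:R)) = n%:~R :> C.
Proof.
move=> kt; have mC : (m%:R != 0 :> C) by rewrite pnatr_eq0.
pose v := \adj A *m t; have [q qE] : exists q, q = Q *m v by exists (Q *m v).
have Dk : (m%:Z * \det A) *: k = diag_mx (\row_i (2 * s i)%N%:Z) *m q.
  rewrite -PAP qE -!mulmxA (mulmxA P) PQ mul_scalar_mx -!scalemxAr /v (mulmxA A) mul_mx_adj mul_scalar_mx.
  by rewrite kt -scalemxAr scalerA.
exists ((t^T *m v) 0 0).
have E : m%:Z * (t^T *m v) 0 0 = \sum_i k i 0 * q i 0.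
  transitivity ((k^T *m q) 0 0); last by rewrite mxE; apply: eq_bigr => i _; rewrite mxE.
  by rewrite kt trmx_mul trmxK qE mulmxA -(mulmxA _ P) PQ mul_mx_scalar -scalemxAl [RHS]mxE.
apply: (mulfI mC); rewrite -[in RHS](_ : (m%:Z)%:~R = m%:R) // -intrM E mulr_sumr rmorph_sum.
apply: eq_bigr => i _ /=.
have sC : ((s i)%:R != 0 :> C) by rewrite pnatr_eq0 -lt0n.
have := congr1 (fun M : 'cV[int]_r => (M i 0)%:~R : C) Dk.
rewrite mul_diag_mx !mxE !intrM -[(2 * s i)%N%:~R]/((2 * s i)%N%:R) natrM => e.
transitivity ((k i 0)%:~R * (m%:~R * (\det A)%:~R * (k i 0)%:~R) / (2 * (s i)%:R) : C).
  by rewrite -[m%:~R]/(m%:R); field.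
by rewrite e; field.
Qed.

Lemma dual_theta_translate (u : C) (K : int) : (2 * \det A %| K)%Z -> 0 < Im u -> dual_theta (u - K%:~R) = dual_theta u.
Proof.
move=> /dvdzP[l KE].
have hs u' : 0 < Im u' -> has_sum (fun k : 'cV[int]_r =>
   cexp (tpi * u' * \sum_i ((k i 0)%:~R ^+ 2 / (4 * (s i)%:R))) *
   \sum_(h | L (col h)) cexp (tpi * (((k^T *m col h) 0 0)%:~R / m%:R))) (dual_theta u').
  move=> u0.
  have hh (h : {ffun 'I_r -> 'I_m}) : has_sum (fun k : 'cV[int]_r => \prod_i theta_term 0 (al (h i)) (u' / (4 * (s i)%:R)) (k i 0))
     (\prod_i theta1 0 (al (h i)) (u' / (4 * (s i)%:R))).
    apply: (has_sum_col (a := fun i n => theta_term 0 (al (h i)) (u' / (4 * (s i)%:R)) n)) => i; rewrite /theta1 rmorph0 mulr0 mul0r oppr0 cexp0 mul1r.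
    exact/has_sum_theta/upper_scaled.
  have := has_sum_sum (index_enum {ffun 'I_r -> 'I_m}) (P := fun h => L (col h)) (fun h _ => hh h).
  apply: has_sum_ext => k /=; rewrite mulr_sumr.
  apply: eq_bigr => h _; rewrite -cexpD -cexp_sum; congr cexp.
  rewrite mulr_sumr [(_ *m _) 0 0]mxE rmorph_sum /= mulr_suml mulr_sumr -big_split.
  apply: eq_bigr => i _; rewrite /= !mxE !RCE addr0 intrM -[((h i)%:Z)%:~R]/((h i)%:R); ring.
move=> u0; have u1 : 0 < Im (u - K%:~R) by rewrite ImD ImN Im_int subr0.
apply: has_sum_unique (hs _ u1) _; apply: has_sum_ext (hs _ u0) => k.
(* Outside the dual lattice the term vanishes on both sides; on it, the translation changes the
   exponent by an integer multiple of [2 pi i]. *)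
set E := \sum_(h | L (col h)) _; have [->|nz] := eqVneq E 0; first by rewrite !mulr0.
have [t kt] := dual_support nz; have [n hn] := dual_norm_integral kt.
congr (_ * _); rewrite -[LHS](cexpD_int _ (- (l * n))); congr cexp.
rewrite mulrNz intrM -hn KE intrM -mulr_sumr; ring.
Qed.

(** Inversion carries (1 0; K 1) to the translation of the dual series by -K. *)
Lemma lattice_theta_unipotent (K : int) (z : C) : (2 * \det A %| K)%Z -> 0 < Im z ->
  lattice_theta (z / (K%:~R * z + 1)) = sqrtc (K%:~R * z + 1) ^+ r * lattice_theta z.
Proof.
move=> hK z0; pose u := - z^-1; have u0 : 0 < Im u := upper_neg_inv z0.
have zn : z != 0 by apply: contraTneq z0 => ->; rewrite ltxx.
have un : u != 0 by apply: contraTneq u0 => ->; rewrite ltxx.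
have u1 : 0 < Im (u - K%:~R) by rewrite ImD [Im (- K%:~R)]ImN Im_int subr0.
have u1n : u - K%:~R != 0 by apply: contraTneq u1 => ->; rewrite ltxx.
have zE : z = - u^-1 by rewrite /u invrN opprK invrK.
have YE : K%:~R * z + 1 = (u - K%:~R) / u by rewrite zE; field.
have Yn : K%:~R * z + 1 != 0 by rewrite YE mulf_neq0 // invr_neq0.
have -> : z / (K%:~R * z + 1) = - (u - K%:~R)^-1 by rewrite YE {1}zE; field; rewrite u1n.
have -> : lattice_theta z = lattice_theta (- u^-1) by rewrite -zE.
rewrite !lattice_theta_inversion // dual_theta_translate // mulrA; congr (_ * _).
have -> x : x ^+ r = \prod_(i < r) x :> C by rewrite prodr_const card_ord.
rewrite -big_split; apply: eq_bigr => i _ /=.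
have s1 := sector_sqrt_upper (upper_scaled i u1); have s2 := sector_sqrt_upper (upper_scaled i u0).
set x := sqrtc (- _) in s1 *; set y := sqrtc (- _) in s2 *.
suff -> : sqrtc (K%:~R * z + 1) = x / y by rewrite divfK // sector_neq0.
apply: sqrtc_uniq; last exact: Re_sector_div.
have cn : ci != 0 :> C by rewrite -cabs_eq0 cabs_ci oner_eq0.
have sC : ((s i)%:R != 0 :> C) by rewrite pnatr_eq0 -lt0n.
by rewrite YE expr_div_n !sqr_sqrtc; field; rewrite un cn sC.
Qed.

End LatticeTheta.

(** * Integral diagonalization and coprime shifts *)

Section Diagonalization.

(** Gram-Schmidt without denominators: [E] clears the first row at the price of a factor [al], so
    the Schur complement is multiplied by [al^2] and stays integral and positive. *)
Lemma integral_diagonalization r (A : 'M[int]_r) : A^T = A ->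
  (forall x : 'cV_r, x != 0 -> 0 < (x^T *m A *m x) 0 0) ->
  exists P (s : 'I_r -> int), [/\ \det P != 0, P^T *m A *m P = diag_mx (\row_i s i) & forall i, 0 < s i].
Proof.
elim: r A => [|r IH] A symA posA.
  exists 1%:M, (fun _ => 1); split=> [||[]//]; first by rewrite det1.
  by apply/matrixP => -[].
move: A symA posA; rewrite -[r.+1]/(1 + r)%N => A symA posA.
pose al := A (lshift r 0) (lshift r 0); pose v := (@ursubmx int 1 r 1 r A : 'rV[int]_r); pose B := (@drsubmx int 1 r 1 r A : 'M[int]_r).
have AE : A = block_mx (al%:M) v (v^T) B :> 'M[int]_(1 + r).
  rewrite -[LHS](@submxK _ 1 r 1 r); congr block_mx.
    by apply/matrixP => i j; rewrite (ord1 i) (ord1 j) !mxE; congr (A _ _); exact: val_inj.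
  by rewrite /v trmx_ursub symA.
have al0 : 0 < al.
  have -> : al = ((delta_mx (lshift r 0) 0 : 'cV[int]_(1 + r))^T *m A *m (delta_mx (lshift r 0) 0 : 'cV[int]_(1 + r))) 0 0.
    by rewrite trmx_delta -rowE -colE !mxE.
  by apply: posA; apply/eqP => /matrixP/(_ (lshift r 0) 0); rewrite !mxE !eqxx.
pose E : 'M[int]_(1 + r) := block_mx 1%:M (- v) 0 al%:M.
pose B' := al *: (al *: B - v^T *m v).
have EAE : E^T *m A *m E = block_mx al%:M 0 0 B'.
  rewrite AE /E tr_block_mx -mulmxA !mulmx_block !trmx1 !trmx0 !mul1mx !mulmx1 !mul0mx !mulmx0 !addr0 !tr_scalar_mx.
  have e1 : al%:M *m - v + v *m al%:M = 0 by rewrite mulmxN mul_scalar_mx mul_mx_scalar addNr.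
  have e2 : (- v)^T *m al%:M + al%:M *m v^T = 0 by rewrite linearN /= mulNmx mul_scalar_mx mul_mx_scalar addNr.
  rewrite e1 e2 mulmx0 add0r; congr block_mx.
  by rewrite mul_scalar_mx mulmxN mul_mx_scalar /B' addrC.
have gen k (X : 'M[int]_(1 + r, k)) : (E *m X)^T *m A *m (E *m X) = X^T *m block_mx (al%:M) 0 0 B' *m X.
  by rewrite trmx_mul -EAE !mulmxA.
have symB : B'^T = B'.
  have BT : B^T = B by rewrite /B trmx_drsub symA.
  by rewrite /B' linearZ linearB /= linearZ /= trmx_mul trmxK BT.
have [|P' [s' [dP' PBP s0]]] := IH B' symB.
  move=> x x0; pose y : 'cV[int]_(1 + r) := E *m col_mx 0 x.
  have -> : (x^T *m B' *m x) 0 0 = (y^T *m A *m y) 0 0.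
    rewrite /y gen tr_col_mx mul_row_block.
    by rewrite trmx0 !mul0mx !mulmx0 !add0r mul_row_col mul0mx add0r.
  apply: posA; apply: contraNneq x0; rewrite /y /E mul_block_col.
  move=> /(congr1 dsubmx); rewrite col_mxKd mulmx0 add0r mul_scalar_mx (_ : dsubmx 0 = 0); last by apply/matrixP => i j; rewrite !mxE.
  move=> /matrixP h; apply/eqP/matrixP => i j; have /eqP := h i j.
  by rewrite !mxE mulf_eq0 gt_eqF //= => /eqP.
pose S : 'rV[int]_(1 + r) := row_mx al%:M (\row_i s' i).
exists (E *m (block_mx 1%:M 0 0 P' : 'M[int]_(1 + r))), (S 0); split.
- by rewrite det_mulmx !det_ublock !det1 det_scalar !mul1r mulf_neq0 // expf_neq0 // gt_eqF.
- rewrite gen tr_block_mx !mulmx_block.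
  rewrite !trmx0 trmx1 !mul0mx !mulmx0 !mul1mx !mulmx1 !addr0 !add0r mul0mx PBP.
  have -> : \row_i S 0 i = S by apply/rowP => i; rewrite mxE.
  rewrite diag_mx_row; congr block_mx.
  by apply/matrixP => i j; rewrite !mxE (ord1 i) (ord1 j) mulr1n.
- move=> i; rewrite mxE; case: splitP => j _; rewrite mxE //.
  by rewrite (ord1 j) mulr1n.
Qed.

End Diagonalization.

Section CoprimeShift.

Lemma coprime_shift (c d : int) (M : nat) : c != 0 -> coprimez c d -> (0 < M)%N ->
  exists t, 0 < d + c * t /\ coprimez (d + c * t) M%:Z.
Proof.
(* [t0] collects the primes of M that do not divide d. A prime of M dividing d divides neither [t0]
   nor c, any other divides [t0] but not d, so none divides [d + c t0]. A multiple of M, governed by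
   [k], then makes the value positive. *)
move=> c0 cd M0; pose t0 := (M`_[pred p | ~~ (p %| `|d|)])%N.
pose x := d + c * t0%:Z; pose k := sgz c * (`|x| + 1).
have xk : d + c * (t0%:Z + M%:Z * k) = x + `|c| * M%:Z * (`|x| + 1).
  rewrite /x /k [`|c|](_ : _ = sgz c * c); first by ring.
  by rewrite -abszE -abszEsg.
have x0 : 0 < d + c * (t0%:Z + M%:Z * k).
  rewrite xk; have c1 : 1 <= `|c| by rewrite -gtz0_ge1 normr_gt0.
  have : 1 <= `|c| * M%:Z by nia.
  by nia.
exists (t0%:Z + M%:Z * k); split=> //; move: x0; set y := d + _ => y0.
have yn : (0 < `|y|)%N by lia.
rewrite /coprimez /gcdz absz_nat eqz_nat -[_ == _]/(coprime `|y| M).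
rewrite coprime_has_primes //; apply/hasPn => p; rewrite mem_primes => /and3P[pp _ pM].
rewrite /= mem_primes pp yn /=; apply/negP => py.
have pt0 : (p %| t0)%N = ~~ (p %| `|d|)%N.
  have := congr1 (fun l => p \in l) (primes_part [pred p | ~~ (p %| `|d|)%N] M).
  by rewrite mem_filter !mem_primes pp part_gt0 M0 pM /= inE andbT.
have pxz : (p%:Z %| d + c * t0%:Z)%Z.
  have -> : d + c * t0%:Z = y - M%:Z * (c * k) by rewrite /y; ring.
  by apply: rpredB; [rewrite dvdzE | apply: dvdz_mulr; rewrite dvdzE].
case pd : (p %| `|d|)%N; rewrite pd /= in pt0.
  have : (p%:Z %| c * t0%:Z)%Z.
    have -> : c * t0%:Z = (d + c * t0%:Z) - d by ring.
    by apply: rpredB => //; rewrite dvdzE.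
  rewrite dvdzE abszM absz_nat Euclid_dvdM // pt0 orbF => pc.
  have : (p %| gcdn `|c| `|d|)%N by rewrite dvdn_gcd pc pd.
  by move: cd; rewrite /coprimez /gcdz eqz_nat => /eqP ->; rewrite dvdn1 => /eqP p1; rewrite p1 in pp.
have : (p%:Z %| d)%Z.
  have -> : d = (d + c * t0%:Z) - c * t0%:Z by ring.
  by apply: rpredB => //; apply: dvdz_mull; rewrite dvdzE absz_nat pt0.
by rewrite dvdzE absz_nat pd.
Qed.

End CoprimeShift.

(** * The transformation law on Gamma_0(2 det A) *)

Section Gamma0Law.
Variable R : realType.
Local Notation C := R[i].
Local Notation Im := complex.Im.
Variables (r m0 : nat) (A P Q : 'M[int]_r) (s : 'I_r -> nat).
Local Notation m := m0.+1.
Hypothesis s_gt0 : forall i, (0 < s i)%N.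
Hypothesis PQ : P *m Q = (m%:Z)%:M.
Hypothesis QP : Q *m P = (m%:Z)%:M.
Hypothesis PAP : P^T *m A *m P = diag_mx (\row_i (2 * s i)%N%:Z).
Hypothesis evenA : forall x, (2 %| lattice_norm A x)%Z.
Local Notation theta := (@lattice_theta R r A).

Lemma lattice_theta_translate (z : C) (t : int) : theta (z + t%:~R) = theta z.
Proof.
congr tsum; apply/funext => x; rewrite /lattice_term.
have /dvdzP[q ->] := evenA x.
rewrite -[RHS](cexpD_int _ (q * t)); congr cexp; rewrite /tpi !intrM; ring.
Qed.

Lemma det_diagonalization : \det P ^+ 2 * \det A = 2 ^+ r * \prod_i (s i)%:Z.
Proof.
have := congr1 determinant PAP; rewrite !det_mulmx det_tr det_diag => e.
have -> : 2 ^+ r = \prod_(i < r) 2 :> int by rewrite prodr_const card_ord.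
rewrite expr2 mulrAC e -big_split.
by apply: eq_bigr => i _; rewrite mxE PoszM.
Qed.

(** If d is prime to this number, then m, 2, [det P] and all [s i] are invertible modulo d; and its
    multiples are divisible by m and by each [4 s_i]. *)
Definition bad_modulus : nat := (m * 4 * (\prod_i s i) * `|\det P|)%N.

Lemma det_neq0 : (\det P != 0) && (\det A != 0).
Proof.
have : \det P ^+ 2 * \det A != 0.
  rewrite det_diagonalization mulf_neq0 ?expf_neq0 //; apply/prodf_neq0 => i _.
  by rewrite eqz_nat -lt0n.
by rewrite mulf_eq0 negb_or expf_eq0.
Qed.

Lemma bad_modulus_gt0 : (0 < bad_modulus)%N.
Proof.
have /andP[dP _] := det_neq0.
by rewrite !muln_gt0 absz_gt0 dP prodn_gt0.
Qed.

Lemma coprime_bad_modulus d (x : nat) : coprimez d bad_modulus%:Z -> (x %| bad_modulus)%N -> coprimez d x.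
Proof.
rewrite /coprimez /gcdz !absz_nat !eqz_nat => cop xM; exact: coprime_dvdr xM cop.
Qed.

(** From [s_i c_i = c] modulo d and [(s_i / d)^2 = 1] comes [(c_i / d) = (c / d) (s_i / d)]; and up
    to squares the product of the [s_i] is [2^r det A], by [det_diagonalization]. *)
Lemma prod_kronecker (cs : 'I_r -> int) (c d : int) : odd `|d| -> 0 < d -> coprimez d bad_modulus%:Z ->
  (forall i, (d %| (s i)%:Z * cs i - c)%Z) ->
  \prod_i kronecker (cs i) d = (kronecker c d * kronecker 2 d) ^+ r * kronecker (\det A) d.
Proof.
move=> dodd d0 cop hc.
have sq (x : nat) : (x %| bad_modulus)%N -> kronecker x d ^+ 2 = 1.
  by move=> xM; apply: kronecker_sqr => //; rewrite coprimez_sym; exact: coprime_bad_modulus xM.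
have sM i : (s i %| bad_modulus)%N.
  by rewrite /bad_modulus (bigD1 i) //= dvdn_mulr // dvdn_mull // dvdn_mulr.
have term i : kronecker (cs i) d = kronecker c d * kronecker (s i) d.
  rewrite -(kronecker_modl dodd d0 (hc i)) kronecker_mull // mulrC mulrA -expr2 sq ?mul1r //.
rewrite (eq_bigr _ (fun i _ => term i)) big_split /= prodr_const card_ord exprMn -mulrA; congr (_ * _).
have <- : kronecker (\prod_i (s i)%:Z) d = \prod_i kronecker (s i) d.
  apply: (big_morph (fun x => kronecker x d)) => [x y|]; first exact: kronecker_mull.
  by rewrite kronecker_pos // jacobi_1l.
have krX (x : int) k : kronecker (x ^+ k) d = kronecker x d ^+ k by rewrite !kronecker_pos // jacobi_expl.
have := congr1 (fun x => kronecker x d) det_diagonalization.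
rewrite !kronecker_mull // !krX.
have sqP : kronecker (\det P) d ^+ 2 = 1.
  apply: kronecker_sqr => //; rewrite coprimez_sym /coprimez /gcdz.
  have : coprimez d `|\det P|%N by apply: coprime_bad_modulus cop _; rewrite dvdn_mull.
  by rewrite /coprimez /gcdz absz_nat.
rewrite expr2 in sqP; rewrite sqP mul1r => ->; rewrite mulrA -exprD addnn -mul2n exprM (sq 2%N) ?expr1n ?mul1r //.
by rewrite /bad_modulus dvdn_mulr // dvdn_mulr // dvdn_mull.
Qed.

Lemma lattice_theta_coprime (a b c d : int) (z : C) : a * d - b * c = 1 -> (2 * \det A %| c)%Z -> 0 < d ->
  coprimez d bad_modulus%:Z -> 0 < Im z ->
  theta ((a%:~R * z + b%:~R) / (c%:~R * z + d%:~R)) =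
  ((kronecker c d * kronecker 2 d) ^+ r * kronecker (\det A) d)%:~R * (epsilon R d)^-1 ^+ r *
  sqrtc (c%:~R * z + d%:~R) ^+ r * theta z.
Proof.
move=> det /dvdzP[c0 cE] d0 cop z0; set D := \det A in cE *.
have dodd : odd `|d|.
  have : coprimez d 2%N by apply: coprime_bad_modulus cop _; rewrite /bad_modulus dvdn_mulr // dvdn_mulr // dvdn_mull.
  by rewrite /coprimez /gcdz absz_nat eqz_nat -[_ == _]/(coprime _ _) coprime_sym coprime2n.
have : coprimez d (bad_modulus%:Z ^+ 2) by rewrite coprimezXr.
move=> /coprimezP[[u v] /= uv]; set M := bad_modulus%:Z in uv.
have uvE : v * M ^+ 2 = 1 - u * d by rewrite -uv; ring.
(* With [c = 2 D c0] and [u d + v M^2 = 1], the choice [K = - 2 D c0 u] changes c into [c v M^2],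
   and [t = - b u] below changes b into [b v M^2]. A lower unipotent matrix and a translation thus
   make both off-diagonal entries divisible by [M^2]. *)
have [K [cd [KD cdD cdE]]] : exists K cd : int,
    [/\ (2 * D %| K)%Z, cd = c + d * K & cd = 2 * D * c0 * v * M ^+ 2].
  exists (2 * D * - (c0 * u)), (c + d * (2 * D * - (c0 * u))); split => //; first exact: dvdz_mulr.
  by rewrite -[RHS]mulrA uvE cE; ring.
have [t [a2 [b2 [a2E b2D b2E]]]] : exists t a2 b2 : int,
    [/\ a2 = a + b * K + t * cd, b2 = b + t * d & b2 = b * v * M ^+ 2].
  exists (- (b * u)), (a + b * K + - (b * u) * cd), (b + - (b * u) * d); split => //.
  by rewrite -[RHS]mulrA uvE; ring.
have det2 : a2 * d - b2 * cd = 1 by rewrite -det a2E b2D cdD; ring.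
have mM : (m%:Z ^+ 2 %| b2)%Z.
  rewrite b2E dvdz_mull // dvdz_exp2r // /M dvdzE !absz_nat /bad_modulus.
  by rewrite dvdn_mulr // dvdn_mulr // dvdn_mulr.
have sM i : exists e : int, M = (s i)%:Z * (4 * e).
  exists (m%:Z * (\prod_(j | j != i) s j)%N%:Z * `|\det P|%N%:Z).
  rewrite /M /bad_modulus (bigD1 i) //= !PoszM; ring.
(* This is [cd / s_i], in a form that displays the factor 4 left in [M / s_i]. *)
pose cs i := 2 * D * c0 * v * M * (M %/ (s i)%:Z)%Z.
have csE i : cd = (s i)%:Z * cs i.
  have [e Me] := sM i; have s0 : (s i)%:Z != 0 by rewrite eqz_nat -lt0n.
  by rewrite cdE /cs expr2 {2 4}Me mulKz //; ring.
have cs4 i : (4 %| cs i)%Z.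
  have [e Me] := sM i; have s0 : (s i)%:Z != 0 by rewrite eqz_nat -lt0n.
  by rewrite /cs {2}Me mulKz // dvdz_mull // dvdz_mulr.
have det1 : 1 * 1 - 0 * (- K) = 1 :> int by ring.
have N0 := @denom_neq0 R (- K) 1 z (orbT _) z0.
have w0E := Im_moebius det1 N0.
set w := (_ / _) in w0E.
have w0 : 0 < Im w by rewrite w0E divr_gt0 // exprn_gt0 // cabs_gt0.
have YE : K%:~R * w + 1 = (- K%:~R * z + 1)^-1.
  by rewrite /w in N0 *; rewrite !intE in N0 *; rewrite mulr0z; field.
have zE : z = w / (K%:~R * w + 1).
  by rewrite YE invrK /w; rewrite !intE in N0 *; rewrite mulr0z; field.
have Y0 : K%:~R * w + 1 != 0.
  by rewrite YE invr_eq0; move: N0; rewrite !intE.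
have D0 : cd%:~R * w + d%:~R != 0 by apply: denom_neq0; rewrite ?(gt_eqF d0) ?orbT.
have DE : cd%:~R * w + d%:~R = (c%:~R * z + d%:~R) * (K%:~R * w + 1).
  by rewrite [in RHS]zE cdD intrD intrM; field.
have gzE : (a%:~R * z + b%:~R) / (c%:~R * z + d%:~R) + t%:~R = (a2%:~R * w + b2%:~R) / (cd%:~R * w + d%:~R).
  have X0 : c%:~R * z + d%:~R != 0 by apply: contraNneq D0; rewrite DE => ->; rewrite mul0r.
  have -> : a2%:~R * w + b2%:~R = ((a%:~R * z + b%:~R) + t%:~R * (c%:~R * z + d%:~R)) * (K%:~R * w + 1) :> C.
    by rewrite [in RHS]zE a2E b2D cdD !(intrD, intrM); field.
  by rewrite DE; field; rewrite X0 Y0.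
rewrite -[LHS](lattice_theta_translate _ t) gzE.
rewrite (lattice_theta_diagonal s_gt0 PQ QP PAP det2 d0 mM csE cs4 w0).
have -> : theta z = sqrtc (K%:~R * w + 1) ^+ r * theta w.
  rewrite {1}zE; exact: (lattice_theta_unipotent s_gt0 PQ QP PAP).
have dR : 0 < d%:~R :> R by rewrite ltr0z.
have sq := sqrtc_unipotent c%:~R K%:~R w0 dR.
rewrite [RHS]mulrA; congr (_ * _); rewrite -[RHS]mulrA -exprMn.
have -> : sqrtc (c%:~R * z + d%:~R) * sqrtc (K%:~R * w + 1) = sqrtc (cd%:~R * w + d%:~R) :> C.
  by move: sq; rewrite !RCE -zE => ->; congr (sqrtc (_ * w + _)); rewrite cdD intrD intrM [d%:~R * _]mulrC.
congr (_ * _); rewrite /theta_multiplier big_split /= prodr_const card_ord; congr (_ * _).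
rewrite -rmorph_prod /=; congr (_%:~R); apply: prod_kronecker => // i.
by rewrite -csE cdD addrAC subrr add0r dvdz_mulr.
Qed.

(** An integral translation of z replaces d by [d + c t], positive and prime to [bad_modulus]. The
    shift t remains in the multiplier until the periods of the characters remove it. *)
Lemma lattice_theta_gamma0 (a b c d : int) (z : C) : a * d - b * c = 1 -> (2 * \det A %| c)%Z -> c != 0 -> 0 < Im z ->
  exists t, [/\ 0 < d + c * t, odd `|(d + c * t)%R|, coprimez (d + c * t) (\det A) &
  theta ((a%:~R * z + b%:~R) / (c%:~R * z + d%:~R)) =
  ((kronecker c (d + c * t) * kronecker 2 (d + c * t)) ^+ r * kronecker (\det A) (d + c * t))%:~R *
  (epsilon R (d + c * t))^-1 ^+ r *
  sqrtc (c%:~R * z + d%:~R) ^+ r * theta z].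
Proof.
move=> det Dc c0 z0.
have cd : coprimez c d by apply/coprimezP; exists (- b, a) => /=; rewrite -det; ring.
have [t [d0 cop]] := coprime_shift c0 cd bad_modulus_gt0.
exists t; have det2 : a * (d + c * t) - (b + a * t) * c = 1 by rewrite -det; ring.
have z1 : 0 < Im (z + (- t)%:~R) by rewrite ImD Im_int addr0.
have cd2 : coprimez (2 * \det A) (d + c * t).
  apply/coprimezP; case/dvdzP: Dc => q qE; exists (- (b + a * t) * q, a) => /=.
  by rewrite -mulrA -qE -det2; ring.
move: (cd2); rewrite coprimezMl => /andP[c2 cD]; split=> //.
- by move: c2; rewrite /coprimez /gcdz eqz_nat -[_ == _]/(coprime _ _) coprime2n.
- by rewrite coprimez_sym.
have := lattice_theta_coprime det2 Dc d0 cop z1.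
have -> : a%:~R * (z + (- t)%:~R) + (b + a * t)%:~R = a%:~R * z + b%:~R :> C.
  by rewrite mulrNz intrD intrM; ring.
have -> : c%:~R * (z + (- t)%:~R) + (d + c * t)%:~R = c%:~R * z + d%:~R :> C.
  by rewrite mulrNz intrD intrM; ring.
by rewrite lattice_theta_translate.
Qed.

End Gamma0Law.

(** * Behaviour at the cusps *)

Section ExponentialSums.
Variable R : realType.
Local Opaque cexp.
Local Notation C := R[i].
Local Notation Im := complex.Im.
Local Notation Re := complex.Re.

Lemma complex_pos (e : C) : 0 < e -> exists2 x : R, 0 < x & e = x%:C.
Proof. by case: e => x y; rewrite ltcE /= => /andP[/eqP -> x0]; exists x. Qed.

Lemma cabs_lt_norm (z : C) (x : R) : (`|z| < x%:C) = (cabs z < x).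
Proof. by rewrite cabsE ltcR. Qed.

Lemma has_sum_series (a : nat -> C) s : has_sum a s -> (series a : nat -> C^o) @ \oo --> (s : C^o).
Proof.
move=> h; apply/cvgrPdist_lt => e /complex_pos[x x0 ->].
have [F uF hF] := h x x0.
exists (\max_(i <- F) i).+1 => // n /= nF.
rewrite distrC cabs_lt_norm; apply: hF; first exact: iota_uniq.
move=> i iF; rewrite mem_index_iota /=; apply: leq_trans nF.
by rewrite ltnS; have := @leq_bigmax_seq _ F xpredT id i iF isT.
Qed.

(** The terms at the lower point [z'] exceed those at z by the factor [exp (2 mu dl)], which pays
    for the [mu^2] of the Taylor remainder and for its growth over the disc of radius [dl]. Absolute
    convergence at [z'] thus justifies termwise differentiation. *)
Lemma derivable_exponential_sum (I : eqType) (c : I -> C) (mu : I -> R) (F : C -> C) :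
  (forall i, 0 <= mu i) ->
  (forall z, 0 < Im z -> has_sum (fun i => c i * cexp (ci * (mu i)%:C * z)) (F z)) ->
  forall z, 0 < Im z -> derivable (F : C^o -> C^o) z 1.
Proof.
move=> mu0 hF z z0; pose dl := Im z / 4.
have d0 : 0 < dl by rewrite divr_gt0.
pose z' := z - (2 * dl)%:C * ci.
have z'0 : 0 < Im z'.
  rewrite /z' ImD ImN ImM Im_ci Re_ci Re_real Im_real mulr1 mulr0 addr0 /dl; lra.
have [M hM] := has_sum_sum_bounded (hF _ z'0).
have M0 := sum_bounded_ge0 hM.
have expz i : cabs (c i * cexp (ci * (mu i)%:C * z')) = cabs (c i * cexp (ci * (mu i)%:C * z)) * expR (mu i * (2 * dl)).
  have -> : ci * (mu i)%:C * z' = ci * (mu i)%:C * z + (mu i * (2 * dl))%:C.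
    rewrite /z' mulrBr; congr (_ + _); rewrite -mulrN.
    transitivity (- (ci * ci) * ((mu i)%:C * (2 * dl)%:C) : C); first by ring.
    by rewrite ciM opprK mul1r RCM.
  by rewrite cexpD cexp_real [in LHS]mulrA cabsM cabsR ger0_norm ?expR_ge0.
have mule i : mu i <= dl^-1 * expR (mu i * (2 * dl)).
  rewrite mulrC ler_pdivlMr //; apply: (le_trans _ (expR_ge1Dx _)).
  by have := mulr_ge0 (mu0 i) (ltW d0); lra.
pose g i : C := c i * cexp (ci * (mu i)%:C * z) * (ci * (mu i)%:C).
have hg : sum_bounded g (cabs (dl^-1)%:C * M).
  apply: sum_bounded_le (sum_boundedZ (dl^-1)%:C hM) => i.
  rewrite /g (cabsM (c i * cexp _)) (cabsM (dl^-1)%:C) expz (cabsM ci) cabs_ci mul1r !cabsR.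
  rewrite (ger0_norm (mu0 i)) (@ger0_norm _ dl^-1) ?invr_ge0 ?(ltW d0) //.
  by rewrite [leRHS]mulrCA ler_wpM2l ?cabs_ge0.
have [L hL _] := has_sum_bounded hg.
apply/cvg_ex; exists (L : C^o); apply/cvgrPdist_lt => e /complex_pos[x x0 ->].
(* The 16 is the 4 of [cexp_sub1D_le] times the 4 in [mu^2 = (4 / dl^2) (mu dl / 2)^2], where
   [(mu dl / 2)^2 <= exp (mu dl)]. Adding 1 keeps [B] positive. *)
pose B := 16 / dl ^+ 2 * M + 1.
have B0 : 0 < B by rewrite ltr_wpDl // mulr_ge0 // divr_ge0 // sqr_ge0.
pose eta := Num.min dl (x / B).
have eta0 : 0 < eta by rewrite lt_min d0 divr_gt0.
near=> h.
have h0 : h != 0 by near: h; exact: nbhs_dnbhs_neq.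
have hs : cabs h < eta.
  rewrite -cabs_lt_norm; near: h; apply: dnbhs0_lt; by rewrite ltcR.
move: hs; rewrite lt_min => /andP[hd hx].
have zh : 0 < Im (h *: 1 + z).
  rewrite ImD [h *: 1]mulr1; have := Im_le_cabs h; rewrite ler_norml => /andP[] + _.
  rewrite /dl in hd; lra.
have H : has_sum (fun i => c i * cexp (ci * (mu i)%:C * z) * ((cexp (ci * (mu i)%:C * h) - 1 - ci * (mu i)%:C * h) / h))
   (h^-1 * (F (h *: 1 + z) - F z) - L).
  apply: has_sum_ext (has_sumB (has_sumZ h^-1 (has_sumB (hF _ zh) (hF _ z0))) hL) => i /=.
  have -> : cexp (ci * (mu i)%:C * (h *: 1 + z)) = cexp (ci * (mu i)%:C * h) * cexp (ci * (mu i)%:C * z).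
    by rewrite -cexpD -mulrDr [h *: 1]mulr1.
  rewrite /g; field.
  exact: h0.
rewrite distrC cabs_lt_norm.
have : cabs (h^-1 * (F (h *: 1 + z) - F z) - L) <= cabs (16 / dl ^+ 2 * cabs h)%:C * M.
  apply: (has_sum_cabs_le H); apply: sum_bounded_le (sum_boundedZ _ hM) => i.
  rewrite [leLHS]cabsM [leRHS]cabsM expz [leRHS]mulrCA ler_wpM2l ?cabs_ge0 //.
  have cx : cabs (ci * (mu i)%:C * h) = mu i * cabs h.
    by rewrite cabsM (cabsM ci) cabs_ci mul1r cabsR ger0_norm.
  rewrite cabsM cabsV ler_pdivrMr ?cabs_gt0 //.
  apply: (le_trans (cexp_sub1D_le _)); rewrite cx.
  have h1 : expR (mu i * cabs h) <= expR (mu i * dl) by rewrite ler_expR ler_wpM2l // ltW.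
  have h2 : (mu i * dl / 2) ^+ 2 <= expR (mu i * dl).
    have -> : expR (mu i * dl) = expR (mu i * dl / 2) ^+ 2 by rewrite expr2 -expRD; congr expR; field.
    have p0 : 0 <= mu i * dl / 2 by rewrite divr_ge0 // mulr_ge0 // ltW.
    rewrite ler_pXn2r ?nnegrE ?expR_ge0 //; apply: (le_trans _ (expR_ge1Dx _)); lra.
  have ch := cabs_ge0 h.
  rewrite cabsR ger0_norm; last by rewrite mulr_ge0 // divr_ge0 // sqr_ge0.
  have -> : expR (mu i * (2 * dl)) = expR (mu i * dl) * expR (mu i * dl) by rewrite -expRD; congr expR; ring.
  have dn : dl != 0 by rewrite gt_eqF.
  have -> : 4 * (mu i * cabs h) ^+ 2 = 16 / dl ^+ 2 * cabs h ^+ 2 * (mu i * dl / 2) ^+ 2 by field.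
  have -> : 16 / dl ^+ 2 * cabs h * (expR (mu i * dl) * expR (mu i * dl)) * cabs h = 16 / dl ^+ 2 * cabs h ^+ 2 * (expR (mu i * dl) * expR (mu i * dl)) by ring.
  rewrite -[leLHS]mulrA; apply: ler_wpM2l; first by rewrite mulr_ge0 ?sqr_ge0 // divr_ge0 // sqr_ge0.
  by rewrite ler_pM ?sqr_ge0 ?expR_ge0.
move=> le; apply: (le_lt_trans le); have ch := cabs_ge0 h.
rewrite cabsR ger0_norm; last by rewrite mulr_ge0 // divr_ge0 // sqr_ge0.
apply: (le_lt_trans (y := cabs h * B)); last by rewrite -ltr_pdivlMr.
rewrite /B mulrDr mulr1 -[leLHS]addr0 lerD // le_eqVlt; apply/orP; left; apply/eqP; ring.
Unshelve. all: by end_near.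
Qed.

(** The coefficient of exponent n is read off at the point i, where the terms with [e i = n] are
    absolutely summable, and then divided by the nonzero value [E n ci]. *)
Lemma regroup_exponents (I : eqType) (c : I -> C) (e : I -> nat) (h : nat) (F : C -> C) :
  (forall z, 0 < Im z -> has_sum (fun i => c i * cexp (tpi * (e i)%:R * z / h%:R)) (F z)) ->
  exists a : nat -> C, forall z, 0 < Im z -> has_sum (fun n => a n * cexp (tpi * n%:R * z / h%:R)) (F z).
Proof.
move=> hF; have i0 : 0 < Im (ci : C) by rewrite Im_ci.
have [M hM] := has_sum_sum_bounded (hF _ i0).
pose E (n : nat) z : C := cexp (tpi * n%:R * z / h%:R).
have hb n : has_sum (fun i => if e i == n then c i * E n ci else 0) (tsum (fun i => if e i == n then c i * E n ci else 0)).
  apply: (@has_sum_tsum _ _ _ M); apply: sum_bounded_le hM => i.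
  by case: eqP => [->//|_]; rewrite cabs0 cabs_ge0.
exists (fun n => tsum (fun i => if e i == n then c i * E n ci else 0) / E n ci) => z z0.
apply: (@has_sum_fiber _ _ _ e) (hF _ z0) _ => n.
set T := tsum _ in hb *.
have -> : T / E n ci * cexp (tpi * n%:R * z / h%:R) = E n z / E n ci * T by rewrite /E; ring.
apply: has_sum_ext (has_sumZ (E n z / E n ci) (hb n)) => i.
  case: eqP => [->|_]; last by rewrite mulr0.
  by rewrite mulrCA divfK // cexp_neq0.
Qed.

End ExponentialSums.

Section CuspExpansion.
Variable R : realType.
Local Opaque cexp.
Local Notation C := R[i].
Local Notation Im := complex.Im.
Local Notation Re := complex.Re.

(** The class of h modulo m is cut into classes modulo [m' = m^2 c], on which the phase coming from
    [s a / c] is constant. What remains on each is a theta series at [w1], and its inversion is a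
    series in [z + d / c]. *)
Lemma theta1_cusp (h m c s : nat) (a d : int) : (0 < m)%N -> (0 < c)%N -> (0 < s)%N ->
  exists kappa : int -> C, forall z, 0 < Im z ->
  has_sum (fun k => kappa k * cexp (tpi * (k%:~R ^+ 2 * z / (4 * s%:R * m%:R ^+ 2))))
    (theta1 (h%:R / m%:R) 0 (s%:R * (a%:~R / c%:R - (c%:R * (c%:R * z + d%:~R))^-1)) /
     sqrtc (- (2 * ci * ((z + d%:~R / c%:R) / (4 * s%:R * m%:R ^+ 2))))).
Proof.
move=> m0 c0 s0.
have mC : (m%:R != 0 :> C) by rewrite pnatr_eq0 -lt0n.
have cC : (c%:R != 0 :> C) by rewrite pnatr_eq0 -lt0n.
have sC : (s%:R != 0 :> C) by rewrite pnatr_eq0 -lt0n.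
pose m' := (m ^ 2 * c)%N; have m'0 : (0 < m')%N by rewrite muln_gt0 expn_gt0 m0.
have m'E : m'%:R = m%:R ^+ 2 * c%:R :> C by rewrite natrM natrX.
have m'C : (m'%:R != 0 :> C) by rewrite pnatr_eq0 -lt0n.
pose phase (x : int) : C := cexp (tpi * ((x%:~R / m%:R) ^+ 2 * (s%:R * (a%:~R / c%:R)))).
have phaseE (x : int) (y : nat) : (m'%:Z %| x - y%:Z)%Z -> phase x = phase y.
  move=> /dvdzP[q xy]; have -> : x = y%:Z + q * m'%:Z by rewrite -xy; ring.
  rewrite /phase -[RHS](cexpD_int _ (q * (2 * y%:Z + q * m'%:Z) * s%:Z * a)); congr cexp.
  by rewrite !(intrD, intrM) -[m'%:~R]/(m'%:R) -[s%:~R]/(s%:R) m'E; field; rewrite mC cC.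
pose P (h' : 'I_m') := (m%:Z %| (h' : nat)%:Z - h%:Z)%Z.
exists (fun k => \sum_(h' | P h') phase (h' : nat) *
   cexp (tpi * (k%:~R ^+ 2 * d%:~R / (4 * s%:R * m%:R ^+ 2 * c%:R)) + tpi * k%:~R * ((h' : nat)%:R / m'%:R))).
move=> z z0.
have X0 : c%:R * z + d%:~R != 0 by have := @denom_neq0 R c%:Z d z; rewrite eqz_nat -lt0n c0 => /(_ isT z0).
pose w2 := (z + d%:~R / c%:R) / (4 * s%:R * m%:R ^+ 2).
have w20 : 0 < Im w2.
  have -> : w2 = ((4 * s%:R * m%:R ^+ 2)^-1 : R)%:C * (z + (d%:~R / c%:R : R)%:C) by rewrite !RCE mulrC.
  rewrite ImM Re_real Im_real mul0r addr0 ImD Im_real addr0 mulr_gt0 // invr_gt0.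
  by rewrite mulr_gt0 ?exprn_gt0 ?mulr_gt0 // ltr0n.
pose w1 := - (4 * w2)^-1; have w10 : 0 < Im w1 := upper_inv w20.
have w2n : w2 != 0 by apply: contraTneq w20 => ->; rewrite ltxx.
pose w := s%:R * (a%:~R / c%:R - (c%:R * (c%:R * z + d%:~R))^-1).
have wE : w = s%:R * (a%:~R / c%:R) + w1 * (m%:R / m'%:R) ^+ 2.
  rewrite /w /w1 /w2 m'E; field.
  by rewrite mC cC sC /= mulrC X0.
have w0 : 0 < Im w.
  rewrite wE (_ : s%:R * (a%:~R / c%:R) = (s%:R * (a%:~R / c%:R) : R)%:C); last by rewrite !RCE.
  rewrite (_ : w1 * _ = ((m%:R / m'%:R) ^+ 2 : R)%:C * w1); last by rewrite !RCE mulrC.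
  rewrite ImD ImM Re_real !Im_real mul0r addr0 add0r mulr_gt0 // exprn_gt0 // divr_gt0 ?ltr0n //.
have key : theta1 (h%:R / m%:R) 0 w = \sum_(h' | P h') phase (h' : nat) * theta1 ((h' : nat)%:R / m'%:R) 0 w1.
  apply: has_sum_unique (residue_theta1 h m0 w0) _.
  have hh (h' : 'I_m') := has_sumZ (phase (h' : nat)) (residue_theta1 h' m'0 w10).
  have := has_sum_sum (index_enum 'I_m') (P := P) (fun h' _ => hh h').
  apply: has_sum_ext => y /=.
  have yr : (`|(y %% m')%Z| < m')%N.
    have mz : m'%:Z != 0 by rewrite eqz_nat -lt0n.
    by have := @ltz_mod y m'%:Z mz; have := @modz_ge0 y m'%:Z mz; clear; lia.
  pose y' := Ordinal yr.
  have yy : (m'%:Z %| y - (y' : nat)%:Z)%Z.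
    have mz : m'%:Z != 0 by rewrite eqz_nat -lt0n.
    rewrite /= gez0_abs ?modz_ge0 // {1}(divz_eq y m'%:Z) addrK dvdz_mull //.
  have uni (h' : 'I_m') : (m'%:Z %| y - (h' : nat)%:Z)%Z = (h' == y').
    apply/idP/eqP => [hd|->//]; apply: ord_inj.
    have : (m'%:Z %| (h' : nat)%:Z - (y' : nat)%:Z)%Z.
      have -> : (h' : nat)%:Z - (y' : nat)%:Z = (y - (y' : nat)%:Z) - (y - (h' : nat)%:Z) by ring.
      exact: rpredB.
    move: (ltn_ord h') (ltn_ord y'); move: (nat_of_ord h') (nat_of_ord y') => u1 u2 h1 h2 /dvdzP[q].
    clear -h1 h2; move: m' h1 h2 => n h1 h2 qe.
    have [q0|q0|q0] := ltgtP q 0.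
    - have : q * n%:Z <= - n%:Z by nia.
      lia.
    - have : n%:Z <= q * n%:Z by nia.
      lia.
    - by rewrite q0 mul0r in qe; lia.
  under eq_bigr do rewrite uni.
  have Py : P y' = (m%:Z %| y - h%:Z)%Z.
    have : (m%:Z %| y - (y' : nat)%:Z)%Z.
      by apply: dvdz_trans yy; rewrite dvdzE /= /m' -mulnn -mulnA dvdn_mulr.
    rewrite /P => yd; have -> : y - h%:Z = (y - (y' : nat)%:Z) + ((y' : nat)%:Z - h%:Z) by ring.
    by apply/esym; exact: rpredDl.
  rewrite -Py big_mkcond (bigD1 y') //= big1 ?addr0; last first.
    by move=> h' hy; rewrite (negbTE hy) mulr0 if_same.
  rewrite eqxx; case: ifP => // _; rewrite -(phaseE y) // -cexpD; congr cexp.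
  rewrite wE; field.
  by rewrite m'C cC mC.
rewrite -/w -/w2 key.
have sw := sector_neq0 (sector_sqrt_upper w20).
have -> : (\sum_(h' | P h') phase (h' : nat) * theta1 ((h' : nat)%:R / m'%:R) 0 w1) / sqrtc (- (2 * ci * w2)) =
   \sum_(h' | P h') phase (h' : nat) * theta1 0 ((h' : nat)%:R / m'%:R) w2.
  rewrite mulr_suml; apply: eq_bigr => h' _; rewrite theta1_inversion // oppr0; field.
  exact: sw.
have hh (h' : 'I_m') := has_sumZ (phase (h' : nat)) (has_sum_theta 0 ((h' : nat)%:R / m'%:R) w20).
have := has_sum_sum (index_enum 'I_m') (P := P) (fun h' _ => hh h').
rewrite (_ : \sum_(h' | P h') phase (h' : nat) * theta1 0 ((h' : nat)%:R / m'%:R) w2 =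
  \sum_(h' | P h') phase (h' : nat) * tsum (theta_term 0 ((h' : nat)%:R / m'%:R) w2)); last first.
  by apply: eq_bigr => h' _; rewrite /theta1 rmorph0 mulr0 mul0r oppr0 cexp0 mul1r.
apply: has_sum_ext => k /=; rewrite mulr_suml; apply: eq_bigr => h' _.
rewrite -mulrA /theta_term -cexpD; congr (_ * cexp _); rewrite /w2 !RCE addr0; field.
by rewrite ?m'C ?cC ?mC ?sC.
Qed.

Definition has_expansion (F : C -> C) : Prop := exists (h : nat) (a : nat -> C), (0 < h)%N /\
  forall z, 0 < Im z -> has_sum (fun n => a n * cexp (tpi * n%:R * z / h%:R)) (F z).

Lemma has_expansionZ (x : C) F : has_expansion F -> has_expansion (fun z => x * F z).
Proof.
move=> [h [a [h0 ha]]]; exists h, (fun n => x * a n); split=> // z z0.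
by apply: has_sum_ext (has_sumZ x (ha z z0)) => n; rewrite mulrA.
Qed.

Lemma eq_has_expansion F G : (forall z, 0 < Im z -> F z = G z) -> has_expansion F -> has_expansion G.
Proof. by move=> FG [h [a [h0 ha]]]; exists h, a; split=> // z z0; rewrite -FG //; exact: ha. Qed.

(** The arguments of the two roots lie in ]-pi/2, 0[ and ]0, pi/2[, so the product stays in the
    right half-plane. *)
Lemma sqrtc_rotation (X : C) : 0 < Im X -> sqrtc (- ci * X) = sqrtc (- ci) * sqrtc X.
Proof.
move=> X0; have X1 : Im X != 0 by rewrite gt_eqF.
have r0 := Re_sqrtc_gt0 (z := X); rewrite X1 in r0.
have i0 := Im_sqrtc_sg X1; rewrite pmulr_rgt0 // in i0.
have c1 : Im (- ci : C) != 0 by rewrite ImN Im_ci oppr_eq0 oner_eq0.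
have cr := Re_sqrtc_gt0 (z := - ci : C); rewrite c1 in cr.
have cs := Im_sqrtc_sg c1; rewrite ImN Im_ci mulN1r oppr_gt0 in cs.
apply: sqrtc_uniq; first by rewrite exprMn !sqr_sqrtc.
rewrite ReM subr_gt0; apply: (lt_trans (y := 0)); last by rewrite mulr_gt0 ?r0 ?cr.
by rewrite nmulr_rlt0.
Qed.

Variables (r m0 : nat) (A P Q : 'M[int]_r) (s : 'I_r -> nat).
Local Notation m := m0.+1.
Hypothesis s_gt0 : forall i, (0 < s i)%N.
Hypothesis PQ : P *m Q = (m%:Z)%:M.
Hypothesis QP : Q *m P = (m%:Z)%:M.
Hypothesis PAP : P^T *m A *m P = diag_mx (\row_i (2 * s i)%N%:Z).
Hypothesis evenA : forall x, (2 %| lattice_norm A x)%Z.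
Local Notation theta := (@lattice_theta R r A).

Lemma lattice_norm_ge0 x : 0 <= lattice_norm A x.
Proof.
have m2 : 0 < m%:Z ^+ 2 :> int by rewrite exprn_gt0.
rewrite -(pmulr_rge0 _ m2) (lattice_normE PQ PAP); apply: sumr_ge0 => i _.
by rewrite mulr_ge0 // sqr_ge0.
Qed.

Lemma has_sum_lattice_theta z : 0 < Im z -> has_sum (@lattice_term R r A z) (theta z).
Proof.
move=> z0; rewrite (lattice_thetaE s_gt0 PQ QP PAP) //.
exact: (has_sum_lattice s_gt0 PQ QP PAP).
Qed.

Lemma lattice_theta_expansion : has_expansion theta.
Proof.
have [|a ha] := @regroup_exponents R _ (fun=> 1) (fun x => `|lattice_norm A x|%N) 2 theta; last by exists 2%N, a.
move=> z z0; apply: has_sum_ext (has_sum_lattice_theta z0) => x.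
rewrite mul1r /lattice_term; congr cexp.
by rewrite -[`|_|%N%:R]/((`|lattice_norm A x|%N%:Z)%:~R) gez0_abs ?lattice_norm_ge0 // /tpi; field.
Qed.

(** By [theta1_cusp] each one-variable factor, divided by its own root [S i z], is an exponential
    series; the product of these roots is a nonzero constant times [sqrtc (c z + d) ^ r]. *)
Lemma lattice_theta_cusp_pos (a b d : int) (c : nat) : a * d - b * c%:Z = 1 -> (0 < c)%N ->
  has_expansion (fun z => (sqrtc (c%:R * z + d%:~R) ^+ r)^-1 * theta ((a%:~R * z + b%:~R) / (c%:R * z + d%:~R))).
Proof.
move=> det c0; have cC : (c%:R != 0 :> C) by rewrite pnatr_eq0 -lt0n.
have mC : (m%:R != 0 :> C) by rewrite pnatr_eq0.
have sC i : ((s i)%:R != 0 :> C) by rewrite pnatr_eq0 -lt0n.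
have [kappa hk] := choice (fun hi : 'I_m * 'I_r => @theta1_cusp hi.1 m c (s hi.2) a d (ltn0Sn m0) c0 (s_gt0 hi.2)).
pose S i z : C := sqrtc (- (2 * ci * ((z + d%:~R / c%:R) / (4 * (s i)%:R * m%:R ^+ 2)))).
have [ks ksE] : exists ks : C, ks = sqrtc (- ci) by exists (sqrtc (- ci)).
pose S0 : C := \prod_i ((Num.sqrt (2 / (4 * (s i)%:R * m%:R ^+ 2 * c%:R)))%:C * ks).
have SE z : 0 < Im z -> \prod_i S i z = S0 * sqrtc (c%:R * z + d%:~R) ^+ r.
  move=> z0; have -> x : x ^+ r = \prod_(i < r) x :> C by rewrite prodr_const card_ord.
  rewrite -big_split; apply: eq_bigr => i _ /=.
  have X0 : 0 < Im (c%:R * z + d%:~R).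
    by rewrite ImD Im_int addr0 -[c%:R]/((c%:Z)%:~R) ImM Re_int Im_int mul0r addr0 mulr_gt0 // ltr0z ltz_nat.
  rewrite -[RHS]mulrA ksE -sqrtc_rotation // -sqrtcZ.
    rewrite /S; congr sqrtc; rewrite !RCE; field.
    by rewrite cC sC nat1r mC.
  by rewrite divr_gt0 // !mulr_gt0 ?exprn_gt0 ?ltr0n.
pose pi0 := (\prod_i s i)%N.
have pi0C : (pi0%:R != 0 :> C) by rewrite pnatr_eq0 -lt0n prodn_gt0.
(* A common denominator of the exponents [k_i^2 / (4 s_i m^2)]; [e k] is the numerator of their
   sum. *)
pose h0 := (4 * m ^ 2 * pi0)%N.
pose e (k : 'cV[int]_r) : nat := (\sum_i (`|k i 0%R| ^ 2 * \prod_(j | j != i) s j))%N.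
pose L (h : {ffun 'I_r -> 'I_m}) := [forall i, (m%:Z %| (P *m \col_j (h j : nat)%:Z) i 0%R)%Z].
pose G z : C := \sum_(h | L h) \prod_i (theta1 ((h i : nat)%:R / m%:R) 0 ((s i)%:R * (a%:~R / c%:R - (c%:R * (c%:R * z + d%:~R))^-1)) / S i z).
have GE z : 0 < Im z -> G z * \prod_i S i z = theta ((a%:~R * z + b%:~R) / (c%:R * z + d%:~R)).
  move=> z0; have X0 : c%:R * z + d%:~R != 0.
    by have := @denom_neq0 R c%:Z d z; rewrite eqz_nat -lt0n c0 => /(_ isT z0).
  have gE : (a%:~R * z + b%:~R) / (c%:R * z + d%:~R) = a%:~R / c%:R - (c%:R * (c%:R * z + d%:~R))^-1.
    have detC : b%:~R * c%:R = a%:~R * d%:~R - 1 :> C.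
      by rewrite -[c%:R]/((c%:Z)%:~R) -!intrM -[1 in RHS]/(1%:~R) -intrB -det; congr (_%:~R); ring.
    apply: (mulIf cC); rewrite mulrAC mulrDl detC; field.
    have X0' := X0; rewrite mulrC in X0'; by rewrite ?cC ?X0 ?X0'.
  have g0 : 0 < Im ((a%:~R * z + b%:~R) / (c%:R * z + d%:~R)).
    by have := Im_moebius det X0 => /= ->; rewrite divr_gt0 // exprn_gt0 // cabs_gt0.
  rewrite (lattice_thetaE s_gt0 PQ QP PAP g0) mulr_suml; apply: eq_bigr => h _.
  rewrite -big_split; apply: eq_bigr => i _ /=; rewrite -gE divfK //.
  apply: sector_neq0; apply: sector_sqrt_upper.
  have -> : (z + d%:~R / c%:R) / (4 * (s i)%:R * m%:R ^+ 2) = ((4 * (s i)%:R * m%:R ^+ 2)^-1 : R)%:C * (z + (d%:~R / c%:R : R)%:C).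
    by rewrite !RCE mulrC.
  rewrite ImM Re_real Im_real mul0r addr0 ImD Im_real addr0 mulr_gt0 // invr_gt0.
  by rewrite mulr_gt0 ?exprn_gt0 ?mulr_gt0 // ltr0n.
have S00 : S0 != 0.
  apply/prodf_neq0 => i _; apply: mulf_neq0.
    rewrite eq_complex /= eqxx andbT gt_eqF // sqrtr_gt0 divr_gt0 // !mulr_gt0 ?exprn_gt0 ?ltr0n //.
  rewrite ksE; apply/eqP => /(congr1 (fun x : C => x ^+ 2)); rewrite sqr_sqrtc expr0n => /eqP.
  by rewrite oppr_eq0 -cabs_eq0 cabs_ci oner_eq0.
apply: (@eq_has_expansion (fun z => S0 * G z)) => [z z0|].
  rewrite -(GE z z0) SE //.
  have X0 : sqrtc (c%:R * z + d%:~R) != 0.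
    have X1 : c%:R * z + d%:~R != 0.
      by have := @denom_neq0 R c%:Z d z; rewrite eqz_nat -lt0n c0 => /(_ isT z0).
    by apply: contraNneq X1 => x0; rewrite -[c%:R * z + _]sqr_sqrtc x0 expr0n.
  have := expf_neq0 r X0; move: (sqrtc _ ^+ r) => y y0; field; exact: y0.
apply: has_expansionZ.
have [|a' ha] := @regroup_exponents R _ (fun k : 'cV[int]_r => \sum_(h : {ffun 'I_r -> 'I_m} | L h) \prod_i kappa (h i, i) (k i 0)) e h0 G; last first.
  by exists h0, a'; split=> //; rewrite !muln_gt0 /= prodn_gt0.
move=> z z0.
have hh (h : {ffun 'I_r -> 'I_m}) : has_sum (fun k : 'cV[int]_r => \prod_i (kappa (h i, i) (k i 0) *
    cexp (tpi * ((k i 0)%:~R ^+ 2 * z / (4 * (s i)%:R * m%:R ^+ 2)))))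
   (\prod_i (theta1 ((h i : nat)%:R / m%:R) 0 ((s i)%:R * (a%:~R / c%:R - (c%:R * (c%:R * z + d%:~R))^-1)) / S i z)).
  apply: (has_sum_col (a := fun i n => kappa (h i, i) n * cexp (tpi * (n%:~R ^+ 2 * z / (4 * (s i)%:R * m%:R ^+ 2))))) => i.
  exact: (hk (h i, i) z z0).
have := has_sum_sum (index_enum {ffun 'I_r -> 'I_m}) (P := L) (fun h _ => hh h).
apply: has_sum_ext => k /=; rewrite mulr_suml; apply: eq_bigr => h _.
rewrite big_split /=; congr (_ * _); rewrite -cexp_sum; congr cexp.
rewrite /e natr_sum mulr_sumr !mulr_suml; apply: eq_bigr => i _.
have -> : h0%:R = 4 * m%:R ^+ 2 * ((s i)%:R * (\prod_(j | j != i) s j)%N%:R) :> C.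
  by rewrite /h0 /pi0 (bigD1 i) //= !natrM; ring.
have : ((\prod_(j | j != i) s j)%N%:R != 0 :> C) by rewrite pnatr_eq0 -lt0n prodn_gt0.
move: (\prod_(j | _) _)%N => q q0.
have -> : (`|k i 0%R| ^ 2 * q)%N%:R = (k i 0)%:~R ^+ 2 * q%:R :> C.
  have e2 : (`|k i 0%R| ^ 2)%N%:Z = k i 0 ^+ 2 by rewrite -abszX gez0_abs // sqr_ge0.
  by rewrite natrM -rmorphXn -e2.
field; by rewrite nat1r mC q0 sC.
Qed.

Lemma lattice_theta_cusps (a b c d : int) : a * d - b * c = 1 ->
  has_expansion (fun z => (sqrtc (c%:~R * z + d%:~R) ^+ r)^-1 * theta ((a%:~R * z + b%:~R) / (c%:~R * z + d%:~R))).
Proof.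
move=> det; have [c0|c0|c0] := ltgtP c 0.
- have det' : (- a) * (- d) - (- b) * (`|c|%N)%:Z = 1 by rewrite ltz0_abs // -det; ring.
  have cn : (0 < `|c|)%N by rewrite absz_gt0 lt_eqF.
  have cE : (`|c|%N)%:R = - c%:~R :> C by rewrite -[_%:R]/((`|c|%N%:Z)%:~R) ltz0_abs // mulrNz.
  (* The matrix [- g] moves z in the same way, but multiplies the principal root by i, because
     [c z + d] lies in the lower half-plane; the constant undoes this. *)
  apply: eq_has_expansion (has_expansionZ ((- ci) ^+ r)^-1 (lattice_theta_cusp_pos det' cn)) => z z0.
  have -> : (`|c|%N)%:R * z + (- d)%:~R = - (c%:~R * z + d%:~R) by rewrite cE mulrNz; ring.
  have -> : (- a)%:~R * z + (- b)%:~R = - (a%:~R * z + b%:~R) :> C by rewrite !mulrNz; ring.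
  rewrite invrN mulrNN mulrA; congr (_ * _).
  have ImX : Im (c%:~R * z + d%:~R) = c%:~R * Im z by rewrite ImD ImM Im_int Re_int Im_int mul0r !addr0.
  rewrite sqrtc_opp; last by rewrite ImX mulf_neq0 ?intr_eq0 ?(lt_eqF c0) ?(gt_eqF z0).
  rewrite ifF; last by apply/negbTE; rewrite -leNgt ImX ltW // pmulr_llt0 // ltrz0.
  by rewrite -invfM exprMn mulrA -exprMn mulNr ciM opprK expr1n mul1r.
- have det' : a * d - b * (`|c|%N)%:Z = 1 by rewrite gtz0_abs.
  have cn : (0 < `|c|)%N by rewrite absz_gt0 gt_eqF.
  apply: eq_has_expansion (lattice_theta_cusp_pos det' cn) => z z0.
  by rewrite -[(`|c|%N)%:R]/((`|c|%N%:Z)%:~R) gtz0_abs.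
- move: det; rewrite c0 mulr0 subr0 => det.
  apply: eq_has_expansion (has_expansionZ ((sqrtc d%:~R ^+ r)^-1) lattice_theta_expansion) => z z0.
  rewrite mul0r add0r; congr (_ * _).
  have [[-> ->]|[-> ->]] : (a = 1 /\ d = 1) \/ (a = -1 /\ d = -1).
  + have : (`|a| * `|d| = 1)%N by rewrite -abszM det.
    by move=> /eqP; rewrite muln_eq1 => /andP[/eqP ha /eqP hd]; nia.
  + by rewrite mul1r divr1 (lattice_theta_translate evenA).
  + rewrite mulrNz invrN invr1 mulrN1 mulN1r opprD opprK -[- b%:~R]mulrNz.
    by rewrite (lattice_theta_translate evenA).
Qed.

End CuspExpansion.

(** * The trace form of a totally real field *)

Import passmx.

Section TraceForm.
Variable K : fieldExtType rat.
Local Notation N := (\dim {:K}).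
Local Notation B := (vbasis {:K}).
Local Notation T := (@field_trace K).
Let Bb : basis_of {:K} B := vbasisP {:K}.

Definition regular_mx (x : K) : 'M[rat]_N := mxof B B (amulr x).

Lemma regular_mx_is_linear : linear regular_mx.
Proof. by move=> a x y; rewrite /regular_mx linearP /=; exact: linearP. Qed.
HB.instance Definition _ := GRing.isSemilinear.Build rat K _ _ regular_mx
  (GRing.semilinear_linear regular_mx_is_linear).

Lemma rVof_mul_regular x y : rVof B (x * y) = rVof B x *m regular_mx y.
Proof. by rewrite -rVof_app // lfunE. Qed.

Lemma regular_mxM x y : regular_mx (x * y) = regular_mx x *m regular_mx y.
Proof.
apply/row_matrixP => i; rewrite !rowE mulmxA -(vecofK Bb (delta_mx 0 i)).
by rewrite -!rVof_mul_regular mulrA.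
Qed.

Lemma regular_mx1 : regular_mx 1 = 1%:M.
Proof.
apply/row_matrixP => i; rewrite !rowE -(vecofK Bb (delta_mx 0 i)).
by rewrite -rVof_mul_regular mulr1 mulmx1.
Qed.

Lemma field_traceE x : T x = \tr (regular_mx x). Proof. by []. Qed.

Lemma field_trace_is_linear : linear_for *%R T.
Proof. by move=> a x y; rewrite !field_traceE linearP /= linearP. Qed.
HB.instance Definition _ := GRing.isSemilinear.Build rat K _ _ T
  (GRing.semilinear_linear field_trace_is_linear).

Lemma field_trace1 : T 1 = N%:R.
Proof. by rewrite field_traceE regular_mx1 mxtrace1. Qed.

Definition coordinates k (w : 'I_k -> K) : 'M[rat]_(k, N) := \matrix_i rVof B (w i).

Lemma row_coordinates k (w : 'I_k -> K) i : row i (coordinates w) = rVof B (w i).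
Proof. exact: rowK. Qed.

Lemma coordinates_mul k (w w' : 'I_k -> K) (M : 'M[rat]_k) :
  (forall i, w' i = \sum_j M i j *: w j) -> coordinates w' = M *m coordinates w.
Proof.
move=> h; apply/row_matrixP => i; rewrite row_mul row_coordinates h linear_sum /= mulmx_sum_row.
by apply: eq_bigr => j _; rewrite linearZ /= row_coordinates mxE.
Qed.

Definition gram k (w : 'I_k -> K) : 'M[rat]_k := \matrix_(i, j) T (w i * w j).

Lemma gramE k (w : 'I_k -> K) : gram w = coordinates w *m gram (fun i => B`_i) *m (coordinates w)^T.
Proof.
apply/matrixP => i j; rewrite !mxE.
have wE l : w l = \sum_a coordinates w l a *: B`_a.
  rewrite {1}[w l](coord_basis Bb) ?memvf //; apply: eq_bigr => a _.
  by rewrite !mxE.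
rewrite {1}(wE i) {1}(wE j) mulr_suml linear_sum /=.
under eq_bigr => a _ do rewrite mulr_sumr linear_sum /=.
rewrite exchange_big; apply: eq_bigr => b _ /=; rewrite [X in _ = X * _]mxE mulr_suml; apply: eq_bigr => a _.
rewrite !mxE -scalerAl -scalerAr !linearZ /=; ring.
Qed.

Lemma coordinates_unit (w : 'I_N -> K) : \det (gram w) != 0 -> coordinates w \in unitmx.
Proof.
rewrite gramE !det_mulmx det_tr unitmxE unitfE; apply: contraNneq => ->.
by rewrite mulr0.
Qed.

Lemma field_trace_mx (w : 'I_N -> K) (x : K) (M : 'M[rat]_N) : coordinates w \in unitmx ->
  (forall i, w i * x = \sum_j M i j *: w j) -> T x = \tr M.
Proof.
move=> uw h; have e : coordinates w *m regular_mx x = M *m coordinates w.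
  rewrite -(coordinates_mul h); apply/row_matrixP => i.
  by rewrite row_mul !row_coordinates rVof_mul_regular.
by rewrite field_traceE -[regular_mx x](mulKmx uw) e mxtrace_mulC mulmxK.
Qed.

End TraceForm.

Section TotallyReal.
Variables (R : realType) (K : fieldExtType rat).
Local Notation C := R[i].
Local Notation N := (\dim {:K}).
Local Notation T := (@field_trace K).
Hypothesis realK : totally_real K R.

(** Bundles a plain map into a ring morphism, the form over which [totally_real] quantifies; the
    diagonal entries below come as plain maps. *)
Lemma totally_real_morph (f : K -> C) : {morph f : x y / x + y} -> {morph f : x y / x * y} -> f 1 = 1 ->
  forall x, complex.Im (f x) = 0.
Proof.
move=> fD fM f1 x.
have f0 : f 0 = 0 by apply: (addrI (f 0)); rewrite -fD !addr0.
have fB : {morph f : x y / x - y}.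
  move=> u v; have fN : f (- v) = - f v by apply: (addrI (f v)); rewrite -fD !subrr.
  by rewrite fD fN.
pose Z := GRing.isZmodMorphism.Build _ _ f fB.
pose M := GRing.isMonoidMorphism.Build _ _ f (f1, fM).
pose F : {rmorphism K -> C} := HB.pack f Z M.
exact: (realK F x).
Qed.

Lemma comm_regular (x y : K) : map_mx (ratr : rat -> C) (regular_mx x) *m map_mx ratr (regular_mx y) =
  map_mx ratr (regular_mx y) *m map_mx ratr (regular_mx x).
Proof. by rewrite -!map_mxM -!regular_mxM mulrC. Qed.

(** The commuting matrices of the regular representation are triangularized together over C. Each
    diagonal entry is then a ring morphism from K to C, hence real-valued, and the trace of [x^2] is
    a sum of squares of nonzero reals. *)
Lemma field_trace_sqr_gt0 (x : K) : x != 0 -> 0 < T (x ^+ 2).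
Proof.
move=> x0; pose rho (y : K) : 'M[C]_N := map_mx ratr (regular_mx y).
have [|P uP /allP trigP] := @cotrigonalization C N [seq rho (vbasis {:K})`_(nat_of_ord i) | i <- enum 'I_N].
  by move=> _ _ /mapP[i _ ->] /mapP[j _ ->]; exact: comm_regular.
have Pu : P \in unitmx by exact: unitarymx_unit.
pose rho' y := P *m rho y *m invmx P.
have rhoD y z : rho' (y + z) = rho' y + rho' z.
  by rewrite /rho' /rho linearD /= map_mxD mulmxDr mulmxDl.
have rhoM y z : rho' (y * z) = rho' y *m rho' z.
  by rewrite /rho' /rho regular_mxM map_mxM !mulmxA mulmxKV.
have rho1 : rho' 1 = 1%:M by rewrite /rho' /rho regular_mx1 map_mx1 mulmx1 mulmxV.
have trig y : is_trig_mx (rho' y).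
  have -> : rho' y = \sum_i ratr (coord (vbasis {:K}) i y) *: rho' (vbasis {:K})`_i.
    rewrite {1}(coord_basis (vbasisP {:K}) (memvf y)) /rho' /rho linear_sum /= map_mx_sum mulmx_sumr mulmx_suml.
    by apply: eq_bigr => i _; rewrite linearZ /= map_mxZ -scalemxAr -scalemxAl.
  apply/is_trig_mxP => i j ij; rewrite summxE big1 // => k _; rewrite mxE.
  have := trigP (rho (vbasis {:K})`_k) (map_f _ (mem_enum _ k)).
  by rewrite /= /similar_to conjumx // => /is_trig_mxP /(_ i j ij); rewrite /rho' => ->; rewrite mulr0.
have trE y : ratr (T y) = \tr (rho' y).
  rewrite /rho' mxtrace_mulC mulKmx // /rho field_traceE -[RHS]/(\tr (map_mx ratr _)).
  by rewrite /mxtrace rmorph_sum; apply: eq_bigr => i _; rewrite [RHS]mxE.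
clearbody rho'.
have diagM i y z : rho' (y * z) i i = rho' y i i * rho' z i i.
  rewrite rhoM mxE (bigD1 i) //= big1 ?addr0 // => k ki.
  have [ik|ik] := ltnP i k; first by rewrite (is_trig_mxP (trig y) i k ik) mul0r.
  have {}ik : (k < i)%N by rewrite ltn_neqAle ik andbT.
  by rewrite (is_trig_mxP (trig z) k i ik) mulr0.
have diag_real i y : complex.Im (rho' y i i) = 0.
  apply: (@totally_real_morph (fun y => rho' y i i)) => [u v|u v|]; last by rewrite rho1 mxE eqxx.
    by rewrite rhoD [LHS]mxE.
  exact: diagM.
have : 0 < ratr (T (x ^+ 2)) :> C.
  rewrite trE /mxtrace.
  have pos i : 0 < rho' (x ^+ 2) i i.
    have xi : rho' x i i != 0.
      have : rho' (x * x^-1) i i != 0 by rewrite divff // rho1 mxE eqxx oner_eq0.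
      by rewrite diagM; apply: contraNneq => ->; rewrite mul0r.
    rewrite expr2 diagM; move: xi (diag_real i x); case: (rho' x i i) => a b /= ab b0.
    rewrite b0 in ab *; rewrite ltcE /= !mulr0 !mul0r addr0 subr0 eqxx /=.
    rewrite -expr2 exprn_even_gt0 //=; apply: contraNneq ab => ->; by rewrite eq_complex /= eqxx.
  have N0 : (0 < N)%N by exact: adim_gt0.
  rewrite (bigD1 (Ordinal N0)) //= ltr_wpDr ?pos // sumr_ge0 // => i _; exact: ltW.
by rewrite ltr0q.
Qed.

End TotallyReal.

(** * The lattice of trace-zero integers *)

Section TraceZeroLattice.
Variables (K : fieldExtType rat).
Local Notation T := (@field_trace K).

(** The witness is the matrix of multiplication by x in the integral basis; its square is the matrix
    of [x^2]. *)
Lemma integral_trace n (w : 'I_n -> K) : \dim {:K} = n -> integral_basis w -> \det (gram w) != 0 ->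
  forall x, algebraic_integer x ->
  exists M : 'M[int]_n, T x = (\tr M)%:~R /\ T (x ^+ 2) = (\tr (M *m M))%:~R.
Proof.
move=> dimK; case: n / dimK w => w [wint wbasis] dw x xint.
have uw := coordinates_unit dw.
have [M hM] : exists M : 'M[int]_(\dim {:K}), forall i, w i * x = \sum_j w j *~ M i j.
  have h i : exists c : {ffun 'I_(\dim {:K}) -> int}, w i * x = \sum_j w j *~ c j.
    by have [c [hc _]] := wbasis _ (integral_mul (wint i) xint); exists c.
  have [c hc] := choice h.
  by exists (\matrix_(i, j) c i j) => i; rewrite hc; apply: eq_bigr => j _; rewrite mxE.
have hM' i : w i * x = \sum_j (map_mx intr M) i j *: w j.
  by rewrite hM; apply: eq_bigr => j _; rewrite mxE scaler_int.
have trm (M' : 'M[int]_(\dim {:K})) : \tr (map_mx intr M') = (\tr M')%:~R :> rat.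
  by rewrite /mxtrace rmorph_sum; apply: eq_bigr => j _; rewrite mxE.
exists M; split; first by rewrite (field_trace_mx uw hM') trm.
rewrite -trm; apply: (field_trace_mx uw) => i.
rewrite expr2 mulrA hM' mulr_suml.
under eq_bigr => j _ do rewrite -scalerAl hM' scaler_sumr.
rewrite exchange_big; apply: eq_bigr => k _ /=; rewrite map_mxM mxE scaler_suml.
by apply: eq_bigr => j _; rewrite scalerA.
Qed.

(** Off-diagonal products occur in equal pairs, as do the cross terms of the square of the trace.
    For trace zero this gives the evenness of the trace form. *)
Lemma tr_sqr_parity n (M : 'M[int]_n) : (2 %| \tr (M *m M) - \tr M ^+ 2)%Z.
Proof.
elim: n M => [|n IH] M; first by rewrite /mxtrace !big_ord0 expr0n subr0.
pose M' : 'M[int]_(1 + n) := M.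
have -> : \tr (M *m M) - \tr M ^+ 2 = \tr (M' *m M') - \tr M' ^+ 2 by [].
rewrite -(submxK M'); move: (ulsubmx M') (ursubmx M') (dlsubmx M') (drsubmx M') => a b c d.
rewrite mulmx_block !mxtrace_block !mxtraceD (mxtrace_mulC c b).
have tr1 (X : 'M[int]_1) : \tr X = X 0 0 by rewrite /mxtrace big_ord1.
rewrite !tr1 [(a *m a) 0 0]mxE big_ord1.
have -> : a 0 0 * a 0 0 + (b *m c) 0 0 + ((b *m c) 0 0 + \tr (d *m d)) - (a 0 0 + \tr d) ^+ 2 =
   (\tr (d *m d) - \tr d ^+ 2) + 2 * ((b *m c) 0 0 - a 0 0 * \tr d) by ring.
by apply: rpredD; [exact: IH | exact: dvdz_mulr].
Qed.

Lemma even_trace_sqr n (w : 'I_n -> K) : \dim {:K} = n -> integral_basis w -> \det (gram w) != 0 ->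
  forall x, algebraic_integer x -> T x = 0 -> exists t : int, T (x ^+ 2) = (2 * t)%:~R.
Proof.
move=> dimK bw dw x xint Tx; have [M [M1 M2]] := integral_trace dimK bw dw xint.
have /dvdzP[t ht] := tr_sqr_parity M.
have M0 : \tr M = 0 by apply/eqP; rewrite -(intr_eq0 rat) -M1 Tx.
by exists t; rewrite M2 mulrC -ht M0 expr0n subr0.
Qed.

End TraceZeroLattice.

Section TraceZeroBasis.
Variables (K : fieldExtType rat) (r : nat) (w : 'I_r.+1 -> K) (d : int).
Local Notation T := (@field_trace K).
Hypothesis dimK : \dim {:K} = r.+1.
Hypothesis w_basis : integral_basis w.
Hypothesis gram_w : \det (gram w) = d%:~R.
Hypothesis d_neq0 : d != 0.
Hypothesis cop : coprimez r.+1%:Z d.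

Let gw0 : \det (gram w) != 0. Proof. by rewrite gram_w intr_eq0. Qed.

Lemma trace_int x : algebraic_integer x -> exists t : int, T x = t%:~R.
Proof. by move=> xi; have [M [-> _]] := integral_trace dimK w_basis gw0 xi; exists (\tr M). Qed.

Lemma algebraic_integer_int (z : int) : algebraic_integer (z%:~R : K).
Proof.
exists ('X - z%:P); first exact: monicXsubC.
by rewrite map_polyXsubC root_XsubC.
Qed.

Definition combination k (u : 'I_k -> K) (c : 'cV[int]_k) : K := \sum_i u i *~ c i 0.

Lemma combinationE k (u : 'I_k -> K) c : combination u c = \sum_i ((c i 0)%:~R : rat) *: u i.
Proof. by apply: eq_bigr => i _; rewrite scaler_int. Qed.

Lemma combination_integral k (u : 'I_k -> K) c : (forall i, algebraic_integer (u i)) -> algebraic_integer (combination u c).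
Proof.
move=> ui; rewrite /combination; elim/big_ind: _ => [|x y|i _].
- exact: (algebraic_integer_int 0).
- exact: integral_add.
- by rewrite -mulrzr; exact: (integral_mul (ui i) (algebraic_integer_int (c i 0))).
Qed.

Lemma combination_delta k (u : 'I_k -> K) i : combination u (delta_mx i 0) = u i.
Proof.
rewrite /combination (bigD1 i) //= big1 ?addr0 => [|j /negbTE ji]; first by rewrite mxE !eqxx mulr1z.
by rewrite mxE ji mulr0z.
Qed.

Lemma combination_mul k l (u : 'I_k -> K) (M : 'M[int]_(k, l)) (c : 'cV[int]_l) :
  combination (fun j => combination u (col j M)) c = combination u (M *m c).
Proof.
rewrite !combinationE; under eq_bigr => i _ do rewrite combinationE scaler_sumr.
rewrite exchange_big; apply: eq_bigr => j _ /=; rewrite mxE rmorph_sum scaler_suml.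
by apply: eq_bigr => i _; rewrite scalerA !mxE -intrM mulrC.
Qed.

Lemma trace_combination k (u : 'I_k -> K) (G : 'M[int]_k) c c' : (forall i j, T (u i * u j) = (G i j)%:~R) ->
  T (combination u c * combination u c') = ((c^T *m G *m c') 0 0)%:~R.
Proof.
move=> hG; rewrite !combinationE mulr_suml linear_sum mxE rmorph_sum /=.
under eq_bigr => i _ do rewrite mulr_sumr linear_sum /=.
rewrite exchange_big; apply: eq_bigr => j _ /=; rewrite mxE mulr_suml rmorph_sum; apply: eq_bigr => i _ /=.
rewrite -scalerAl -scalerAr !linearZ /= hG !intrM !mxE; ring.
Qed.

Lemma trace_combination1 k (u : 'I_k -> K) c : T (combination u c) = \sum_i (c i 0)%:~R * T (u i).
Proof. by rewrite combinationE linear_sum; apply: eq_bigr => i _; rewrite linearZ. Qed.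

Lemma delta_form k (G : 'M[int]_k) (i : 'I_k) (c : 'cV[int]_k) : ((delta_mx i 0 : 'cV[int]_k)^T *m G *m c) 0 0 = (G *m c) i 0.
Proof. by rewrite trmx_delta -mulmxA -rowE mxE. Qed.

(** Smith normal form of the column of traces of an integral basis: after a unimodular change only
    [v 0] can have nonzero trace, so that trace zero becomes a condition on one coordinate. *)
Lemma adapted_basis : exists (v : 'I_r.+1 -> K) (G : 'M[int]_r.+1) (g : int),
  [/\ (forall i, algebraic_integer (v i)),
      (forall x, algebraic_integer x -> exists! c, x = combination v c),
      (forall i, T (v i) = (if i == 0 then g else 0)%:~R),
      (forall i j, T (v i * v j) = (G i j)%:~R) & \det G = d].
Proof.
have [wint wb] := w_basis.
have [tau htau] := choice (fun i => trace_int (wint i)).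
have [G0 hG0] := choice (fun ij : 'I_r.+1 * 'I_r.+1 => trace_int (integral_mul (wint ij.1) (wint ij.2))).
have [L uL [S uS [ds _ tauE]]] := int_Smith_normal_form (\col_(i < r.+1) tau i).
pose U := invmx L; have UL : U *m L = 1%:M by rewrite mulVmx.
have LU : L *m U = 1%:M by rewrite mulmxV.
pose v i := combination w (matrix.col i U^T).
have combE c : combination v c = combination w (U^T *m c) by exact: combination_mul.
pose Gm : 'M[int]_r.+1 := \matrix_(i, j) G0 (i, j).
have hGm i j : T (w i * w j) = (Gm i j)%:~R by rewrite mxE -hG0.
exists v, (U *m Gm *m U^T), (ds`_0 * S 0 0); split.
- by move=> i; exact: combination_integral.
- move=> x xi; have [c [hc cu]] := wb x xi.
  exists (L^T *m \col_i c i); split.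
    rewrite combE mulmxA -trmx_mul LU trmx1 mul1mx hc.
    by apply: eq_bigr => i _; rewrite mxE.
  move=> c' hc'; rewrite combE in hc'.
  have e : c = [ffun i => (U^T *m c') i 0].
    by apply: cu; rewrite hc'; apply: eq_bigr => i _; rewrite ffunE.
  have -> : \col_i c i = U^T *m c' by apply/matrixP => i j; rewrite e mxE ffunE (ord1 j).
  by rewrite mulmxA -trmx_mul UL trmx1 mul1mx.
- move=> i; rewrite trace_combination1.
  have -> : (if i == 0 then ds`_0 * S 0 0 else 0) = (U *m \col_i tau i) i 0.
    rewrite tauE !mulmxA UL mul1mx mxE big_ord1 mxE.
    case: (eqVneq i 0) => [->|i0]; first by rewrite eqxx mulr1n.
    have -> : (nat_of_ord i == nat_of_ord ord0) = false := negbTE i0.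
    by rewrite mulr0n mul0r.
  rewrite mxE rmorph_sum; apply: eq_bigr => j _ /=.
  by rewrite htau !mxE intrM.
- move=> i j; rewrite (trace_combination _ _ hGm); congr (_%:~R).
  have -> : (matrix.col i U^T)^T = row i U by rewrite tr_col trmxK.
  rewrite -row_mul [LHS]mxE [RHS]mxE; apply: eq_bigr => k _.
  by rewrite [row _ _ _ _]mxE [matrix.col _ _ _ _]mxE.
- rewrite !det_mulmx det_tr mulrAC.
  have : \det U ^+ 2 = 1.
    have : `|\det U|%N = 1%N.
      have := congr1 determinant UL; rewrite det_mulmx det1 => /(congr1 absz).
      by rewrite abszM => /eqP; rewrite muln_eq1 => /andP[/eqP].
    by clear; nia.
  rewrite expr2 => ->; rewrite mul1r; apply/eqP; rewrite -(eqr_int rat) -gram_w; apply/eqP.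
  have <- : map_mx intr Gm = gram w by apply/matrixP => i j; rewrite [LHS]mxE [RHS]mxE hGm.
  by rewrite det_map_mx.
Qed.

Lemma trace_zero_basis : exists (u : 'I_r -> K) (A : 'M[int]_r),
  [/\ (forall c, trace_zero_integers K (combination u c)),
      (forall x, trace_zero_integers K x -> exists! c, x = combination u c),
      (forall c, T (combination u c ^+ 2) = (lattice_norm A c)%:~R),
      A^T = A & \det A = r.+1%:Z * d].
Proof.
have [v [G [g [vint vb vT vG detG]]]] := adapted_basis.
have one_int : algebraic_integer (1 : K) by exact: (algebraic_integer_int 1).
have [e [eE _]] := vb 1 one_int.
have Tv c : T (combination v c) = (c 0 0 * g)%:~R.
  rewrite trace_combination1 (bigD1 0) //= big1 ?addr0 => [|i /negbTE i0]; first by rewrite vT eqxx intrM.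
  by rewrite vT i0 mulr0.
(* Pairing the expansion of 1 with [v i] gives the trace of [v i]. Multiplied by the adjugate, this
   yields [dej]. *)
have Ge : G *m e = g *: delta_mx 0 0.
  apply/matrixP => i j; rewrite (ord1 j); apply/eqP; rewrite -(eqr_int rat); apply/eqP.
  rewrite -delta_form -(trace_combination _ _ vG) combination_delta -eE mulr1 vT !mxE eqxx andbT.
  by case: (i == 0); rewrite ?mulr1 ?mulr0.
have ne : r.+1%:Z = e 0 0 * g.
  by apply/eqP; rewrite -(eqr_int rat) -Tv -eE field_trace1 dimK.
have dej j : d * e j 0 = g * \adj G j 0.
  have := congr1 (mulmx (\adj G)) Ge; rewrite mulmxA mul_adj_mx detG mul_scalar_mx -scalemxAr -colE.
  by move=> /matrixP/(_ j 0); rewrite !mxE.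
(* Since g divides n it is prime to d, so by [dej] it divides every coordinate of 1, and [1 = g y]
   with y integral. The trace of [1 = g^k y^k] then shows that [g^k] divides n for every k, which
   forces g to be 1 or -1. *)
have g1 : `|g|%N = 1%N.
  have gn : (g %| r.+1%:Z)%Z by rewrite ne dvdz_mull.
  have gd : coprimez g d.
    by move: cop gn; rewrite /coprimez /gcdz dvdzE !eqz_nat => c' gn; exact: coprime_dvdl gn c'.
  have ge j : (g %| e j 0%R)%Z.
    by rewrite -(Gauss_dvdzr _ gd) dej dvdz_mulr.
  pose y := combination v (\col_j (e j 0%R %/ g)%Z).
  have yint : algebraic_integer y by exact: combination_integral.
  have gy : 1 = (g%:~R : rat) *: y.
    rewrite eE /y !combinationE scaler_sumr; apply: eq_bigr => i _; rewrite scalerA -intrM !mxE.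
    by have := ge i; rewrite dvdz_eq mulrC => /eqP ->.
  have gyk k : (1 : K) = (g ^+ k)%:~R *: y ^+ k.
    by rewrite rmorphXn /= -exprZn -gy expr1n.
  have yk k : algebraic_integer (y ^+ k).
    by elim: k => [|k IH]; rewrite ?expr0 ?exprS //; exact: integral_mul.
  have gk k : (`|g| ^ k %| r.+1)%N.
    have [t ht] := trace_int (yk k).
    have : r.+1%:Z = g ^+ k * t.
      apply/eqP; rewrite -(eqr_int rat) intrM -ht -linearZ /= -gyk field_trace1 dimK //.
    by move=> /(congr1 absz); rewrite abszM abszX /= => ->; rewrite dvdn_mulr.
  have g0 : (0 < `|g|)%N.
    by rewrite absz_gt0; apply/eqP => gz; move: ne; rewrite gz mulr0.
  have := dvdn_leq (ltn0Sn r) (gk r.+1).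
  have := @ltn_expl `|g|%N r.+1.
  by case: (ltngtP `|g|%N 1%N) => [|_ h1 h2|//]; [lia|have := h1 isT; rewrite ltnNge h2].
have g0 : g != 0 by rewrite -absz_eq0 g1.
pose u i := v (lift ord0 i); pose A : 'M[int]_r := row' 0 (col' 0 G).
have uG i j : T (u i * u j) = (A i j)%:~R by rewrite vG !mxE.
pose ext (c : 'cV[int]_r) : 'cV[int]_r.+1 := \col_i (if unlift ord0 i is Some j then c j 0 else 0).
have uE c : combination u c = combination v (ext c).
  rewrite [RHS]/combination big_ord_recl mxE unlift_none mulr0z add0r.
  by apply: eq_bigr => i _; rewrite mxE liftK.
exists u, A; split.
- move=> c; split; first by apply: combination_integral => i; exact: vint.
  by rewrite uE Tv mxE unlift_none mul0r.
- move=> x [xint Tx]; have [c [cE cu]] := vb x xint.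
  have c0 : c 0 0 = 0.
    apply/eqP; move: Tx; rewrite cE Tv => /eqP; rewrite intr_eq0 mulf_eq0 => /orP[//|].
    by rewrite (negbTE g0).
  have ce : c = ext (\col_i c (lift ord0 i) 0).
    apply/matrixP => i j; rewrite (ord1 j) mxE; case: unliftP => [k ->|->]; last exact: c0.
    by rewrite mxE.
  exists (\col_i c (lift ord0 i) 0); split; first by rewrite uE -ce.
  move=> c'; rewrite uE => /cu ec; apply/matrixP => i j; rewrite mxE ec mxE liftK (ord1 j) //.
- by move=> c; rewrite expr2 (trace_combination _ _ uG).
- by apply/matrixP => i j; rewrite mxE; apply/eqP; rewrite -(eqr_int rat) -!uG mulrC.
(* [A] is the minor of [G] at (0, 0), so its determinant is the entry of the adjugate that [dej 0]
   computes. *)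
- have := dej 0; rewrite mxE /cofactor expr0 mul1r -/A => h.
  have g2 : g * g = 1 by clear -g1; nia.
  transitivity (g * (g * \det A)); first by rewrite mulrA g2 mul1r.
  by rewrite -h ne; ring.
Qed.

End TraceZeroBasis.

Section Summability.
Import finmap.
Variable R : realType.
Local Notation C := R[i].

Lemma has_sum_summability (I : choiceType) (a : I -> C) s : has_sum a s ->
  summability.sum (a : I -> C^o) = s.
Proof.
move=> h; apply: cvg_lim; [exact: norm_hausdorff|exact: totally_filter|].
have tf := @totally_filter I.
apply/cvgrPdist_lt => e /complex_pos[x x0 ->].
have [F uF hF] := h x x0.
exists [fset i in F]%fset => // B /= FB.
rewrite distrC cabs_lt_norm /partial_sum -(big_seq_fsetE _ _ xpredT a).
apply: hF; first exact: fset_uniq.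
by move=> i iF; apply: (fsubsetP FB); rewrite !inE.
Qed.

End Summability.

(** * Kronecker characters and the multiplier *)

Section Characters.
Variable R : realType.
Local Notation C := R[i].

Lemma kronecker_character_dirichlet (N a : int) :
  (forall m, coprimez m N -> odd `|m| /\ coprimez a m) ->
  (forall m, coprimez m N -> kronecker a (m + N) = kronecker a m) ->
  dirichlet_character N (kronecker_character R N a).
Proof.
move=> Ha Hp; split.
- move=> m; rewrite /kronecker_character; case: ifP => [cm|_]; last by rewrite eqxx.
  have [om am] := Ha m cm; have := kronecker_sqr om am.
  by rewrite intr_eq0; case: eqP => // ->; rewrite expr0n.
- move=> m m'; rewrite /kronecker_character coprimezMl.
  case: ifP => [/andP[cm cm']|/negbT]; last by rewrite negb_and; case: ifP => //=; rewrite ?mul0r // => _ /negbTE ->; rewrite mulr0.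
  by rewrite cm cm' kronecker_mulr ?intrM //; [case: (Ha m cm)|case: (Ha m' cm')].
- move=> m; rewrite /kronecker_character.
  have -> : coprimez (m + N) N = coprimez m N.
    by rewrite /coprimez ![gcdz _ N]gcdzC addrC gcdzDl.
  by case: ifP => // cm; rewrite Hp.
Qed.

Lemma dirichlet_character_periodic (N : int) (chi : int -> C) m k : dirichlet_character N chi -> chi (m + N * k) = chi m.
Proof.
case=> _ _ per; elim/int_rec: k => [|k IH|k IH]; first by rewrite mulr0 addr0.
  by rewrite intS mulrDr mulr1 addrCA addrC per.
by rewrite -per -[RHS]IH intS opprD mulrDr mulrN1; congr chi; ring.
Qed.

Lemma kronecker_mul4 (a m : int) : 0 < a -> odd `|m| -> kronecker (4 * a) m = kronecker a m.
Proof.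
move=> a0 om; rewrite !kronecker_jacobi // jacobi_mull //.
have -> : 4 * a < 0 = false by lia.
have -> : a < 0 = false by lia.
have -> : jacobi 4 `|m|%N = 1.
  by rewrite (_ : 4 = 2 ^+ 2) // jacobi_expl // jacobi_sqr // coprime2n.
by rewrite mul1r.
Qed.

Lemma kronecker_N1 (m : int) : odd `|m| -> 0 < m -> kronecker (-1) m = chi4z m.
Proof. by move=> om m0; rewrite kronecker_pos // jacobiN1 // chi4zE // ltNge ltW // mul1r. Qed.

Lemma kronecker_expl (a m : int) k : odd `|m| -> 0 < m -> kronecker (a ^+ k) m = kronecker a m ^+ k.
Proof. by move=> om m0; rewrite !kronecker_pos // jacobi_expl. Qed.

Lemma epsilonV_sqr (m : int) : ((epsilon R m)^-1) ^+ 2 = (chi4z m)%:~R.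
Proof.
rewrite /epsilon /chi4z; case: ifP => _; first by rewrite invr1 expr1n.
by rewrite -/(ci : C) ciV sqrrN expr2 ciM.
Qed.

Lemma epsilon_mod4 (c d t : int) : (4 %| c)%Z -> epsilon R (d + c * t) = epsilon R d.
Proof.
case/dvdzP=> q ->; rewrite /epsilon.
by have -> : (d + q * 4 * t == 1 %[mod 4])%Z = (d == 1 %[mod 4])%Z by lia.
Qed.

End Characters.

Section TraceZeroTheta.
Variables (R : realType) (K : fieldExtType rat) (r : nat) (d : int).
Local Notation C := R[i].
Local Notation Im := complex.Im.
Local Notation T := (@field_trace K).

(** Summability is a premise of the last clause because it comes from a diagonalization of A, chosen
    afterwards. *)
Lemma trace_zero_theta : \dim {:K} = r.+1 -> totally_real K R -> is_discriminant K d -> d != 0 ->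
  coprimez r.+1%:Z d ->
  exists A : 'M[int]_r, [/\ A^T = A, (forall x, x != 0 -> 0 < lattice_norm A x),
    (forall x, (2 %| lattice_norm A x)%Z), \det A = r.+1%:Z * d &
    forall z, 0 < Im z -> has_sum (@lattice_term R r A z) (@lattice_theta R r A z) -> theta R K z = @lattice_theta R r A z].
Proof.
move=> dimK realK disc d0 cop.
have [w wb dw] : exists2 w : 'I_r.+1 -> K, integral_basis w & d%:~R = \det (gram w).
  by case: disc; rewrite -dimK => w wb dw; exists w.
have gw0 : \det (gram w) != 0 by rewrite -dw intr_eq0.
have [u [A [u0 ub uA symA detA]]] := trace_zero_basis dimK wb (esym dw) d0 cop.
exists A; split => //.
- move=> x x0; rewrite -(ltr0z rat) -uA; apply: (field_trace_sqr_gt0 realK).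
  apply: contraNneq x0 => ux.
  have [c [_ cu]] := ub _ (u0 x); rewrite -(cu x) //; apply/eqP/cu.
  by rewrite ux /combination big1 // => i _; rewrite mxE mulr0z.
- move=> x; have [xi Tx] := u0 x; have [t ht] := even_trace_sqr dimK wb gw0 xi Tx.
  move: ht; rewrite uA => /eqP; rewrite eqr_int => /eqP ->; exact: dvdz_mulr.
move=> z z0 hs; apply: has_sum_summability.
have [e he] := choice (fun x : trace_zero_integers K => ub (val x) (set_valP x)).
pose f (c : 'cV[int]_r) : trace_zero_integers K := SigSub (mem_set (u0 c)).
have ef : cancel e f.
  move=> x; apply: val_inj; rewrite /=; by have [<- _] := he x.
have fe : cancel f e.
  by move=> c; have [_ ec] := he (f c); rewrite (ec c).
apply: has_sum_ext (has_sum_bij ef fe hs) => x /=.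
have [xE _] := he x; rewrite [in RHS]xE uA ratr_int /lattice_term; congr cexp.
Qed.

End TraceZeroTheta.

Lemma det_mx2 (g : 'M[int]_2) : \det g = g 0 0 * g 1 1 - g 0 1 * g 1 0.
Proof.
rewrite (expand_det_row _ 0) !big_ord_recl big_ord0 /cofactor !det_mx11 !mxE /= addr0.
have E (i j i' j' : 'I_2) : val i = val i' -> val j = val j' -> g i j = g i' j'.
  by move=> /val_inj -> /val_inj ->.
rewrite (E 0 ord0 0 0) // (E (lift 0 0) (lift ord0 0) 1 1) // (E 0 (lift ord0 ord0) 0 1) //.
rewrite (E (lift 0 0) (lift (lift ord0 ord0) 0) 1 0) // expr0 expr1; ring.
Qed.

Lemma diagonalized_form r (A : 'M[int]_r) : A^T = A -> (forall x, x != 0 -> 0 < lattice_norm A x) ->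
  exists (m0 : nat) (P Q : 'M[int]_r) (s : 'I_r -> nat), [/\ (forall i, (0 < s i)%N),
    P *m Q = (m0.+1%:Z)%:M, Q *m P = (m0.+1%:Z)%:M & P^T *m A *m P = diag_mx (\row_i (2 * s i)%N%:Z)].
Proof.
move=> symA posA; have [P [s [dP PAP s0]]] := integral_diagonalization symA posA.
(* Doubling P turns the diagonal entries into [4 s_i = 2 (2 s_i)]. Q is the adjugate with the sign
   of the determinant, so that the scalar m is positive. *)
pose P2 := 2%:Z *: P; have dP2 : \det P2 != 0 by rewrite detZ mulf_neq0 // expf_neq0.
have dE : sgz (\det P2) * \det P2 = (`|\det P2|%N.-1.+1)%:Z.
  by rewrite prednK ?absz_gt0 // abszEsg.
exists `|\det P2|%N.-1, P2, (sgz (\det P2) *: \adj P2), (fun i => 2 * `|s i|)%N; split.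
- by move=> i; rewrite muln_gt0 absz_gt0 gt_eqF.
- by rewrite -scalemxAr mul_mx_adj -dE scale_scalar_mx.
- by rewrite -scalemxAl mul_adj_mx -dE scale_scalar_mx.
have -> : P2^T = 2%:Z *: P^T by rewrite linearZ.
rewrite -!scalemxAl -scalemxAr PAP scalerA; apply/matrixP => i j; rewrite !mxE.
by rewrite mulrnAr; congr (_ *+ _); rewrite !PoszM gtz0_abs // mulrA.
Qed.

Section Main.
Variable R : realType.
Local Notation C := R[i].
Local Notation Im := complex.Im.

Lemma fundamental_discriminant_neq0 D : fundamental_discriminant D -> D != 0.
Proof.
case=> [[D1 _]|[m [-> _ m23]]]; first by apply/eqP => D0; move: D1; rewrite D0.
by apply/eqP => m0; case: m23 => h; lia.
Qed.

(** For odd n the modulus is [2 a] up to sign, with a congruent to 1 or 0 modulo 4 according to the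
    shape of the fundamental discriminant; for even n it is [4 a]. Each case has its own period
    lemma. *)
Lemma delta_character (r : nat) (d : int) : fundamental_discriminant d -> coprimez r.+1%:Z d -> 0 < r.+1%:Z * d ->
  dirichlet_character (2 * r.+1%:Z * d) (kronecker_character R (2 * r.+1%:Z * d) (delta_mul r.+1 d)).
Proof.
move=> fund cop D0; have d0 : 0 < d by rewrite -(pmulr_rgt0 d (ltn0Sn r : 0 < r.+1%:Z)).
set N := 2 * r.+1%:Z * d; set a := delta_mul r.+1 d.
have aN : (a %| N)%Z.
  rewrite /a /delta_mul; case: ifP => rodd.
    by apply/dvdzP; exists ((-1) ^+ (r.+1.-1)./2 * 2); rewrite /N -signr_odd; case: odd; rewrite ?expr1 ?expr0; ring.
  apply/dvdzP; exists 4; rewrite /N.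
  have -> : r.+1%:Z = 2 * (r.+1./2)%:Z by have := odd_double_half r.+1; rewrite rodd; lia.
  by ring.
have codd m : coprimez m N -> odd `|m|.
  rewrite /N -mulrA coprimezMr => /andP[c2 _].
  by move: c2; rewrite /coprimez /gcdz eqz_nat -[_ == _]/(coprime _ _) coprimen2.
have ca m : coprimez m N -> coprimez a m.
  by rewrite coprimez_sym; move: aN; rewrite dvdzE /coprimez /gcdz !eqz_nat; exact: coprime_dvdl.
apply: kronecker_character_dirichlet => m cm; first by split; [exact: codd|exact: ca].
have om := codd m cm; have am := ca m cm.
have a0 : a != 0.
  by apply: contraTneq aN => ->; rewrite dvd0z /N -mulrA mulf_neq0 // gt_eqF.
have [rodd|reven] := boolP (odd r.+1).
  have [e Na] : exists e : int, N = 2 * a * e.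
    exists ((-1) ^+ (r.+1.-1)./2); rewrite /N /a /delta_mul rodd -signr_odd.
    by case: odd; rewrite ?expr1 ?expr0; ring.
  (* A fundamental discriminant is 1 modulo 4 or divisible by 4, and [(-1) ^ ((n - 1) / 2) * n] is 1
     modulo 4 for odd n. *)
  have a14 : (a == 1 %[mod 4])%Z \/ (4 %| a)%Z.
    rewrite /a /delta_mul rodd; case: fund => [[d1 _]|[m' [-> _ _]]]; [left|right].
      have : ((-1) ^+ (r.+1.-1)./2 * r.+1%:Z == 1 %[mod 4])%Z.
        rewrite -signr_odd /=; have := odd_double_half r; rewrite /= in rodd.
        by have := odd_double_half r./2; case: (odd r./2); rewrite ?expr1 ?expr0; lia.
      by move=> /eqP xe; apply/eqP; rewrite -modzMm xe d1.
    by apply/dvdzP; exists ((-1) ^+ (r.+1.-1)./2 * r.+1%:Z * m'); ring.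
  case: a14 => ha; first by rewrite Na kronecker_period1.
  by rewrite Na (_ : 2 * a * e = a * (2 * e)) ?kronecker_period4 //; ring.
have rE : r.+1%:Z = 2 * (r.+1./2)%:Z by have := odd_double_half r.+1; rewrite (negbTE reven); lia.
have aE : a = (r.+1./2)%:Z * d by rewrite /a /delta_mul (negbTE reven).
have ap : 0 < a by rewrite aE mulr_gt0 // ltz_nat; have := odd_double_half r.+1; rewrite (negbTE reven); lia.
have NE : N = 4 * a by rewrite /N rE aE; ring.
have omN : odd `|(m + N)%R| by rewrite NE; lia.
(* The factor 4 does not change the symbol at odd entries, and it brings [4 * a], the modulus
   itself, within reach of [kronecker_period4]. *)
rewrite -(kronecker_mul4 ap om) -(kronecker_mul4 ap omN) NE.
have := @kronecker_period4 (4 * a) m 1; rewrite mulr1; apply => //.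
- by rewrite mulf_neq0.
- exact: dvdz_mulr.
- by rewrite coprimez_sym -NE.
Qed.

(** For even r the power of [epsilon] is [(-1 / d) ^ (r / 2)], the origin of the sign in delta_n.
    For odd r, [(2 / d) (D / d) = (2 D / d) = (4 a / d) = (a / d)], the origin of its 1/2. The
    equation for a constrains it only for even r, the implication only for odd r. *)
Lemma multiplier_delta (r : nat) (c d D : int) (a : int) : odd `|d| -> 0 < d -> coprimez c d -> 
  a = (if odd r.+1 then (-1) ^+ r./2 * D else a) -> (odd r -> 4 * a = 2 * D /\ 0 < a) ->
  ((kronecker c d * kronecker 2 d) ^+ r * kronecker D d)%:~R * (epsilon R d)^-1 ^+ r =
  (kronecker a d)%:~R * (if odd r then (kronecker c d)%:~R ^+ r * (epsilon R d)^-1 ^+ r else 1).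
Proof.
move=> od d0 cd aE aO; have c2 : kronecker c d ^+ 2 = 1 by exact: kronecker_sqr.
have two2 : kronecker 2 d ^+ 2 = 1.
  by apply: kronecker_sqr => //; rewrite /coprimez /gcdz eqz_nat -[_ == _]/(coprime _ _) coprime2n.
case: ifP => ro; last first.
  have rE : r = (r./2 * 2)%N by have := odd_double_half r; rewrite ro; lia.
  have -> : (kronecker c d * kronecker 2 d) ^+ r = 1.
    have e1 : (kronecker c d * kronecker 2 d) ^+ 2 = 1 by rewrite exprMn c2 two2 mulr1.
    by rewrite rE mulnC exprM e1 expr1n.
  rewrite mul1r mulr1 {1}rE mulnC exprM epsilonV_sqr -(kronecker_N1 od d0) -rmorphXn -intrM /=.
  by rewrite aE /= ro /= kronecker_mull // kronecker_expl // mulrC.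
have [a4 a0] := aO ro.
rewrite -(kronecker_mul4 a0 od) a4 kronecker_mull // mulrA.
congr (_ * _); rewrite -rmorphXn -intrM /=; congr (_%:~R).
rewrite exprMn.
have -> : kronecker 2 d ^+ r = kronecker 2 d.
  by rewrite -(odd_double_half r) ro exprD -mul2n exprM two2 expr1n mulr1.
ring.
Qed.

End Main.

Theorem theorem1p1 (R : realType) (K : fieldExtType rat) (n : nat) (dK : int)
    (n_ge2 : (2 <= n)%N) (degK : \dim {:K} = n)
    (realK : totally_real K R) (discK : is_discriminant K dK)
    (fundK : fundamental_discriminant dK) (copK : coprimez n%:Z dK) :
  theta R K \in modular_forms (n%:Z - 1) (2 * n%:Z * dK)
    (kronecker_character R (2 * n%:Z * dK) (delta_mul n dK)).
Proof.
case: n n_ge2 degK copK => [//|r] r_gt0 degK copK.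
have d0 := fundamental_discriminant_neq0 fundK.
have [A [symA posA evenA detA thetaE]] := trace_zero_theta degK realK discK d0 copK.
have [m0 [P [Q [s [s_gt0 PQ QP PAP]]]]] := diagonalized_form symA posA.
have hs := @has_sum_lattice_theta R r m0 A P Q s s_gt0 PQ QP PAP.
have {}thetaE z : 0 < complex.Im z -> theta R K z = @lattice_theta R r A z.
  by move=> z0; apply: thetaE => //; exact: hs.
(* The sign of the discriminant comes from positive definiteness: [det P ^ 2 * det A] is the
   positive number [2 ^ r] times the product of the [s i]. *)
have D0 : 0 < r.+1%:Z * dK.
  have /andP[dP _] := det_neq0 s_gt0 PAP.
  have P2 : 0 < \det P ^+ 2 by rewrite exprn_even_gt0.
  rewrite -detA -(pmulr_rgt0 _ P2) (det_diagonalization PAP) mulr_gt0 ?exprn_gt0 //.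
  by apply: prodr_gt0 => i _; rewrite ltz_nat.
have chiP := delta_character R fundK copK D0.
set N := 2 * r.+1%:Z * dK in chiP *; set a := delta_mul r.+1 dK in chiP *; set chi := kronecker_character R N a in chiP *.
have ND : N = 2 * \det A by rewrite detA /N mulrA.
have kE : r.+1%:Z - 1 = r by rewrite intS addrC addKr.
have k2 : (2 %| r.+1%:Z - 1)%Z = ~~ odd r by rewrite kE dvdzE /= dvdn2.
have hp (w : R[i]) (x : nat) : half_power w x = sqrtc w ^+ x by [].
have hpN (w : R[i]) (x : nat) : half_power w (- x%:Z) = (sqrtc w ^+ x)^-1 by rewrite /half_power -exprnN.
have aodd : odd r -> 4 * a = 2 * \det A /\ 0 < a.
  move=> ro; have aE : a = (r.+1./2)%:Z * dK by rewrite /a /delta_mul /= ro.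
  have e2 : r.+1%:Z = 2 * (r.+1./2)%:Z by have := odd_double_half r.+1; rewrite /= ro; lia.
  have e : 4 * a = 2 * \det A by rewrite aE detA e2; ring.
  by split=> //; move: D0; rewrite -detA; lia.
have aeven : a = if odd r.+1 then (-1) ^+ r./2 * \det A else a.
  by rewrite {1}/a /delta_mul; case: ifP => //= ro; rewrite detA mulrA.
have N4 : odd r -> (4 %| N)%Z.
  by move=> ro; have [a4 _] := aodd ro; rewrite ND -a4 dvdz_mulr.
have N0 : 0 < N by rewrite ND detA mulr_gt0.
apply: mem_set; split.
- by split => //; rewrite k2 negbK.
- exact: chiP.
- move=> z z0.
  apply: (@derivable_exponential_sum R _ (fun=> 1) (fun x => pi * (lattice_norm A x)%:~R)) => //.
    by move=> x; rewrite mulr_ge0 ?pi_ge0 // ler0z; exact: (lattice_norm_ge0 PQ PAP).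
  move=> w w0; rewrite thetaE //; apply: has_sum_ext (hs w w0) => x.
  by rewrite mul1r /lattice_term; congr cexp; rewrite RCM RC_int; ring.
- move=> g z [gdet gN] z0.
  have det : g 0 0 * g 1 1 - g 0 1 * g 1 0 = 1 by rewrite -det_mx2.
  have Dg : (2 * \det A %| g 1%R 0%R)%Z by rewrite -ND.
  have X0 : denom g z != 0.
    apply: denom_neq0 => //; rewrite -negb_and; apply/negP => /andP[/eqP c0 /eqP d00].
    by move: det; rewrite c0 d00 !mulr0 subr0.
  have gz0 : 0 < complex.Im (moebius g z).
    by rewrite /moebius (Im_moebius det X0) divr_gt0 // exprn_gt0 // cabs_gt0.
  rewrite !thetaE // /automorphy_factor k2 kE hp.
  have cd : coprimez (g 1 0) (g 1 1) by apply/coprimezP; exists (- g 0 1, g 0 0) => /=; rewrite -det; ring.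
  have dN : coprimez (g 1 1) N.
    rewrite coprimez_sym; move: gN cd; rewrite dvdzE /coprimez /gcdz !eqz_nat; exact: coprime_dvdl.
  have dodd : odd `|g 1 1|.
    move: dN; rewrite /N -mulrA coprimezMr => /andP[c2 _].
    by move: c2; rewrite /coprimez /gcdz eqz_nat -[_ == _]/(coprime _ _) coprimen2.
  (* Moving d to a good residue requires c to be nonzero; when c = 0 the matrix is a translation up
     to sign. *)
  have [c0|c0] := eqVneq (g 1 0) 0.
    have chi_d : chi (g 1 1) = (kronecker a (g 1 1))%:~R by rewrite /chi /kronecker_character dN.
    rewrite chi_d; have [[a1 d1]|[a1 d1]] : (g 0 0 = 1 /\ g 1 1 = 1) \/ (g 0 0 = -1 /\ g 1 1 = -1).
    - have : (`|g 0%R 0%R| * `|g 1%R 1%R| = 1)%N by rewrite -abszM; move: det; rewrite c0 mulr0 subr0 => ->.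
      by move=> /eqP; rewrite muln_eq1 => /andP[/eqP ha /eqP hd]; move: det; rewrite c0 mulr0 subr0; clear -ha hd; nia.
    - have X1 : denom g z = 1 by rewrite /denom c0 d1 mul0r add0r.
      have -> : moebius g z = z + (g 0 1)%:~R by rewrite /moebius X1 a1 mul1r divr1.
      rewrite (lattice_theta_translate evenA) X1 sqrtc1 expr1n !mulr1 c0 d1 quad_char0 //.
      have k1 : kronecker a 1 = 1 by rewrite kronecker_jacobi // jacobi1.
      have -> : epsilon R 1 = 1 by [].
      by rewrite k1 !mulr1z !exp1rz !mulr1; case: ifP; rewrite mul1r.
    have X1 : denom g z = -1 by rewrite /denom c0 d1 mul0r add0r mulrNz.
    have -> : moebius g z = z + (- g 0 1)%:~R.
      by rewrite /moebius X1 a1 mulrNz invrN invr1 mulrN1 mulN1r opprD opprK -[- (g 0 1)%:~R]mulrNz.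
    rewrite (lattice_theta_translate evenA) X1 sqrtN1 -/(ci : R[i]) c0 d1 quad_char0 //.
    have cn : ci != 0 :> R[i] by rewrite -cabs_eq0 cabs_ci oner_eq0.
    rewrite kronecker_jacobi // jacobi1 mulr1 mulr1z exp1rz mulr1.
    have -> : epsilon R (-1) = ci by [].
    (* At -1 the root contributes [i ^ r]. For odd r it cancels [epsilon (-1) ^ (- r)], and a > 0;
       for even r it equals [(-1) ^ (r / 2)], the sign of a, which is the symbol (a / -1). *)
    case: (boolP (odd r)) => ro /=.
      have [_ a0] := aodd ro.
      by rewrite ltNge ltW //= mul1r -exprnN mulVf ?mul1r // expf_neq0.
    have rE : r = (2 * r./2)%N by rewrite mul2n -[LHS]odd_double_half (negbTE ro).
    have DA : 0 < \det A by rewrite detA.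
    rewrite aeven /= ro [X in ci ^+ X]rE exprM [ci ^+ 2]expr2 ciM -signr_odd -[(-1) ^+ r./2 in RHS]signr_odd.
    by case: odd; rewrite /= ?expr0 ?expr1 ?mul1r ?mulN1r ?oppr_lt0 ?DA ?(ltNge _ 0) ?(ltW DA) /= ?mulrNz ?mulrNN ?mulr1z ?mul1r.
  have [t [t0 todd tD ->]] := lattice_theta_gamma0 s_gt0 PQ QP PAP evenA det Dg c0 z0.
  rewrite -/(denom g z).
  have ct : coprimez (g 1 0) (g 1 1 + g 1 0 * t).
    by apply/coprimezP; exists (- (g 0 1 + g 0 0 * t), g 0 0) => /=; rewrite -det; ring.
  rewrite (multiplier_delta R todd t0 ct aeven aodd).
  (* The shift t disappears here: c is a multiple of N, and chi has period N. *)
  have chiE : chi (g 1 1) = (kronecker a (g 1 1 + g 1 0 * t))%:~R.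
    have [q cq] := dvdzP gN; rewrite -(dirichlet_character_periodic (g 1 1) (q * t) chiP).
    have -> : g 1 1 + N * (q * t) = g 1 1 + g 1 0 * t by rewrite cq; ring.
    rewrite /chi /kronecker_character ifT // coprimez_sym.
    by move: gN ct; rewrite dvdzE /coprimez /gcdz !eqz_nat; exact: coprime_dvdl.
  rewrite chiE; case: (boolP (odd r)) => ro /=; last by rewrite mulr1.
  have c4 : (4 %| g 1%R 0%R)%Z := dvdz_trans (N4 ro) gN.
  rewrite quad_charE // kronecker_period4 //.
  rewrite epsilon_mod4 //.
  by rewrite -exprnN exprVn !mulrA.
- move=> g gdet.
  have det : g 0 0 * g 1 1 - g 0 1 * g 1 0 = 1 by rewrite -det_mx2.
  have [h [b [h0 hb]]] := lattice_theta_cusps R s_gt0 PQ QP PAP evenA det.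
  exists h, b; split=> // z z0.
  have X0 : denom g z != 0.
    apply: denom_neq0 => //; rewrite -negb_and; apply/negP => /andP[/eqP c0 /eqP d00].
    by move: det; rewrite c0 d00 !mulr0 subr0.
  have gz0 : 0 < complex.Im (moebius g z).
    by rewrite /moebius (Im_moebius det X0) divr_gt0 // exprn_gt0 // cabs_gt0.
  rewrite thetaE // kE hpN.
  exact: (has_sum_series (hb z z0)).
Qed.
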